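(* Let $\delta_1,\delta_2\in\mathbb{R}$. Let $(M^{2m},\varphi,g)$ be a para-Kähler–Norden manifold and let its tangent bundle $TM$ be endowed with the $\varphi$-Sasaki metric $g^{\varphi}$. A vector field $\xi$ on $M$ is an interpolating sesqui-harmonic vector field if and only if $$\delta_1\bar{\Delta}\xi+\delta_2\bar{\Delta}^2\xi-\delta_2\mathrm{Tr}_g\big((\nabla_{\ast}R)(\ast,S(\xi))\xi+R(\ast,\nabla_{\ast}S(\xi))\xi+2R(\ast,S(\xi))\nabla_{\ast}\xi\big)=0.$$
   Context: All manifolds, maps and tensor fields are smooth. A para-Kähler–Norden manifold $(M^{2m},\varphi,g)$ is a $2m$-dimensional manifold $M$ with a Riemannian metric $g$ and a $(1,1)$-tensor field $\varphi$ such that $\varphi^2=I$, $\varphi\neq\pm I$, the $+1$ and $-1$ eigenbundles of $\varphi$ have the same rank, $g(\varphi V,W)=g(V,\varphi W)$ for all vector fields $V,W$, and $\nabla\varphi=0$, where $\nabla$ is the Levi-Civita connection of $g$. $R(X,Y)Z=\nabla_X\nabla_YZ-\nabla_Y\nabla_XZ-\nabla_{[X,Y]}Z$ is the curvature tensor of $g$. $\mathrm{Tr}_g$ of an expression containing two asterisks means $\sum_i$ of the expression with both asterisks replaced by $e_i$, for a local $g$-orthonormal frame $\{e_i\}$. For a vector field $W$ on $M$, ${}^{H}W$ and ${}^{V}W$ are its horizontal (with respect to $\nabla$) and vertical lifts to $TM$. The $\varphi$-Sasaki metric $g^{\varphi}$ is the pseudo-Riemannian metric on $TM$ with $g^{\varphi}({}^{H}W,{}^{H}Z)=g(W,Z)$,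 $g^{\varphi}({}^{H}W,{}^{V}Z)=0$, $g^{\varphi}({}^{V}W,{}^{V}Z)=g(W,\varphi Z)$ (the right-hand sides being composed with the projection $TM\to M$). A vector field $\xi$ on $M$ is regarded as a map $\xi:(M,g)\to(TM,g^{\varphi})$. For a vector field $X$ on $M$, $\bar{\Delta}X=-\mathrm{Tr}_g(\nabla_{\ast}\nabla_{\ast}-\nabla_{\nabla_{\ast}\ast})X$ is the rough Laplacian, $\bar{\Delta}^2X=\bar{\Delta}\bar{\Delta}X$, and $S(\xi)=\mathrm{Tr}_gR(\varphi\xi,\nabla_{\ast}\xi)\ast$. The interpolating sesqui-energy is $E_{\delta_1,\delta_2}(\xi)=\delta_1\int|d\xi|^2v_g+\delta_2\int|\tau(\xi)|^2v_g$, where $|d\xi|^2=\mathrm{Tr}_g\,g^{\varphi}(d\xi(\ast),d\xi(\ast))$, $\tau(\xi)=\mathrm{Tr}_g\nabla d\xi$ is the tension field of the map $\xi$, and $|\tau(\xi)|^2=g^{\varphi}(\tau(\xi),\tau(\xi))$. The vector field $\xi$ is an interpolating sesqui-harmonic vector field (for given $\delta_1,\delta_2$) if it is a critical point of $E_{\delta_1,\delta_2}$ when variations are restricted to maps induced by vector fields, i.e. $\frac{d}{dt}E_{\delta_1,\delta_2}(\xi_t)|_{t=0}=0$ for every smooth variation $\xi_t$ of $\xi_0=\xi$ through vector fields; when $M$ is non-compact, the energy is integrated over an open set $D\subset M$ with compact closure and the variation is supported in $D$, for arbitrary such $D$. *)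

(* Defs.v *)
(* Smooth manifolds, tensor fields and maps are handled through the charts of
   an atlas.  A tangent vector is a row vector of components in a chart, and a
   (1,1)-tensor acts on it by right multiplication.  All differential operators
   are local, so they are applied to functions defined on the whole coordinate
   space although only their values on the image of a chart are meaningful. *)
From HB Require Import structures.
From mathcomp Require Import all_boot all_order all_algebra.
From mathcomp Require Import all_classical all_reals all_analysis.
From mathcomp Require Import ring.

Set Implicit Arguments.
Unset Strict Implicit.
Unset Printing Implicit Defensive.

Import Order.TTheory GRing.Theory Num.Theory.
Import numFieldNormedType.Exports.

Local Open Scope classical_set_scope.
Local Open Scope ring_scope.

Section Smooth.
Variables (R : realType) (V W : normedModType R).

Definition iterD (s : seq V) (f : V -> W) : V -> W :=
  foldr (fun v h x => 'D_v h x) f s.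

Definition smooth_on (U : set V) (f : V -> W) : Prop :=
  forall (s : seq V) (x : V), U x -> differentiable (iterD s f) x.

End Smooth.

(* A local vector field: its components as functions of the coordinates. *)
Notation vfield R n := ('rV[R]_n -> 'rV[R]_n).
(* A local field of n x n matrices: components of a metric or an endomorphism. *)
Notation mfield R n := ('rV[R]_n -> 'M[R]_n).

Section Local.
Variables (R : realType).

Definition bform n (A : 'M[R]_n) (v w : 'rV[R]_n) : R := (v *m A *m w^T) 0 0.

(* Christoffel symbol of the k-th component, lower indices i, j. *)
Definition christoffel n (G : mfield R n) (x : 'rV[R]_n) (k i j : 'I_n) : R :=
  2^-1 * \sum_l invmx (G x) k l *
    (('D_(delta_mx 0 i) G x) j l + ('D_(delta_mx 0 j) G x) i l
     - ('D_(delta_mx 0 l) G x) i j).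

Definition Gam n (G : mfield R n) (x v w : 'rV[R]_n) : 'rV[R]_n :=
  \row_k \sum_i \sum_j christoffel G x k i j * v 0 i * w 0 j.

(* Levi-Civita connection. *)
Definition nabla n (G : mfield R n) (X Y : vfield R n) : vfield R n :=
  fun x => 'D_(X x) Y x + Gam G x (X x) (Y x).

Definition bracket n (X Y : vfield R n) : vfield R n :=
  fun x => 'D_(X x) Y x - 'D_(Y x) X x.

Definition curv n (G : mfield R n) (X Y Z : vfield R n) : vfield R n :=
  fun x => nabla G X (nabla G Y Z) x - nabla G Y (nabla G X Z) x
           - nabla G (bracket X Y) Z x.

(* (nabla_V R)(X, Y) Z *)
Definition nabla_curv n (G : mfield R n) (V X Y Z : vfield R n) : vfield R n :=
  fun x => nabla G V (curv G X Y Z) x - curv G (nabla G V X) Y Z x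
           - curv G X (nabla G V Y) Z x - curv G X Y (nabla G V Z) x.

Definition endo_app n (phi : mfield R n) (X : vfield R n) : vfield R n :=
  fun x => X x *m phi x.

(* (nabla_X phi) Y *)
Definition nabla_endo n (G phi : mfield R n) (X Y : vfield R n) : vfield R n :=
  fun x => nabla G X (endo_app phi Y) x - endo_app phi (nabla G X Y) x.

Definition orthonormal_frame n (G : mfield R n) (x : 'rV[R]_n)
    (e : 'I_n -> vfield R n) : Prop :=
  exists U : set 'rV[R]_n, [/\ open U, U x, forall i, smooth_on U (e i) &
    forall y, U y -> forall i j, bform (G y) (e i y) (e j y) = (i == j)%:R].

(* Some smooth orthonormal frame on a neighborhood of x. *)
Definition frame n (G : mfield R n) (x : 'rV[R]_n) : 'I_n -> vfield R n :=
  xget (fun=> fun=> 0) [set e | orthonormal_frame G x e].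

(* Trace at x: T e is the value at x of the traced expression, with both
   asterisks replaced by the local vector field e. *)
Definition Tr n (W : zmodType) (G : mfield R n) (x : 'rV[R]_n)
    (T : vfield R n -> W) : W := \sum_i T (frame G x i).

Definition rough_lap n (G : mfield R n) (X : vfield R n) : vfield R n :=
  fun x => - Tr G x (fun e =>
    nabla G e (nabla G e X) x - nabla G (nabla G e e) X x).

Definition Sfield n (G phi : mfield R n) (xi : vfield R n) : vfield R n :=
  fun x => Tr G x (fun e => curv G (endo_app phi xi) (nabla G e xi) e x).

(* Maps F from coordinates of (M, g) to coordinates of a pseudo-Riemannian
   manifold with metric H. *)
Definition dmap n k (F : 'rV[R]_n -> 'rV[R]_k) (X : vfield R n)
  : 'rV[R]_n -> 'rV[R]_k := fun x => 'D_(X x) F x.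

Definition sq_dmap n k (G : mfield R n) (H : mfield R k)
    (F : 'rV[R]_n -> 'rV[R]_k) (x : 'rV[R]_n) : R :=
  Tr G x (fun e => bform (H (F x)) (dmap F e x) (dmap F e x)).

(* Second fundamental form (nabla dF)(X, Y); the first two terms are the
   pullback connection applied to the field dF(Y) along F. *)
Definition nabla_dmap n k (G : mfield R n) (H : mfield R k)
    (F : 'rV[R]_n -> 'rV[R]_k) (X Y : vfield R n) : 'rV[R]_n -> 'rV[R]_k :=
  fun x => 'D_(X x) (dmap F Y) x + Gam H (F x) (dmap F X x) (dmap F Y x)
           - dmap F (nabla G X Y) x.

Definition tension n k (G : mfield R n) (H : mfield R k)
    (F : 'rV[R]_n -> 'rV[R]_k) (x : 'rV[R]_n) : 'rV[R]_k :=
  Tr G x (fun e => nabla_dmap G H F e e x).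

(* Coordinates on the tangent bundle: z = (x, u), with x the coordinates of the
   base point and u the components of the tangent vector. *)
Definition hlift n (G : mfield R n) (W : vfield R n) : vfield R (n + n) :=
  fun z => row_mx (W (lsubmx z)) (- Gam G (lsubmx z) (W (lsubmx z)) (rsubmx z)).

Definition vlift n (W : vfield R n) : vfield R (n + n) :=
  fun z => row_mx 0 (W (lsubmx z)).

(* The vector W at the base point such that a is the sum of a horizontal vector
   and of the vertical lift of W. *)
Definition vpart n (G : mfield R n) (z a : 'rV[R]_(n + n)) : 'rV[R]_n :=
  rsubmx a + Gam G (lsubmx z) (lsubmx a) (rsubmx z).

(* Components of the phi-Sasaki metric; see sasakiHH, sasakiHV, sasakiVV. *)
Definition sasaki n (G phi : mfield R n) : mfield R (n + n) :=
  fun z => let x := lsubmx z in \matrix_(i, j)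
    let a := delta_mx 0 i in let b := delta_mx 0 j in
    (bform (G x) (lsubmx a) (lsubmx b)
     + bform (G x) (vpart G z a) (vpart G z b *m phi x)).

(* A vector field as a map into the tangent bundle. *)
Definition as_map n (X : vfield R n) : 'rV[R]_n -> 'rV[R]_(n + n) :=
  fun x => row_mx x (X x).

Definition sesqui_lhs n (d1 d2 : R) (G phi : mfield R n) (xi : vfield R n)
  : vfield R n :=
  let S := Sfield G phi xi in
  fun x => d1 *: rough_lap G xi x + d2 *: rough_lap G (rough_lap G xi) x
    - d2 *: Tr G x (fun e => nabla_curv G e e S xi x
                             + curv G e (nabla G e S) xi x
                             + 2 *: curv G e S (nabla G e xi) x).

Lemma GamDl n (G : mfield R n) x v v' w :
  Gam G x (v + v') w = Gam G x v w + Gam G x v' w.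
Proof.
apply/rowP => k; rewrite !mxE -big_split; apply: eq_bigr => i _ /=.
by rewrite -big_split; apply: eq_bigr => j _ /=; rewrite !mxE; ring.
Qed.

Lemma GamZl n (G : mfield R n) x c v w : Gam G x (c *: v) w = c *: Gam G x v w.
Proof.
apply/rowP => k; rewrite !mxE big_distrr; apply: eq_bigr => i _ /=.
by rewrite big_distrr; apply: eq_bigr => j _ /=; rewrite !mxE; ring.
Qed.

Lemma bformE n (A : 'M[R]_n) v w :
  bform A v w = \sum_i \sum_j A i j * v 0 i * w 0 j.
Proof.
rewrite /bform mxE exchange_big; apply: eq_bigr => j _ /=.
by rewrite !mxE big_distrl; apply: eq_bigr => i _ /=; ring.
Qed.

(* The connection is torsion free and metric. *)
Lemma christoffelC n (G : mfield R n) x k i j :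
  (forall l, ('D_(delta_mx 0 l) G x)^T = 'D_(delta_mx 0 l) G x) ->
  christoffel G x k i j = christoffel G x k j i.
Proof.
move=> sym; rewrite /christoffel; congr (_ * _); apply: eq_bigr => l _.
by rewrite -[in LHS](sym l) mxE; ring.
Qed.

Lemma nabla_torsion_free n (G : mfield R n) (X Y : vfield R n) x :
  (forall l, ('D_(delta_mx 0 l) G x)^T = 'D_(delta_mx 0 l) G x) ->
  nabla G X Y x - nabla G Y X x = bracket X Y x.
Proof.
move=> sym; rewrite /nabla /bracket.
suff -> : Gam G x (X x) (Y x) = Gam G x (Y x) (X x).
  by rewrite opprD addrACA subrr addr0.
apply/rowP => k; rewrite !mxE exchange_big; apply: eq_bigr => j _ /=.
by apply: eq_bigr => i _; rewrite (christoffelC k i j sym); ring.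
Qed.

Lemma christoffel_lower n (G : mfield R n) x (k i j : 'I_n) :
  G x \in unitmx -> (G x)^T = G x ->
  \sum_l G x j l * christoffel G x l k i =
  2^-1 * (('D_(delta_mx 0 k) G x) i j + ('D_(delta_mx 0 i) G x) k j
          - ('D_(delta_mx 0 j) G x) k i).
Proof.
move=> Gu sym.
pose T l := ('D_(delta_mx 0 k) G x) i l + ('D_(delta_mx 0 i) G x) k l
          - ('D_(delta_mx 0 l) G x) k i.
transitivity (2^-1 * \sum_p (G x *m invmx (G x)) j p * T p).
  rewrite [in RHS]big_distrr.
  transitivity (\sum_l \sum_p G x j l * (2^-1 * (invmx (G x) l p * T p))).
    by apply: eq_bigr => l _; rewrite /christoffel !big_distrr.
  rewrite exchange_big; apply: eq_bigr => p _ /=.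
  rewrite mxE big_distrl big_distrr; apply: eq_bigr => l _ /=; ring.
rewrite mulmxV// (bigD1 j)//= !mxE eqxx mul1r big1 ?addr0// => p /negbTE pj.
by rewrite !mxE eq_sym pj mul0r.
Qed.

Lemma Gam_metric n (G : mfield R n) x (k i j : 'I_n) :
  G x \in unitmx -> (G x)^T = G x ->
  (forall l, ('D_(delta_mx 0 l) G x)^T = 'D_(delta_mx 0 l) G x) ->
  ('D_(delta_mx 0 k) G x) i j =
  bform (G x) (Gam G x (delta_mx 0 k) (delta_mx 0 i)) (delta_mx 0 j)
  + bform (G x) (delta_mx 0 i) (Gam G x (delta_mx 0 k) (delta_mx 0 j)).
Proof.
move=> Gu sym symD.
have Gd (p q l : 'I_n) : Gam G x (delta_mx 0 p) (delta_mx 0 q) 0 l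
    = christoffel G x l p q.
  rewrite mxE (bigD1 p)//= (bigD1 q)//= !mxE !eqxx/= !mulr1.
  rewrite big1 ?addr0 => [|r /negbTE rq]; last by rewrite !mxE rq mulr0.
  rewrite big1 ?addr0 // => r /negbTE rp.
  by apply: big1 => s _; rewrite !mxE rp mulr0 mul0r.
have sb v w : bform (G x) v w = bform (G x) w v.
  rewrite !bformE exchange_big; apply: eq_bigr => a _ /=; apply: eq_bigr => b _.
  by rewrite -[in LHS]sym mxE; ring.
have E (p q r : 'I_n) : bform (G x) (delta_mx 0 r)
    (Gam G x (delta_mx 0 p) (delta_mx 0 q))
    = \sum_l G x r l * christoffel G x l p q.
  rewrite bformE (bigD1 r)//= [X in _ + X]big1 ?addr0 => [|s /negbTE sr].
    by apply: eq_bigr => l _; rewrite Gd mxE !eqxx mulr1.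
  by apply: big1 => l _; rewrite !mxE sr mulr0 mul0r.
rewrite sb !E !christoffel_lower//.
have s3 (a b c : 'I_n) :
    ('D_(delta_mx 0 a) G x) b c = ('D_(delta_mx 0 a) G x) c b.
  by rewrite -[in LHS]symD mxE.
rewrite (s3 k j i) (s3 i k j) (s3 j k i) /=; by field.
Qed.

Let linear_formE k (F : 'rV[R]_k -> R) a :
  (forall c u v, F (c *: u + v) = c * F u + F v) ->
  F a = \sum_i a 0 i * F (delta_mx 0 i).
Proof.
move=> lF; rewrite [in LHS](row_sum_delta a).
elim: (index_enum _) => [|i s IH]; last by rewrite !big_cons lF IH.
by rewrite !big_nil; have := lF (-1) 0 0; rewrite scaler0 addr0 mulN1r addNr.
Qed.

Let bform_linl k (A : 'M[R]_k) c u v w :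
  bform A (c *: u + v) w = c * bform A u w + bform A v w.
Proof. by rewrite /bform !mulmxDl -!scalemxAl !mxE. Qed.

Let bform_linr k (A : 'M[R]_k) c u v w :
  bform A w (c *: u + v) = c * bform A w u + bform A w v.
Proof. by rewrite /bform linearP mulmxDr -scalemxAr !mxE. Qed.

Let bform0l k (A : 'M[R]_k) w : bform A 0 w = 0.
Proof. by rewrite /bform !mul0mx mxE. Qed.

Let bform0r k (A : 'M[R]_k) w : bform A w 0 = 0.
Proof. by rewrite /bform trmx0 mulmx0 mxE. Qed.

Let vpart_lin n (G : mfield R n) z c a b :
  vpart G z (c *: a + b) = c *: vpart G z a + vpart G z b.
Proof. by rewrite /vpart !linearP GamDl GamZl scalerDr addrACA. Qed.

(* The components of the phi-Sasaki metric satisfy, and are determined by, the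
   defining identities on lifts. *)
Lemma sasakiE n (G phi : mfield R n) z a b :
  bform (sasaki G phi z) a b =
  bform (G (lsubmx z)) (lsubmx a) (lsubmx b)
  + bform (G (lsubmx z)) (vpart G z a) (vpart G z b *m phi (lsubmx z)).
Proof.
pose B a b := bform (G (lsubmx z)) (lsubmx a) (lsubmx b)
  + bform (G (lsubmx z)) (vpart G z a) (vpart G z b *m phi (lsubmx z)).
rewrite -/(B a b) bformE (@linear_formE _ (B ^~ b)); last first.
  by move=> c u v; rewrite /B linearP vpart_lin !bform_linl mulrDr addrACA.
apply: eq_bigr => i _; rewrite (@linear_formE _ (B (delta_mx 0 i))).
  rewrite big_distrr; apply: eq_bigr => j _ /=.
  transitivity (B (delta_mx 0 i) (delta_mx 0 j) * a 0 i * b 0 j).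
    by rewrite mxE.
  by rewrite mulrAC mulrC [B _ _ * _]mulrC.
move=> c u v; rewrite /B linearP vpart_lin mulmxDl -scalemxAl.
by rewrite !bform_linr mulrDr addrACA.
Qed.

Lemma vpart_hlift n (G : mfield R n) (W : vfield R n) z :
  vpart G z (hlift G W z) = 0.
Proof. by rewrite /vpart /hlift row_mxKl row_mxKr addNr. Qed.

Lemma vpart_vlift n (G : mfield R n) (W : vfield R n) z :
  vpart G z (vlift W z) = W (lsubmx z).
Proof.
rewrite /vpart /vlift row_mxKl row_mxKr.
have G0 x w : Gam G x 0 w = 0; last by rewrite G0 addr0.
apply/rowP => k; rewrite !mxE big1 // => i _.
by apply: big1 => j _; rewrite mxE mulr0 mul0r.
Qed.

Lemma sasakiHH n (G phi : mfield R n) (W Z : vfield R n) z :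
  bform (sasaki G phi z) (hlift G W z) (hlift G Z z) =
  bform (G (lsubmx z)) (W (lsubmx z)) (Z (lsubmx z)).
Proof.
rewrite sasakiE !vpart_hlift /hlift !row_mxKl mul0mx.
by rewrite bform0l addr0.
Qed.

Lemma sasakiHV n (G phi : mfield R n) (W Z : vfield R n) z :
  bform (sasaki G phi z) (hlift G W z) (vlift Z z) = 0.
Proof.
rewrite sasakiE vpart_hlift /hlift /vlift !row_mxKl.
by rewrite bform0l bform0r addr0.
Qed.

Lemma sasakiVV n (G phi : mfield R n) (W Z : vfield R n) z :
  bform (sasaki G phi z) (vlift W z) (vlift Z z) =
  bform (G (lsubmx z)) (W (lsubmx z)) (Z (lsubmx z) *m phi (lsubmx z)).
Proof.
rewrite sasakiE !vpart_vlift /vlift !row_mxKl.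
by rewrite bform0l add0r.
Qed.

End Local.

(* Iterated Lebesgue integral over R^n; by Tonelli it is the integral of f
   against n-dimensional Lebesgue measure when f is Borel and nonnegative. *)
Fixpoint lebesgue_int (R : realType) (n : nat)
  : ('rV[R]_n -> \bar R) -> \bar R :=
  match n return ('rV[R]_n -> \bar R) -> \bar R with
  | 0 => fun f => f 0
  | n'.+1 => fun f => (\int[@lebesgue_measure R]_t
      lebesgue_int (fun y : 'rV[R]_n' => f (row_mx (t%:M : 'rV[R]_1) y)))%E
  end.

(* A smooth n-manifold (nonempty, since the space is pointed) with an atlas
   indexed by chart. *)
Record manifold (R : realType) (n : nat) := Manifold {
  mspace :> ptopologicalType ;
  mspace_hausdorff : hausdorff_space mspace ;
  mspace_countable : @second_countable mspace ;
  chart : Type ;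
  dom : chart -> set mspace ;
  coord : chart -> mspace -> 'rV[R]_n ;
  param : chart -> 'rV[R]_n -> mspace ;
  dom_open : forall c, open (dom c) ;
  dom_cover : forall p, exists c, dom c p ;
  img_open : forall c, open (coord c @` dom c) ;
  coordK : forall c p, dom c p -> param c (coord c p) = p ;
  coord_continuous : forall c, {in dom c, continuous (coord c)} ;
  param_continuous : forall c, {in coord c @` dom c, continuous (param c)} ;
  transition_smooth : forall c d,
    smooth_on (coord c @` (dom c `&` dom d)) (coord d \o param c) }.

Section Manifold.
Variables (R : realType) (n : nat) (M : manifold R n).
Implicit Types (c d : chart M) (p : M) (x v w : 'rV[R]_n).

Definition img c : set 'rV[R]_n := coord c @` dom c.

Definition chart_at p : chart M := projT1 (cid (dom_cover p)).

(* Components in the chart d of the tangent vector at p with components v in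
   the chart c. *)
Definition tchange c d p v : 'rV[R]_n :=
  'D_v (coord d \o param c) (coord c p).

Record vector_field := VectorField {
  vcomp :> chart M -> vfield R n ;
  vcomp_smooth : forall c, smooth_on (img c) (vcomp c) ;
  vcomp_change : forall c d p, dom c p -> dom d p ->
    vcomp d (coord d p) = tchange c d p (vcomp c (coord c p)) }.

Record endo_field := EndoField {
  ecomp :> chart M -> mfield R n ;
  ecomp_smooth : forall c, smooth_on (img c) (ecomp c) ;
  ecomp_change : forall c d p v, dom c p -> dom d p ->
    tchange c d p v *m ecomp d (coord d p)
    = tchange c d p (v *m ecomp c (coord c p)) }.

Record riemannian_metric := RiemannianMetric {
  gcomp :> chart M -> mfield R n ;
  gcomp_smooth : forall c, smooth_on (img c) (gcomp c) ;
  gcomp_sym : forall c x, img c x -> (gcomp c x)^T = gcomp c x ;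
  gcomp_pos : forall c x v, img c x -> v != 0 -> 0 < bform (gcomp c x) v v ;
  gcomp_change : forall c d p v w, dom c p -> dom d p ->
    bform (gcomp d (coord d p)) (tchange c d p v) (tchange c d p w)
    = bform (gcomp c (coord c p)) v w }.

(* Measures on the Borel subsets of M. *)
Definition borel_measure :=
  {measure set (g_sigma_algebraType (@open M)) -> \bar R}.

(* vg is the Riemannian volume v_g. *)
Definition riemannian_volume (g : riemannian_metric) (vg : borel_measure) :=
  forall c (A : set M), <<s @open M >> A -> A `<=` dom c ->
  vg A = lebesgue_int (fun x =>
    (\1_(coord c @` A) x * Num.sqrt (\det (g c x)))%:E).

Variables (phi : endo_field) (g : riemannian_metric) (vg : borel_measure).

(* |d xi|^2 as a function on M *)
Definition dxi_density (xi : vector_field) (p : M) : R :=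
  let c := chart_at p in
  sq_dmap (g c) (sasaki (g c) (phi c)) (as_map (xi c)) (coord c p).

(* |tau(xi)|^2 as a function on M *)
Definition tau_density (xi : vector_field) (p : M) : R :=
  let c := chart_at p in
  let x := coord c p in
  let h := sasaki (g c) (phi c) in
  let tau := tension (g c) h (as_map (xi c)) x in
  bform (h (as_map (xi c) x)) tau tau.

Definition sesqui_energy (d1 d2 : R) (D : set M) (xi : vector_field) : R :=
  d1 * (\int[vg]_(p in D) dxi_density xi p)
  + d2 * (\int[vg]_(p in D) tau_density xi p).

Definition eq_at (X Y : vector_field) (p : M) :=
  forall c, dom c p -> X c (coord c p) = Y c (coord c p).

(* xit_t, |t| < eps, is a smooth variation of xi through vector fields. *)
Definition smooth_variation (xi : vector_field) (eps : R)
    (xit : R -> vector_field) : Prop :=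
  (forall p, eq_at (xit 0) xi p) /\
  (forall c, smooth_on [set z : R * 'rV[R]_n | `|z.1| < eps /\ img c z.2]
                       (fun z => xit z.1 c z.2)).

Definition supported_in (xi : vector_field) (eps : R)
    (xit : R -> vector_field) (D : set M) : Prop :=
  closure [set p | exists2 t, `|t| < eps & ~ eq_at (xit t) xi p] `<=` D.

Definition critical_on (d1 d2 : R) (xi : vector_field) (D : set M) : Prop :=
  forall (eps : R) (xit : R -> vector_field), 0 < eps ->
    smooth_variation xi eps xit -> supported_in xi eps xit D ->
    is_derive (0 : R) (1 : R) (fun t => sesqui_energy d1 d2 D (xit t)) 0.

Definition interpolating_sesqui_harmonic (d1 d2 : R) (xi : vector_field) :=
  (compact [set: M] -> critical_on d1 d2 xi [set: M]) /\
  (~ compact [set: M] -> forall D : set M, open D -> compact (closure D) ->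
     critical_on d1 d2 xi D).

End Manifold.

Definition para_kahler_norden (R : realType) (m : nat)
    (M : manifold R (2 * m)) (phi : endo_field M) (g : riemannian_metric M) :=
  [/\ forall (c : chart M) x, img c x -> phi c x *m phi c x = 1%:M,
      ~ (forall (c : chart M) x, img c x -> phi c x = 1%:M) /\
      ~ (forall (c : chart M) x, img c x -> phi c x = - 1%:M),
      forall (c : chart M) x, img c x ->
        \rank (eigenspace (phi c x) 1) = \rank (eigenspace (phi c x) (- 1)),
      forall (c : chart M) x v w, img c x ->
        bform (g c x) (v *m phi c x) w = bform (g c x) v (w *m phi c x) &
      forall (c : chart M) (X Y : vfield R (2 * m)),
        smooth_on (img c) X -> smooth_on (img c) Y ->
        forall x, img c x -> nabla_endo (g c) (phi c) X Y x = 0].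

(* Main.v *)
(* Write L for the rough Laplacian.  The horizontal and vertical parts of tau(xi)
   are S(xi) and -L xi, so |d xi|^2 = 2m + Tr g(nabla xi, phi nabla xi) and
   |tau(xi)|^2 = g(S(xi), S(xi)) + g(L xi, phi L xi).  Differentiating under the
   integral sign along a variation with velocity V supported in one chart, and
   integrating by parts with the help of nabla phi = 0 and of the symmetries of R
   (Lebesgue measure is translation invariant, and Jacobi's formula turns
   divergences into coordinate derivatives), the first variation becomes
   2 int g(LHS, phi V), where LHS is the left-hand side of the equation.  A general
   V is cut into pieces supported in charts by bump functions.  Conversely, if LHS
   does not vanish at a point, take for V a bump function there times phi LHS. *)
Require Import Defs.
From HB Require Import structures.
From mathcomp Require Import all_boot all_order all_algebra.
From mathcomp Require Import all_classical all_reals all_analysis.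
From mathcomp Require Import perm measurable_realfun.
From mathcomp Require Import ring lra.
Set Implicit Arguments.
Unset Strict Implicit.
Unset Printing Implicit Defensive.
Import Order.TTheory GRing.Theory Num.Theory.
Import numFieldNormedType.Exports.
Local Open Scope classical_set_scope.
Local Open Scope ring_scope.

(** * Smooth functions *)

(** The definitions leave choices open: the orthonormal frame of a trace is picked anew at each
    point, and so is the chart in which a density on [M] is computed, so no smoothness in the base
    point is visible. Each traced expression is therefore shown to be a bilinear contraction, which
    allows a frame depending smoothly on the metric, and each density is shown to be invariant under
    transition maps, which are isometries commuting with [phi]. The curvature in tau(xi) arises
    because the vertical part of a constant vector of [TM] has a covariant derivative whose
    antisymmetric part is R. Moving that term to its place uses R(u, phi v) = R(phi u, v), a
    consequence of pair symmetry and of nabla phi = 0. The form g(., phi .) is only nondegenerate,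
    so testing against all vectors replaces positivity. What the bump functions cut up is the first
    variation, which is additive in the velocity, and not the energy. *)

Section SmoothCalculus.
Variable R : realType.
Implicit Types V W : normedModType R.

Lemma derive_translate V W (f : V -> W) (a x v : V) :
  'D_v (fun y => f (y + a)) x = 'D_v f (x + a).
Proof.
have E : (fun h : R => h^-1 *: (f (h *: v + x + a) - f (x + a))) =
    (fun h => h^-1 *: (f (h *: v + (x + a)) - f (x + a))).
  by apply/funext => h; rewrite addrA.
exact: (congr1 (fun F : R -> W => lim (F @ 0^')) E).
Qed.

Opaque derive.

(** The difference [g - f] vanishes near [x], so the zero map is its differential; adding it to [f]
    transports differentiability. *)
Lemma near_eq_differentiable V W (f g : V -> W) x :
  {near x, f =1 g} -> differentiable f x -> differentiable g x.
Proof.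
move=> fg df.
have -> : g = f + (g - f) by rewrite addrC subrK.
apply: differentiableD => //.
have h0 : \forall z \near x, (g - f) z = 0.
  by near=> z; rewrite !fctE -(near fg z) ?subrr//; near: z.
have h1 : \forall z \near 0, (g - f) (z + x) = 0.
  have cz : (fun z => z + x) @ 0 --> x.
    by rewrite -[X in _ --> X]add0r; apply: cvgD; [exact: cvg_id|exact: cvg_cst].
  exact: (cz _ h0).
have o1 : (g - f) \o shift x = cst ((g - f) x) + 'd (cst 0 : V -> W) x +o_0 id.
  apply/eqaddoP => _/posnumP[e]; near=> z.
  rewrite diff_cst /= /shift /= !fctE /=.
  have -> : g (z + x) - f (z + x) = 0 by near: z; exact: h1.
  have -> : g x - f x = 0 by exact: nbhs_singleton h0.
  rewrite addr0 subrr normr0.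
  exact: mulr_ge0.
have d0 : 'd (g - f) x = 'd (cst 0 : V -> W) x :> (V -> W).
  by apply: diff_unique => //; rewrite diff_cst; exact: cst_continuous.
by apply/diff_locallyP; rewrite d0; split=> //; rewrite diff_cst; exact: cst_continuous.
Unshelve. all: end_near. Qed.

Lemma differentiable_mx V m n (F : V -> 'M[R]_(m, n)) x :
  (forall i j, differentiable (fun y => F y i j) x) -> differentiable F x.
Proof.
move=> dF.
have -> : F = \sum_i \sum_j (fun y => F y i j *: (delta_mx i j : 'M[R]_(m, n))).
  apply/funext => y; rewrite [LHS]matrix_sum_delta fct_sumE.
  by apply: eq_bigr => i _; rewrite fct_sumE.
apply: differentiable_sum => i; apply: differentiable_sum => j.
exact: differentiableZl.
Qed.

Lemma differentiable_entry V m n (F : V -> 'M[R]_(m, n)) x i j :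
  differentiable F x -> differentiable (fun y => F y i j) x.
Proof.
move=> dF.
exact: (differentiable_comp (g := fun N : 'M[R]_(m, n) => N i j) dF
         (differentiable_coord _ i j)).
Qed.

Lemma derive_entry V m n (F : V -> 'M[R]_(m, n)) x v i j :
  differentiable F x -> ('D_v F x) i j = 'D_v (fun y => F y i j) x.
Proof. by move=> dF; rewrite derive_mx ?mxE//; exact: diff_derivable. Qed.

Section Dir.
Variables (V W : normedModType R) (f : V -> W) (x : V).
Hypothesis df : differentiable f x.

Lemma derive_dirD u v : 'D_(u + v) f x = 'D_u f x + 'D_v f x.
Proof. by rewrite !deriveE// linearD. Qed.

Lemma derive_dirZ c v : 'D_(c *: v) f x = c *: 'D_v f x.
Proof. by rewrite !deriveE// linearZ. Qed.

Lemma derive_dirN v : 'D_(- v) f x = - 'D_v f x.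
Proof. by rewrite !deriveE// linearN. Qed.

Lemma derive_dir_sum (I : Type) (r : seq I) (v : I -> V) :
  'D_(\sum_(i <- r) v i) f x = \sum_(i <- r) 'D_(v i) f x.
Proof.
elim: r => [|i r IH]; first by rewrite !big_nil derive0.
by rewrite !big_cons derive_dirD IH.
Qed.
End Dir.

Lemma derive_dir_row n W (f : 'rV[R]_n -> W) x v : differentiable f x ->
  'D_v f x = \sum_i v 0 i *: 'D_(delta_mx 0 i) f x.
Proof.
move=> df; rewrite {1}(row_sum_delta v) derive_dir_sum//.
by apply: eq_bigr => i _; rewrite derive_dirZ.
Qed.

Lemma derive_real W (g : R -> W) (x v : R) :
  differentiable g x -> 'D_v g x = v *: 'D_1 g x.
Proof. by move=> dg; rewrite -derive_dirZ// /GRing.scale/= mulr1. Qed.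

Lemma derive_comp V V' W (f : V -> V') (g : V' -> W) x v :
  differentiable f x -> differentiable g (f x) ->
  'D_v (g \o f) x = 'D_('D_v f x) g (f x).
Proof.
move=> df dg; rewrite deriveE; last exact: differentiable_comp.
by rewrite diff_comp// !deriveE.
Qed.

Lemma smooth_on_differentiable V W (U : set V) (f : V -> W) x :
  smooth_on U f -> U x -> differentiable f x.
Proof. by move=> sf Ux; exact: (sf [::] x Ux). Qed.

Lemma iterD_rcons V W s v (f : V -> W) :
  Defs.iterD (rcons s v) f = Defs.iterD s (fun x => 'D_v f x).
Proof. by rewrite /Defs.iterD foldr_rcons. Qed.

(** [smooth_on] quantifies over lists of directions of every length at once; bounding the length
    gives a statement that can be proved by induction on [k], as the closure properties below
    are. *)
Definition Ck k V W (U : set V) (f : V -> W) :=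
  forall s x, (size s <= k)%N -> U x -> differentiable (Defs.iterD s f) x.

(** The head of the list is the outermost derivative, so the recursion takes off the last element:
    what remains concerns the first derivatives of [f], to which product and chain rules apply. *)
Lemma CkS k V W (U : set V) (f : V -> W) :
  Ck k.+1 U f <-> (forall x, U x -> differentiable f x) /\
                  (forall v, Ck k U (fun x => 'D_v f x)).
Proof.
split => [H|[H0 H] s x].
  split=> [x Ux|v s x ks Ux]; first exact: (H [::]).
  by rewrite -iterD_rcons; apply: H => //; rewrite size_rcons.
case/lastP: s => [_ Ux|s v]; first exact: H0.
by rewrite size_rcons ltnS iterD_rcons; exact: H.
Qed.

Lemma CkW k V W (U : set V) (f : V -> W) : Ck k.+1 U f -> Ck k U f.
Proof. by move=> H s x sk; apply: H; exact: leqW. Qed.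

Lemma Ck_diff k V W (U : set V) (f : V -> W) x :
  Ck k U f -> U x -> differentiable f x.
Proof. by move=> H; apply: (H [::]). Qed.

Lemma smooth_Ck V W (U : set V) (f : V -> W) :
  smooth_on U f <-> forall k, Ck k U f.
Proof.
split=> [H k s x _|H s x Ux]; first exact: H.
exact: (H (size s)).
Qed.

Lemma smooth_on_derive V W (U : set V) (f : V -> W) v :
  smooth_on U f -> smooth_on U (fun x => 'D_v f x).
Proof. by move=> H s x Ux; rewrite -iterD_rcons; exact: H. Qed.

Lemma iterD_eq V W (U : set V) (f g : V -> W) s :
  open U -> (forall x, U x -> f x = g x) ->
  forall x, U x -> Defs.iterD s f x = Defs.iterD s g x.
Proof.
move=> oU fg; elim: s => [|v s IH] x Ux /=; first exact: fg.
apply: near_eq_derive; near=> y; apply: IH; near: y.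
exact: open_nbhs_nbhs.
Unshelve. all: end_near. Qed.

Lemma eq_Ck k V W (U : set V) (f g : V -> W) :
  open U -> (forall x, U x -> f x = g x) -> Ck k U f -> Ck k U g.
Proof.
move=> oU fg H s x sk Ux; apply: (near_eq_differentiable _ (H s x sk Ux)).
near=> y; apply: (iterD_eq s oU fg); near: y.
exact: open_nbhs_nbhs.
Unshelve. all: end_near. Qed.

Lemma eq_smooth_on V W (U : set V) (f g : V -> W) :
  open U -> (forall x, U x -> f x = g x) -> smooth_on U f -> smooth_on U g.
Proof. by move=> oU fg /smooth_Ck H; apply/smooth_Ck => k; exact: eq_Ck (H k). Qed.

Lemma smooth_on_sub V W (U U' : set V) (f : V -> W) :
  U `<=` U' -> smooth_on U' f -> smooth_on U f.
Proof. by move=> UU' H s x /UU'; exact: H. Qed.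

Lemma smooth_onU V W (U U' : set V) (f : V -> W) :
  smooth_on U f -> smooth_on U' f -> smooth_on (U `|` U') f.
Proof. by move=> H H' s x []; [exact: H|exact: H']. Qed.

Lemma Ck_cst k V W (U : set V) (a : W) : Ck k U (cst a : V -> W).
Proof.
elim: k a => [|k IH] a.
  by move=> s x; rewrite leqn0 size_eq0 => /eqP -> _ /=; exact: differentiable_cst.
apply/CkS; split=> [x _|v]; first exact: differentiable_cst.
by rewrite (_ : (fun x => _) = cst 0); [exact: IH|apply/funext => y; rewrite derive_cst].
Qed.

Lemma smooth_on_cst V W (U : set V) (a : W) : smooth_on U (fun _ : V => a).
Proof. by apply/smooth_Ck => k; exact: Ck_cst. Qed.

Lemma CkD k V W (U : set V) (f g : V -> W) : open U ->
  Ck k U f -> Ck k U g -> Ck k U (fun x => f x + g x).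
Proof.
move=> oU; elim: k f g => [|k IH] f g hf hg.
  move=> s x; rewrite leqn0 size_eq0 => /eqP -> Ux /=.
  by apply: differentiableD; [exact: Ck_diff hf _|exact: Ck_diff hg _].
apply/CkS; split=> [x Ux|v].
  by apply: differentiableD; [exact: Ck_diff hf _|exact: Ck_diff hg _].
apply: (@eq_Ck _ _ _ _ (fun x => 'D_v f x + 'D_v g x)) => //.
  move=> x Ux; rewrite deriveD//; apply: diff_derivable.
    exact: Ck_diff hf _.
  exact: Ck_diff hg _.
by apply: IH; [case/CkS: hf|case/CkS: hg].
Qed.

Lemma smooth_onD V W (U : set V) (f g : V -> W) : open U ->
  smooth_on U f -> smooth_on U g -> smooth_on U (fun x => f x + g x).
Proof.
by move=> oU /smooth_Ck hf /smooth_Ck hg; apply/smooth_Ck => k; exact: CkD.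
Qed.

Lemma CkM k V (U : set V) (f g : V -> R) : open U ->
  Ck k U f -> Ck k U g -> Ck k U (fun x => f x * g x).
Proof.
move=> oU; elim: k f g => [|k IH] f g hf hg.
  move=> s x; rewrite leqn0 size_eq0 => /eqP -> Ux /=.
  by apply: differentiableM; [exact: Ck_diff hf _|exact: Ck_diff hg _].
apply/CkS; split=> [x Ux|v].
  by apply: differentiableM; [exact: Ck_diff hf _|exact: Ck_diff hg _].
apply: (@eq_Ck _ _ _ _ (fun x => f x * 'D_v g x + g x * 'D_v f x)) => //.
  move=> x Ux; rewrite deriveM//; apply: diff_derivable.
    exact: Ck_diff hf _.
  exact: Ck_diff hg _.
have [_ hf'] := (CkS _ _ _).1 hf; have [_ hg'] := (CkS _ _ _).1 hg.
by apply: CkD => //; apply: IH => //; exact: CkW.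
Qed.

Lemma smooth_onM V (U : set V) (f g : V -> R) : open U ->
  smooth_on U f -> smooth_on U g -> smooth_on U (fun x => f x * g x).
Proof.
by move=> oU /smooth_Ck hf /smooth_Ck hg; apply/smooth_Ck => k; exact: CkM.
Qed.

Lemma smooth_on_sum V W (U : set V) (I : Type) (r : seq I) (P : pred I)
  (f : I -> V -> W) : open U ->
  (forall i, P i -> smooth_on U (f i)) -> smooth_on U (fun x => \sum_(i <- r | P i) f i x).
Proof.
move=> oU hf; elim: r => [|i r IH].
  by under eq_fun do rewrite big_nil; exact: smooth_on_cst.
case Pi: (P i); under eq_fun do rewrite big_cons Pi //; last exact: IH.
by apply: smooth_onD => //; exact: hf.
Qed.

Lemma smooth_on_prod V (U : set V) (I : Type) (r : seq I)
  (f : I -> V -> R) : open U ->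
  (forall i, smooth_on U (f i)) -> smooth_on U (fun x => \prod_(i <- r) f i x).
Proof.
move=> oU hf; elim: r => [|i r IH].
  by under eq_fun do rewrite big_nil; exact: smooth_on_cst.
under eq_fun do rewrite big_cons.
by apply: smooth_onM.
Qed.

Lemma Ck_entry k V m n (U : set V) (F : V -> 'M[R]_(m, n)) i j : open U ->
  Ck k U F -> Ck k U (fun x => F x i j).
Proof.
move=> oU; elim: k F => [|k IH] F hF.
  move=> s x; rewrite leqn0 size_eq0 => /eqP -> Ux /=.
  by apply: differentiable_entry; exact: Ck_diff hF _.
apply/CkS; split=> [x Ux|v].
  by apply: differentiable_entry; exact: Ck_diff hF _.
apply: (@eq_Ck _ _ _ _ (fun x => ('D_v F x) i j)) => //.
  by move=> x Ux; rewrite derive_entry//; exact: Ck_diff hF _.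
by apply: IH; case/CkS: hF.
Qed.

Lemma Ck_mx k V m n (U : set V) (F : V -> 'M[R]_(m, n)) : open U ->
  (forall i j, Ck k U (fun x => F x i j)) -> Ck k U F.
Proof.
move=> oU; elim: k F => [|k IH] F hF.
  move=> s x; rewrite leqn0 size_eq0 => /eqP -> Ux /=.
  by apply: differentiable_mx => i j; exact: Ck_diff (hF i j) _.
have dF x : U x -> differentiable F x.
  by move=> Ux; apply: differentiable_mx => i j; exact: Ck_diff (hF i j) _.
apply/CkS; split=> // v; apply: IH => i j.
apply: (@eq_Ck _ _ _ _ (fun x => 'D_v (fun y => F y i j) x)) => //.
  by move=> x Ux; rewrite derive_entry//; exact: dF.
by case/CkS: (hF i j).
Qed.

Lemma smooth_on_entry V m n (U : set V) (F : V -> 'M[R]_(m, n)) i j : open U ->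
  smooth_on U F -> smooth_on U (fun x => F x i j).
Proof. by move=> oU /smooth_Ck H; apply/smooth_Ck => k; exact: Ck_entry. Qed.

Lemma smooth_on_mx V m n (U : set V) (F : V -> 'M[R]_(m, n)) : open U ->
  (forall i j, smooth_on U (fun x => F x i j)) -> smooth_on U F.
Proof.
move=> oU H; apply/smooth_Ck => k; apply: Ck_mx => // i j.
by have /smooth_Ck := H i j; exact.
Qed.

Lemma Ck_linear k V W (U : set V) (f : {linear V -> W}) : continuous f -> Ck k U f.
Proof.
move=> cf; case: k => [|k].
  move=> s x; rewrite leqn0 size_eq0 => /eqP -> _ /=.
  exact: linear_differentiable.
apply/CkS; split=> [x _|v]; first exact: linear_differentiable.
rewrite (_ : (fun x => _) = cst (f v)); first exact: Ck_cst.
apply/funext => y; rewrite deriveE; last exact: linear_differentiable.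
by rewrite diff_lin.
Qed.

Lemma smooth_on_linear V W (U : set V) (f : {linear V -> W}) :
  continuous f -> smooth_on U f.
Proof. by move=> cf; apply/smooth_Ck => k; exact: Ck_linear. Qed.

Lemma smooth_on_id V (U : set V) : smooth_on U (fun x : V => x).
Proof. by apply: (@smooth_on_linear _ _ _ (idfun : {linear V -> V})) => x. Qed.

Lemma smooth_on_coord n (U : set 'rV[R]_n) i : smooth_on U (fun x => x 0 i : R).
Proof.
by move=> s x Ux; apply: (@smooth_on_entry _ _ _ setT id) => //;
  [exact: openT|exact: smooth_on_id].
Qed.

Lemma smooth_on_snd V V' (U : set (V * V')) : smooth_on U (fun z => z.2).
Proof.
apply: (@smooth_on_linear _ _ _ (@snd V V' : {linear (V * V')%type -> V'})) => z.
exact: cvg_snd.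
Qed.

(** In coordinates the chain rule reads D_v (g o f) = sum_i (D_v f)_i (d_i g) o f, a sum of products
    of functions of the next lower order, so the induction closes. It generalises [g] because [g]
    gets replaced by its partial derivatives. *)
Lemma Ck_comp_row k V m (U : set V) (U' : set 'rV[R]_m) (f : V -> 'rV[R]_m)
    (g : 'rV[R]_m -> R) : open U -> (forall x, U x -> U' (f x)) ->
  Ck k U f -> Ck k U' g -> Ck k U (fun x => g (f x)).
Proof.
move=> oU UU'; elim: k f g UU' => [|k IH] f g UU' hf hg.
  move=> s x; rewrite leqn0 size_eq0 => /eqP -> Ux /=.
  apply: (@differentiable_comp _ _ _ _ f g); first exact: Ck_diff hf _.
  by apply: Ck_diff hg _; exact: UU'.
have df x : U x -> differentiable f x by exact: Ck_diff hf.
have dg x : U x -> differentiable g (f x) by move=> Ux; apply: Ck_diff hg _; exact: UU'.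
apply/CkS; split=> [x Ux|v].
  by apply: (@differentiable_comp _ _ _ _ f g); [exact: df|exact: dg].
apply: (@eq_Ck _ _ _ _ (fun x => \sum_i ('D_v f x) 0 i * 'D_(delta_mx 0 i) g (f x))) => //.
  move=> x Ux; rewrite (@derive_comp _ _ _ f g) ?derive_dir_row//.
  - exact: dg.
  - exact: df.
  - exact: dg.
have [_ hf'] := (CkS _ _ _).1 hf; have [_ hg'] := (CkS _ _ _).1 hg.
elim: (index_enum _) => [|i r IHr].
  by under eq_fun do rewrite big_nil; exact: Ck_cst.
under eq_fun do rewrite big_cons.
apply: CkD => //; apply: CkM => //; first exact: Ck_entry.
by apply: (IH f (fun y => 'D_(delta_mx 0 i) g y)) => //; exact: CkW.
Qed.

Lemma smooth_on_comp V m p q (U : set V) (U' : set 'rV[R]_m) (f : V -> 'rV[R]_m)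
    (g : 'rV[R]_m -> 'M[R]_(p, q)) : open U -> open U' ->
  (forall x, U x -> U' (f x)) ->
  smooth_on U f -> smooth_on U' g -> smooth_on U (fun x => g (f x)).
Proof.
move=> oU oU' UU' /smooth_Ck hf hg; apply: smooth_on_mx => // i j.
apply/smooth_Ck => k; apply: (@Ck_comp_row _ _ _ _ U' _ (fun y => g y i j)) => //.
by have /smooth_Ck := smooth_on_entry i j oU' hg; exact.
Qed.

Lemma smooth_on_comp_scalar V m (U : set V) (U' : set 'rV[R]_m)
    (f : V -> 'rV[R]_m) (g : 'rV[R]_m -> R) : open U ->
  (forall x, U x -> U' (f x)) ->
  smooth_on U f -> smooth_on U' g -> smooth_on U (fun x => g (f x)).
Proof.
move=> oU UU' /smooth_Ck hf /smooth_Ck hg; apply/smooth_Ck => k.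
exact: (@Ck_comp_row _ _ _ _ U').
Qed.

Lemma Ck_comp_real k V (U : set V) (U' : set R) (f : V -> R)
    (g : R -> R) : open U -> (forall x, U x -> U' (f x)) ->
  Ck k U f -> Ck k U' g -> Ck k U (fun x => g (f x)).
Proof.
move=> oU UU'; elim: k f g UU' => [|k IH] f g UU' hf hg.
  move=> s x; rewrite leqn0 size_eq0 => /eqP -> Ux /=.
  apply: (@differentiable_comp _ _ _ _ f g); first exact: Ck_diff hf _.
  by apply: Ck_diff hg _; exact: UU'.
have df x : U x -> differentiable f x by exact: Ck_diff hf.
have dg x : U x -> differentiable g (f x) by move=> Ux; apply: Ck_diff hg _; exact: UU'.
apply/CkS; split=> [x Ux|v].
  by apply: (@differentiable_comp _ _ _ _ f g); [exact: df|exact: dg].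
apply: (@eq_Ck _ _ _ _ (fun x => 'D_v f x * 'D_1 g (f x))) => //.
  move=> x Ux; rewrite (@derive_comp _ _ _ f g); [|exact: df|exact: dg].
  by rewrite [in RHS]derive_real//; exact: dg.
have [_ hf'] := (CkS _ _ _).1 hf; have [_ hg'] := (CkS _ _ _).1 hg.
by apply: CkM => //; apply: (IH f (fun y => 'D_1 g y)) => //; exact: CkW.
Qed.

Lemma smooth_on_comp_real V (U : set V) (U' : set R) (f : V -> R)
    (g : R -> R) : open U -> (forall x, U x -> U' (f x)) ->
  smooth_on U f -> smooth_on U' g -> smooth_on U (fun x => g (f x)).
Proof.
move=> oU UU' /smooth_Ck hf /smooth_Ck hg; apply/smooth_Ck => k.
exact: (@Ck_comp_real _ _ _ U').
Qed.

Lemma smooth_onN V W (U : set V) (f : V -> W) : open U ->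
  smooth_on U f -> smooth_on U (fun x => - f x).
Proof.
move=> oU /smooth_Ck hf; apply/smooth_Ck => k.
have {hf} := hf k; elim: k f => [|k IH] f hf.
  move=> s x; rewrite leqn0 size_eq0 => /eqP -> Ux /=.
  by apply: differentiableN; exact: Ck_diff hf _.
apply/CkS; split=> [x Ux|v].
  by apply: differentiableN; exact: Ck_diff hf _.
apply: (@eq_Ck _ _ _ _ (fun x => - 'D_v f x)) => //.
  by move=> x Ux; rewrite deriveN//; apply: diff_derivable; exact: Ck_diff hf _.
by apply: IH; case/CkS: hf.
Qed.

Lemma smooth_onB V W (U : set V) (f g : V -> W) : open U ->
  smooth_on U f -> smooth_on U g -> smooth_on U (fun x => f x - g x).
Proof. by move=> oU hf hg; apply: smooth_onD => //; exact: smooth_onN. Qed.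

Lemma CkV k V (U : set V) (f : V -> R) : open U ->
  (forall x, U x -> f x != 0) -> Ck k U f -> Ck k U (fun x => (f x)^-1).
Proof.
move=> oU f0; elim: k => [|k IH] hf.
  move=> s x; rewrite leqn0 size_eq0 => /eqP -> Ux /=.
  by apply: differentiableV; [exact: Ck_diff hf _|exact: f0].
apply/CkS; split=> [x Ux|v].
  by apply: differentiableV; [exact: Ck_diff hf _|exact: f0].
apply: (@eq_Ck _ _ _ _ (fun x => (-1) * ((f x)^-1 * (f x)^-1) * 'D_v f x)) => //.
  move=> x Ux; rewrite deriveV//.
  - by rewrite -invfM mulN1r -expr2.
  - exact: f0.
  - by apply: diff_derivable; exact: Ck_diff hf _.
have [_ hf'] := (CkS _ _ _).1 hf; have hfi := IH (CkW hf).
by apply: CkM => //; apply: CkM => //; [exact: Ck_cst|exact: CkM].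
Qed.

Lemma smooth_onV V (U : set V) (f : V -> R) : open U ->
  (forall x, U x -> f x != 0) ->
  smooth_on U f -> smooth_on U (fun x => (f x)^-1).
Proof. by move=> oU f0 /smooth_Ck hf; apply/smooth_Ck => k; exact: CkV. Qed.

(** Bootstrapping: the derivative of [g] is an expression in [g] itself, so each order of regularity
    of [g] gives the next one. *)
Lemma smooth_on_sqrt_ode (U : set R) (g : R -> R) : open U ->
  (forall x, U x -> g x != 0) ->
  (forall x, U x -> is_derive x (1 : R) g ((2 * g x)^-1)) -> smooth_on U g.
Proof.
move=> oU g0 dg; apply/smooth_Ck.
have dg' x : U x -> differentiable g x.
  by move=> Ux; apply/derivable1_diffP; have [] := dg x Ux.
elim=> [|k IH].
  by move=> s x; rewrite leqn0 size_eq0 => /eqP -> /=; exact: dg'.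
apply/CkS; split=> // v.
apply: (@eq_Ck _ _ _ _ (fun x => (2 * g x)^-1 * v)) => //.
  move=> x Ux; have [_ E] := dg x Ux.
  by rewrite (derive_real v (dg' x Ux)) E [LHS]mulrC.
apply: CkM => //; last exact: Ck_cst.
apply: CkV => // [x Ux|]; first by rewrite mulf_neq0// g0.
by apply: CkM => //; exact: Ck_cst.
Qed.

Lemma smooth_on_sqrt V (U : set V) (f : V -> R) : open U ->
  (forall x, U x -> 0 < f x) ->
  smooth_on U f -> smooth_on U (fun x => Num.sqrt (f x)).
Proof.
move=> oU f0 hf.
apply: (@smooth_on_comp_real _ _ [set t | 0 < t] f (@Num.sqrt R)) => //.
refine (@smooth_on_sqrt_ode [set t : R | 0 < t] (fun t : R => Num.sqrt t) _ _ _).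
- exact: open_gt.
- by move=> x /= x0; rewrite gt_eqF// sqrtr_gt0.
Qed.

Lemma line_MVT V (f : V -> R) (x v : V) (h : R) : 0 < h ->
  (forall t, 0 <= t <= h -> differentiable f (x + t *: v)) ->
  exists2 c, 0 < c < h & f (x + h *: v) - f x = h * 'D_v f (x + c *: v).
Proof.
move=> h0 df.
have dl t : differentiable (fun t : R => x + t *: v) t.
  by apply: differentiableD; [exact: differentiable_cst|exact: differentiableZl].
have dlE t : 'D_1 (fun t : R => x + t *: v) t = v.
  rewrite deriveD ?derive_cst; [|exact: derivable_cst|].
  by rewrite add0r deriveE// diff_val scale1r.
  exact: diff_derivable.
have dfl t : 0 <= t <= h -> differentiable (fun t : R => f (x + t *: v)) t.
  by move=> th; apply: (@differentiable_comp _ _ _ _ (fun t : R => x + t *: v) f) => //; exact: df.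
have [||c] := @MVT R (fun t => f (x + t *: v)) (fun t => 'D_v f (x + t *: v)) 0 h h0.
- move=> t; rewrite in_itv/= => /andP[/ltW t0 /ltW th].
  have th' : 0 <= t <= h by rewrite t0.
  apply: DeriveDef; first by apply: diff_derivable; exact: dfl.
  by rewrite (@derive_comp _ _ _ (fun t : R => x + t *: v) f) ?dlE//; exact: df.
- apply: derivable_within_continuous => t; rewrite in_itv/= => th.
  by apply: diff_derivable; exact: dfl.
by rewrite in_itv/= scale0r addr0 subr0 [_ * h]mulrC => ch E; exists c.
Qed.

(** The mixed difference is the increment along [v] of y |-> f(y + h w) - f(y). The mean value
    theorem along [v], then along [w], turns it into h^2 times a second derivative; the bound on [h]
    keeps all points used within distance [r] of [x]. *)
Lemma derive_swap_near V (f : V -> R) (x v w : V) (r h : R) :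
  0 < r -> 0 < h -> h * (`|v| + `|w|) < r ->
  (forall y, `|y - x| < r -> differentiable f y) ->
  (forall y, `|y - x| < r -> differentiable (fun z => 'D_v f z) y) ->
  exists2 y, `|y - x| < r &
    f (x + h *: v + h *: w) - f (x + h *: v) - f (x + h *: w) + f x
    = h ^+ 2 * 'D_w (fun z => 'D_v f z) y.
Proof.
move=> r0 h0 hr df dvf.
have near_x s t : 0 <= s <= h -> 0 <= t <= h -> `|x + s *: v + t *: w - x| < r.
  move=> /andP[s0 sh] /andP[t0 th].
  rewrite addrC -addrA addKr (le_lt_trans _ hr)//.
  rewrite (le_trans (ler_normD _ _))// !normrZ !ger0_norm// mulrDr.
  by rewrite lerD// ler_wpM2r.
have h00 : 0 <= (0 : R) <= h by rewrite lexx ltW.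
have hhh : 0 <= h <= h by rewrite lexx ltW.
pose g y := f (y + h *: w) - f y.
have dg t : 0 <= t <= h -> differentiable g (x + t *: v).
  move=> th; apply: differentiableB.
    apply: (@differentiable_comp _ _ _ _ (fun y => y + h *: w) f) => //.
    by apply: df; exact: near_x.
  by apply: df; have := near_x t 0 th h00; rewrite scale0r addr0.
have [c ch Ec] := @line_MVT _ g x v h h0 dg.
have ch' : 0 <= c <= h by move/andP: ch => [/ltW -> /ltW ->].
have Dg : 'D_v g (x + c *: v) = 'D_v f (x + c *: v + h *: w) - 'D_v f (x + c *: v).
  rewrite /g deriveB.
  - by rewrite derive_translate.
  - apply: diff_derivable.
    apply: (@differentiable_comp _ _ _ _ (fun y => y + h *: w) f) => //.
    by apply: df; exact: near_x.
  - by apply: diff_derivable; apply: df; have := near_x c 0 ch' h00; rewrite scale0r addr0.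
have [t th|d dh Ed] := @line_MVT _ (fun z => 'D_v f z) (x + c *: v) w h h0.
  by apply: dvf; exact: near_x.
have dh' : 0 <= d <= h by move/andP: dh => [/ltW -> /ltW ->].
exists (x + c *: v + d *: w); first exact: near_x.
by rewrite expr2 -mulrA -Ed -Dg -Ec /g opprB addrA; ring.
Qed.

Lemma le_halves (a b c d e : R) :
  `|a - c| < e / 2 -> `|b - d| < e / 2 -> c = d -> `|a - b| <= e.
Proof. by rewrite !ltr_norml => /andP[? ?] /andP[? ?] ?; rewrite ler_norml; lra. Qed.

(* The mixed second difference quotient is a value of either mixed derivative
   near [x]; continuity then identifies them at [x]. *)
Lemma schwarz_scalar V (U : set V) (f : V -> R) (x v w : V) : open U -> U x ->
  smooth_on U f -> 'D_w (fun z => 'D_v f z) x = 'D_v (fun z => 'D_w f z) x.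
Proof.
move=> oU Ux sf; apply/eqP; rewrite -subr_eq0 -normr_le0; apply/ler_addgt0Pl => e e0.
rewrite addr0.
have cont u u' : {for x, continuous (fun z => 'D_u (fun y => 'D_u' f y) z)}.
  apply: differentiable_continuous.
  by apply: smooth_on_differentiable Ux; do 2 apply: smooth_on_derive.
have e2 : 0 < e / 2 by rewrite divr_gt0.
have /nbhs_ballP[r /= r0 Hr] : \forall y \near x, [/\ U y,
    `|'D_w (fun z => 'D_v f z) x - 'D_w (fun z => 'D_v f z) y| < e / 2 &
    `|'D_v (fun z => 'D_w f z) x - 'D_v (fun z => 'D_w f z) y| < e / 2].
  have H1 := open_nbhs_nbhs (conj oU Ux).
  have /cvgrPdist_lt/(_ _ e2) H2 := cont w v.
  have /cvgrPdist_lt/(_ _ e2) H3 := cont v w.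
  by apply: filterS (filterI H1 (filterI H2 H3)) => y [h1 [h2 h3]]; split;
    [exact: h1|exact: h2|exact: h3].
have {}Hr y : `|y - x| < r -> [/\ U y,
    `|'D_w (fun z => 'D_v f z) x - 'D_w (fun z => 'D_v f z) y| < e / 2 &
    `|'D_v (fun z => 'D_w f z) x - 'D_v (fun z => 'D_w f z) y| < e / 2].
  by move=> yx; apply: Hr; rewrite -ball_normE /= distrC.
have df y : `|y - x| < r -> differentiable f y.
  by move=> /Hr[Uy _ _]; exact: smooth_on_differentiable Uy.
have dDf u y : `|y - x| < r -> differentiable (fun z => 'D_u f z) y.
  move=> /Hr[Uy _ _]; apply: smooth_on_differentiable Uy.
  exact: smooth_on_derive.
(* The summand 1 keeps the denominator positive when [v] and [w] are both zero. *)
pose h := r / (2 * (`|v| + `|w| + 1)).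
have p1 : 0 < `|v| + `|w| + 1 by rewrite ltr_wpDl// addr_ge0.
have h0 : 0 < h by rewrite divr_gt0// mulr_gt0.
have hr : h * (`|v| + `|w|) < r.
  rewrite /h mulrAC ltr_pdivrMr ?mulr_gt0// ltr_pM2l//.
  by have := normr_ge0 v; have := normr_ge0 w; lra.
have hr' : h * (`|w| + `|v|) < r by rewrite addrC.
have [y1 y1r E1] := derive_swap_near r0 h0 hr df (dDf v).
have [y2 y2r E2] := derive_swap_near r0 h0 hr' df (dDf w).
have E : 'D_w (fun z => 'D_v f z) y1 = 'D_v (fun z => 'D_w f z) y2.
  apply: (@mulfI _ (h ^+ 2)); first by rewrite expf_neq0// gt_eqF.
  rewrite [x + h *: w + h *: v]addrAC in E2.
  by apply: etrans (esym E1) _; apply: etrans E2; ring.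
have [_ H1 _] := Hr _ y1r; have [_ _ H2] := Hr _ y2r.
exact: le_halves H1 H2 E.
Qed.

Lemma schwarz V m n (U : set V) (F : V -> 'M[R]_(m, n)) (x v w : V) : open U -> U x ->
  smooth_on U F -> 'D_w (fun z => 'D_v F z) x = 'D_v (fun z => 'D_w F z) x.
Proof.
move=> oU Ux sF.
have dD u y : U y -> differentiable (fun z => 'D_u F z) y.
  by move=> Uy; apply: smooth_on_differentiable Uy; exact: smooth_on_derive.
have E u u' i j : ('D_u (fun z => 'D_u' F z) x) i j =
    'D_u (fun z => 'D_u' (fun y => F y i j) z) x.
  rewrite derive_entry; last exact: dD.
  apply: near_eq_derive; near=> y; rewrite derive_entry//.
  apply: smooth_on_differentiable sF _; near: y.
  exact: open_nbhs_nbhs.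
apply/matrixP => i j; apply: etrans (E _ _ _ _) _; apply: etrans (esym (E _ _ _ _)).
apply: (schwarz_scalar v w oU Ux); exact: smooth_on_entry.
Unshelve. all: end_near. Qed.

End SmoothCalculus.

Opaque derive.

(** * Bilinear forms and determinants *)

Section BilinearForms.
Variable R : realType.

Section Bform.
Variables (n : nat) (A : 'M[R]_n).
Implicit Types u v w : 'rV[R]_n.

Lemma bformDl u v w : bform A (u + v) w = bform A u w + bform A v w.
Proof. by rewrite /bform !mulmxDl mxE. Qed.
Lemma bformDr u v w : bform A w (u + v) = bform A w u + bform A w v.
Proof. by rewrite /bform linearD mulmxDr mxE. Qed.
Lemma bformZl c u w : bform A (c *: u) w = c * bform A u w.
Proof. by rewrite /bform -!scalemxAl mxE. Qed.
Lemma bformZr c u w : bform A w (c *: u) = c * bform A w u.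
Proof. by rewrite /bform linearZ -scalemxAr mxE. Qed.
Lemma bformNl u w : bform A (- u) w = - bform A u w.
Proof. by rewrite -scaleN1r bformZl mulN1r. Qed.
Lemma bformNr u w : bform A w (- u) = - bform A w u.
Proof. by rewrite -scaleN1r bformZr mulN1r. Qed.
Lemma bformBl u v w : bform A (u - v) w = bform A u w - bform A v w.
Proof. by rewrite bformDl bformNl. Qed.
Lemma bformBr u v w : bform A w (u - v) = bform A w u - bform A w v.
Proof. by rewrite bformDr bformNr. Qed.
Lemma bform0l w : bform A 0 w = 0.
Proof. by rewrite -(scale0r 0) bformZl mul0r. Qed.
Lemma bform0r w : bform A w 0 = 0.
Proof. by rewrite -(scale0r 0) bformZr mul0r. Qed.
Lemma bform_suml (I : Type) (r : seq I) (P : pred I) (F : I -> 'rV[R]_n) w :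
  bform A (\sum_(i <- r | P i) F i) w = \sum_(i <- r | P i) bform A (F i) w.
Proof. by apply: (big_morph _ (fun u v => bformDl u v w)); exact: bform0l. Qed.
Lemma bform_sumr (I : Type) (r : seq I) (P : pred I) (F : I -> 'rV[R]_n) w :
  bform A w (\sum_(i <- r | P i) F i) = \sum_(i <- r | P i) bform A w (F i).
Proof. by apply: (big_morph _ (fun u v => bformDr u v w)); exact: bform0r. Qed.

Lemma bform_delta i j : bform A (delta_mx 0 i) (delta_mx 0 j) = A i j.
Proof. by rewrite /bform -rowE trmx_delta -colE !mxE. Qed.

Lemma bform_sym : A^T = A -> forall v w, bform A v w = bform A w v.
Proof.
move=> sA v w; rewrite /bform -[in LHS]sA -{1}[v]trmxK -!trmx_mul mulmxA.
by rewrite mxE.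
Qed.

Hypothesis posA : forall v, v != 0 -> 0 < bform A v v.

Lemma bform_eq0 v : (forall w, bform A v w = 0) -> v = 0.
Proof.
by move=> H; apply/eqP; apply: contraT => /posA; rewrite H ltxx.
Qed.

Lemma bform_inj u v : (forall w, bform A u w = bform A v w) -> u = v.
Proof.
move=> H; apply/eqP; rewrite -subr_eq0; apply/eqP/bform_eq0 => w.
by rewrite bformBl H subrr.
Qed.

End Bform.

(** Stated without positivity, since it is also applied to the pseudo-Riemannian [sasaki] metric. *)
Lemma nondegenerate_unitmx n (A : 'M[R]_n) :
  (forall v, (forall w, bform A v w = 0) -> v = 0) -> A \in unitmx.
Proof.
move=> H; rewrite -row_free_unit -kermx_eq0; apply/eqP/row_matrixP => i.
rewrite row0; apply: H => w; rewrite /bform.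
by rewrite -row_mul mulmx_ker row0 mul0mx mxE.
Qed.

Lemma posdef_unitmx n (A : 'M[R]_n) :
  (forall v, v != 0 -> 0 < bform A v v) -> A \in unitmx.
Proof. by move=> pA; apply: nondegenerate_unitmx => v; exact: bform_eq0. Qed.

(* Gram-Schmidt written as a recursion on Schur complements, so that smooth
   dependence on the matrix is visible. *)
Fixpoint chol n : 'M[R]_n -> 'M[R]_n :=
  match n with
  | 0 => fun A => A
  | n'.+1 => fun A : 'M[R]_(1 + n') =>
    let a := A 0 0 in let b := ursubmx A in
    let Q := chol (drsubmx A - a^-1 *: (b^T *m b)) in
    block_mx ((Num.sqrt a)^-1)%:M 0 (- a^-1 *: (Q *m b^T)) Q
  end.

Lemma block_bform n (A : 'M[R]_(1 + n)) c (v : 'rV[R]_n) : A^T = A ->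
  bform A (row_mx c%:M v) (row_mx c%:M v) =
  c ^+ 2 * A 0 0 + 2 * c * (ursubmx A *m v^T) 0 0 + bform (drsubmx A) v v.
Proof.
move=> sA.
have E : dlsubmx A = (ursubmx A)^T by rewrite trmx_ursub sA.
rewrite /bform -{1}(submxK A) mul_row_block tr_row_mx mul_row_col E tr_scalar_mx.
rewrite !mulmxDl !mul_scalar_mx -!scalemxAl !mul_mx_scalar.
have -> : v *m (ursubmx A)^T = ((ursubmx A) *m v^T)^T by rewrite trmx_mul trmxK.
rewrite !mxE.
have -> : lshift n 0 = 0 :> 'I_(1 + n) by apply/val_inj.
ring.
Qed.

Lemma bformDm n (A B : 'M[R]_n) v w : bform (A + B) v w = bform A v w + bform B v w.
Proof. by rewrite /bform mulmxDr mulmxDl mxE. Qed.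

Lemma bformZm n c (A : 'M[R]_n) v w : bform (c *: A) v w = c * bform A v w.
Proof. by rewrite /bform -scalemxAr -scalemxAl mxE. Qed.

Lemma bform_outer n (b v : 'rV[R]_n) : bform (b^T *m b) v v = ((b *m v^T) 0 0) ^+ 2.
Proof.
rewrite /bform mulmxA -mulmxA -{1}[v]trmxK -trmx_mul mxE big_ord1.
by rewrite [X in X * _]mxE.
Qed.

(** The quadratic form of the Schur complement at [v] is the minimum, over the first coordinate, of
    the form of [A] at vectors whose other coordinates are [v]; hence it is positive. *)
Lemma schur_pos n (A : 'M[R]_(1 + n)) : A^T = A ->
  (forall v, v != 0 -> 0 < bform A v v) ->
  [/\ 0 < A 0 0,
   (drsubmx A - (A 0 0)^-1 *: ((ursubmx A)^T *m ursubmx A))^T =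
    drsubmx A - (A 0 0)^-1 *: ((ursubmx A)^T *m ursubmx A) &
   forall v, v != 0 ->
     0 < bform (drsubmx A - (A 0 0)^-1 *: ((ursubmx A)^T *m ursubmx A)) v v].
Proof.
move=> sA pA.
have a0 : 0 < A 0 0.
  rewrite -bform_delta; apply: pA; apply/eqP => /rowP/(_ 0).
  by rewrite !mxE !eqxx => /eqP; rewrite oner_eq0.
split=> // [|v v0].
  by rewrite linearB linearZ /= trmx_mul trmxK trmx_drsub sA.
(* The minimising first coordinate, obtained by completing the square. *)
set c := - (A 0 0)^-1 * (ursubmx A *m v^T) 0 0.
have := pA (row_mx c%:M v); rewrite block_bform// => /(_ _)/lt_le_trans; apply.
  apply: contraNN v0 => /eqP/(congr1 rsubmx); rewrite row_mxKr => ->.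
  by rewrite linear0.
rewrite -scaleNr bformDm bformZm bform_outer.
rewrite /c; set t := (ursubmx A *m v^T) 0 0; set q := bform _ _ _.
have an0 : A 0 0 != 0 by rewrite gt_eqF.
rewrite le_eqVlt; apply/orP; left; apply/eqP; move: (A 0 0) an0 => a an0; by field.
Qed.

(** The Schur complement makes the lower left block of [chol A *m A] vanish; the diagonal blocks are
    then settled by the pivot and by induction. Geometrically, the rows of [chol A] form an
    orthonormal basis for [A]. *)
Lemma cholP n (A : 'M[R]_n) : A^T = A -> (forall v, v != 0 -> 0 < bform A v v) ->
  chol A *m A *m (chol A)^T = 1%:M.
Proof.
elim: n A => [|n IH] A sA pA; first by rewrite [LHS]flatmx0 [RHS]flatmx0.
rewrite -[n.+1]/(1 + n)%N in A sA pA *.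
have [a0 sS pS] := schur_pos sA pA.
rewrite /=; set b := ursubmx A in sS pS *.
set S := drsubmx A - _ in sS pS *.
have QS := IH S sS pS.
set Q := chol S in QS *.
have E : dlsubmx A = b^T by rewrite trmx_ursub sA.
have Ea : ulsubmx A = (A 0 0)%:M.
  apply/matrixP => i j; rewrite !ord1 !mxE eqxx mulr1n; congr (A _ _); exact/val_inj.
have ED : drsubmx A = S + (A 0 0)^-1 *: (b^T *m b) by rewrite subrK.
have an0 : A 0 0 != 0 by rewrite gt_eqF.
have PA : block_mx ((Num.sqrt (A 0 0))^-1)%:M 0 (- (A 0 0)^-1 *: (Q *m b^T)) Q *m A =
    block_mx (Num.sqrt (A 0 0))%:M ((Num.sqrt (A 0 0))^-1 *: b) 0 (Q *m S).
  transitivity (block_mx ((Num.sqrt (A 0 0))^-1)%:M 0 (- (A 0 0)^-1 *: (Q *m b^T)) Q *m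
      block_mx (A 0 0)%:M b b^T (S + (A 0 0)^-1 *: (b^T *m b))).
    by congr (_ *m _); rewrite -[LHS](submxK A) E Ea ED.
  rewrite mulmx_block !mul0mx !addr0; congr block_mx.
  - rewrite -scalar_mxM; congr (_%:M).
    rewrite -{2}[A 0 0]sqr_sqrtr ?ltW//.
    by field; rewrite gt_eqF// sqrtr_gt0.
  - by rewrite mul_scalar_mx.
  - by rewrite mul_mx_scalar scalerA mulrN divff// scaleN1r addNr.
  - by rewrite mulmxDr -scalemxAr -scalemxAl mulmxA addrCA scaleNr addNr addr0.
rewrite PA tr_block_mx trmx0 tr_scalar_mx mulmx_block !mul0mx !mulmx0 !addr0 add0r QS.
rewrite scalar_mx_block; congr block_mx.
  by rewrite -scalar_mxM divff// gt_eqF// sqrtr_gt0.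
rewrite mul_scalar_mx linearZ /= trmx_mul trmxK -scalemxAl scalerA.
rewrite -scalerDl (_ : _ + _ = 0) ?scale0r// -{2}[A 0 0]sqr_sqrtr ?ltW//.
by field; rewrite gt_eqF// sqrtr_gt0.
Qed.

Lemma smooth_on_mul (V : normedModType R) m n p (U : set V)
    (F : V -> 'M[R]_(m, n)) (H : V -> 'M[R]_(n, p)) : open U ->
  smooth_on U F -> smooth_on U H -> smooth_on U (fun x => F x *m H x).
Proof.
move=> oU sF sH; apply: smooth_on_mx => // i j; under eq_fun do rewrite mxE.
by apply: smooth_on_sum => // k _; apply: smooth_onM => //; exact: smooth_on_entry.
Qed.

Lemma smooth_on_scale (V : normedModType R) m n (U : set V)
    (f : V -> R) (H : V -> 'M[R]_(m, n)) : open U ->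
  smooth_on U f -> smooth_on U H -> smooth_on U (fun x => f x *: H x).
Proof.
move=> oU sF sH; apply: smooth_on_mx => // i j; under eq_fun do rewrite mxE.
by apply: smooth_onM => //; exact: smooth_on_entry.
Qed.

Lemma smooth_on_tr (V : normedModType R) m n (U : set V)
    (H : V -> 'M[R]_(m, n)) : open U ->
  smooth_on U H -> smooth_on U (fun x => (H x)^T).
Proof.
move=> oU sH; apply: smooth_on_mx => // i j; under eq_fun do rewrite mxE.
exact: smooth_on_entry.
Qed.

Lemma smooth_on_row (V : normedModType R) m n (U : set V) i
    (H : V -> 'M[R]_(m, n)) : open U ->
  smooth_on U H -> smooth_on U (fun x => row i (H x)).
Proof.
move=> oU sH; apply: smooth_on_mx => // k j; under eq_fun do rewrite mxE.
exact: smooth_on_entry.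
Qed.

Lemma smooth_on_row_mx (V : normedModType R) m p q (U : set V) (H : V -> 'M[R]_(m, p))
  (H' : V -> 'M[R]_(m, q)) : open U -> smooth_on U H -> smooth_on U H' ->
  smooth_on U (fun x => row_mx (H x) (H' x)).
Proof.
move=> oU sH sH'; apply: smooth_on_mx => // i j; under eq_fun do rewrite mxE.
by case: splitP => k _; exact: smooth_on_entry.
Qed.

Lemma smooth_on_col_mx (V : normedModType R) m p q (U : set V) (H : V -> 'M[R]_(p, m))
  (H' : V -> 'M[R]_(q, m)) : open U -> smooth_on U H -> smooth_on U H' ->
  smooth_on U (fun x => col_mx (H x) (H' x)).
Proof.
move=> oU sH sH'; apply: smooth_on_mx => // i j; under eq_fun do rewrite mxE.
by case: splitP => k _; exact: smooth_on_entry.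
Qed.

Lemma smooth_on_bform (V : normedModType R) n (U : set V)
    (A : V -> 'M[R]_n) (X Y : V -> 'rV[R]_n) : open U ->
  smooth_on U A -> smooth_on U X -> smooth_on U Y ->
  smooth_on U (fun x => bform (A x) (X x) (Y x)).
Proof.
move=> oU sA sX sY; apply: smooth_on_entry => //.
by do 2?apply: smooth_on_mul => //; exact: smooth_on_tr.
Qed.

(** Every pivot is positive by [schur_pos], so the inverses and square roots in [chol] stay away
    from their singularities. *)
Lemma smooth_on_chol (V : normedModType R) n (U : set V) (A : V -> 'M[R]_n) :
  open U -> (forall x, U x -> (A x)^T = A x) ->
  (forall x v, U x -> v != 0 -> 0 < bform (A x) v v) ->
  smooth_on U A -> smooth_on U (fun x => chol (A x)).
Proof.
move=> oU; elim: n A => [|n IH] A sA pA dA //.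
rewrite -[n.+1]/(1 + n)%N in A sA pA dA *.
have SP x : U x -> _ := fun Ux => schur_pos (sA x Ux) (fun v => pA x v Ux).
have sm00 : smooth_on U (fun x => A x 0 0) by exact: smooth_on_entry.
have smi : smooth_on U (fun x => (A x 0 0)^-1).
  by apply: smooth_onV => // x /SP[a0 _ _]; rewrite gt_eqF.
have smb : smooth_on U (fun x => ursubmx (A x)).
  by apply: smooth_on_mx => // i j; under eq_fun do rewrite !mxE; exact: smooth_on_entry.
have sQ : smooth_on U (fun x => chol (drsubmx (A x) -
     (A x 0 0)^-1 *: ((ursubmx (A x))^T *m ursubmx (A x)))).
  apply: IH => [x /SP[]//|x v /SP[_ _ H]|]; first exact: H.
  apply: smooth_onB => //.
    by apply: smooth_on_mx => // i j; under eq_fun do rewrite !mxE; exact: smooth_on_entry.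
  by apply: smooth_on_scale => //; apply: smooth_on_mul => //; exact: smooth_on_tr.
rewrite /=; apply: smooth_on_col_mx => //; apply: smooth_on_row_mx => //.
- under eq_fun do rewrite -scalemx1.
  apply: smooth_on_scale => //; last exact: smooth_on_cst.
  apply: smooth_onV => // [x /SP[a0 _ _]|]; first by rewrite gt_eqF// sqrtr_gt0.
  by apply: smooth_on_sqrt => // x /SP[].
- exact: smooth_on_cst.
- apply: smooth_on_scale => //; first exact: smooth_onN.
  by apply: smooth_on_mul => //; exact: smooth_on_tr.
Qed.

Lemma linear_delta (W : lmodType R) n (F : 'rV[R]_n -> W) v :
  (forall c u u', F (c *: u + u') = c *: F u + F u') ->
  F v = \sum_k v 0 k *: F (delta_mx 0 k).
Proof.
move=> lF; have F0 : F 0 = 0.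
  by have := lF (-1) 0 0; rewrite scaler0 addr0 scaleN1r addNr.
rewrite {1}(row_sum_delta v); elim: (index_enum _) => [|k r IH].
  by rewrite !big_nil.
by rewrite !big_cons lF IH.
Qed.

(* A trace over an orthonormal basis is a contraction with the inverse metric,
   hence does not depend on the basis. *)
Lemma orthonormal_trace (W : lmodType R) n (A P : 'M[R]_n) (B : 'rV[R]_n -> 'rV[R]_n -> W) :
  (forall c u u' v, B (c *: u + u') v = c *: B u v + B u' v) ->
  (forall c u u' v, B v (c *: u + u') = c *: B v u + B v u') ->
  P *m A *m P^T = 1%:M ->
  \sum_i B (row i P) (row i P) =
  \sum_k \sum_l (invmx A) k l *: B (delta_mx 0 k) (delta_mx 0 l).
Proof.
move=> Bl Br PAP.
have E := @linear_delta W n.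
have PtP : P^T *m P = invmx A.
  have PtPA : P^T *m P *m A = 1%:M.
    by rewrite -mulmxA; exact: mulmx1C PAP.
  have Au : A \in unitmx by have [] := mulmx1_unit PtPA.
  by rewrite -[LHS](mulmxK Au) PtPA mul1mx.
rewrite -PtP.
transitivity (\sum_i \sum_k \sum_l (P i k * P i l) *: B (delta_mx 0 k) (delta_mx 0 l)).
  apply: eq_bigr => i _; rewrite (E (B ^~ (row i P)))//.
  apply: eq_bigr => k _; rewrite (E (B (delta_mx 0 k)))// scaler_sumr.
  by apply: eq_bigr => l _; rewrite scalerA !mxE.
rewrite exchange_big; apply: eq_bigr => k _ /=.
rewrite exchange_big; apply: eq_bigr => l _ /=.
by rewrite -scaler_suml mxE; congr (_ *: _); apply: eq_bigr => i _; rewrite mxE.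
Qed.

Section DeriveMx.
Variable V : normedModType R.
Implicit Types (x v : V).

Lemma derive_prod (I : eqType) (r : seq I) (f : I -> V -> R) x v : uniq r ->
  (forall i, differentiable (f i) x) ->
  differentiable (fun y => \prod_(i <- r) f i y) x /\
  'D_v (fun y => \prod_(i <- r) f i y) x =
  \sum_(i <- r) \prod_(j <- r) (if j == i then 'D_v (f j) x else f j x).
Proof.
move=> + df; elim: r => [|a r IH] /=.
  move=> _; under [fun y => _]eq_fun do rewrite big_nil.
  by rewrite big_nil derive_cst; split => //; exact: differentiable_cst.
move=> /andP[ar ur]; have [d1 d2] := IH ur.
under [fun y => _]eq_fun do rewrite big_cons.
split; first exact: differentiableM.
rewrite deriveM; [|exact: diff_derivable|exact: diff_derivable].
rewrite d2 big_cons addrC; congr (_ + _).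
  rewrite big_cons eqxx mulrC; congr (_ * _).
  rewrite [LHS]big_seq [RHS]big_seq; apply: eq_bigr => j jr.
  by case: eqP => // ja; rewrite -ja jr in ar.
rewrite /GRing.scale/= big_distrr/= [LHS]big_seq [RHS]big_seq; apply: eq_bigr => i ir.
by rewrite big_cons; case: eqP => // ai; rewrite ai ir in ar.
Qed.

Lemma derive_bigsum (W : normedModType R) (I : Type) (r : seq I) (f : I -> V -> W) x v :
  (forall i, differentiable (f i) x) ->
  differentiable (fun y => \sum_(i <- r) f i y) x /\
  'D_v (fun y => \sum_(i <- r) f i y) x = \sum_(i <- r) 'D_v (f i) x.
Proof.
move=> df; elim: r => [|a r [d1 d2]].
  under [fun y => _]eq_fun do rewrite big_nil.
  by rewrite big_nil derive_cst; split => //; exact: differentiable_cst.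
under [fun y => _]eq_fun do rewrite big_cons.
split; first exact: differentiableD.
rewrite deriveD; [|exact: diff_derivable|exact: diff_derivable].
by rewrite d2 big_cons.
Qed.

(** Differentiating the Leibniz formula puts the derivative into one row at a time. Expanding along
    that row produces cofactors, which are those of [F x] because they do not see the row that was
    changed. *)
Lemma derive_det n (F : V -> 'M[R]_n) x v : differentiable F x ->
  'D_v (fun y => \det (F y)) x =
  \sum_i \sum_j ('D_v F x) i j * cofactor (F x) i j.
Proof.
move=> dF; rewrite /determinant.
have dFij i j : differentiable (fun y => F y i j) x by exact: differentiable_entry.
have [_ ->] := @derive_bigsum _ _ (index_enum {perm 'I_n})
   (fun s y => (-1) ^+ (s : bool) * \prod_i F y i (s i)) x v (fun s =>
     differentiableM (differentiable_cst _ _)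
      (derive_prod v (index_enum_uniq 'I_n) (fun i => dFij i (s i))).1).
pose M i := \matrix_(j, k) (if j == i then ('D_v F x) j k else F x j k).
transitivity (\sum_i \det (M i)).
  rewrite /determinant exchange_big; apply: eq_bigr => s _ /=.
  have [d1 d2] := derive_prod v (index_enum_uniq 'I_n) (fun i => dFij i (s i)).
  rewrite deriveM; [|exact: derivable_cst|exact: diff_derivable].
  rewrite derive_cst scaler0 addr0 d2 /GRing.scale/= big_distrr/=.
  apply: eq_bigr => i _; congr (_ * _); apply: eq_bigr => j _.
  by rewrite mxE derive_entry.
apply: eq_bigr => i _; rewrite (expand_det_row _ i); apply: eq_bigr => j _.
rewrite [M i i j]mxE eqxx /cofactor; congr (_ * (_ * \det _)).
by apply/matrixP => k l; rewrite !mxE eq_sym (negbTE (neq_lift i k)).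
Qed.

Lemma jacobi_formula n (F : V -> 'M[R]_n) x v : differentiable F x ->
  F x \in unitmx ->
  'D_v (fun y => \det (F y)) x = \det (F x) * \tr (invmx (F x) *m 'D_v F x).
Proof.
move=> dF Fu; rewrite derive_det// /invmx Fu -scalemxAl mxtraceZ mulrA mulfV; last first.
  by rewrite -unitfE -unitmxE.
rewrite mul1r mxtrace_mulC; apply: eq_bigr => i _; rewrite mxE; apply: eq_bigr => j _.
by rewrite mxE.
Qed.

Lemma smooth_on_det n (U : set V) (F : V -> 'M[R]_n) : open U ->
  smooth_on U F -> smooth_on U (fun y => \det (F y)).
Proof.
move=> oU sF; apply: smooth_on_sum => // s _; apply: smooth_onM => //.
  exact: smooth_on_cst.
by apply: smooth_on_prod => // i; exact: smooth_on_entry.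
Qed.

Lemma derive_mul m n p (F : V -> 'M[R]_(m, n)) (H : V -> 'M[R]_(n, p)) x v :
  differentiable F x -> differentiable H x ->
  differentiable (fun y => F y *m H y) x /\
  'D_v (fun y => F y *m H y) x = 'D_v F x *m H x + F x *m 'D_v H x.
Proof.
move=> dF dH.
have dFij i j : differentiable (fun y => F y i j) x by exact: differentiable_entry.
have dHij i j : differentiable (fun y => H y i j) x by exact: differentiable_entry.
have E i j := @derive_bigsum _ _ (index_enum 'I_n) (fun k y => F y i k * H y k j) x v
  (fun k => differentiableM (dFij i k) (dHij k j)).
have d : differentiable (fun y => F y *m H y) x.
  by apply: differentiable_mx => i j; under eq_fun do rewrite mxE; have [] := E i j.
split=> //; apply/matrixP => i j; rewrite derive_entry//.
under eq_fun do rewrite mxE.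
have [_ ->] := E i j; rewrite !mxE -big_split/=; apply: eq_bigr => k _.
rewrite deriveM; [|exact: diff_derivable|exact: diff_derivable].
by rewrite !derive_entry// addrC /GRing.scale/= [H x k j * _]mulrC.
Qed.

Lemma derive_tr m n (F : V -> 'M[R]_(m, n)) x v : differentiable F x ->
  differentiable (fun y => (F y)^T) x /\ 'D_v (fun y => (F y)^T) x = ('D_v F x)^T.
Proof.
move=> dF.
have d : differentiable (fun y => (F y)^T) x.
  by apply: differentiable_mx => i j; under eq_fun do rewrite mxE; exact: differentiable_entry.
split=> //; apply/matrixP => i j; rewrite derive_entry// [RHS]mxE.
by under eq_fun do rewrite mxE; rewrite derive_entry.
Qed.

Lemma derive_scale m n (f : V -> R) (H : V -> 'M[R]_(m, n)) x v :
  differentiable f x -> differentiable H x ->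
  differentiable (fun y => f y *: H y) x /\
  'D_v (fun y => f y *: H y) x = 'D_v f x *: H x + f x *: 'D_v H x.
Proof.
move=> df dH.
have dHij i j : differentiable (fun y => H y i j) x by exact: differentiable_entry.
have d : differentiable (fun y => f y *: H y) x.
  apply: differentiable_mx => i j; under eq_fun do rewrite mxE.
  exact: differentiableM.
split=> //; apply/matrixP => i j; rewrite derive_entry// !mxE.
under eq_fun do rewrite mxE.
rewrite deriveM; [|exact: diff_derivable|exact: diff_derivable].
by rewrite !derive_entry// addrC /GRing.scale/= [H x i j * _]mulrC.
Qed.

Lemma derive_bform n (A : V -> 'M[R]_n) (X Y : V -> 'rV[R]_n) x v :
  differentiable A x -> differentiable X x -> differentiable Y x ->
  'D_v (fun y => bform (A y) (X y) (Y y)) x =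
  bform ('D_v A x) (X x) (Y x) + bform (A x) ('D_v X x) (Y x)
  + bform (A x) (X x) ('D_v Y x).
Proof.
move=> dA dX dY; have [dY' EY] := derive_tr v dY.
have [d1 E1] := derive_mul v dX dA; have [d2 E2] := derive_mul v d1 dY'.
rewrite /bform -(derive_entry v 0 0 d2) E2 E1 EY mulmxDl !mxE.
by congr (_ + _); exact: addrC.
Qed.

End DeriveMx.

Lemma linear_eq_delta (W : lmodType R) n (F H : 'rV[R]_n -> W) :
  (forall c u u', F (c *: u + u') = c *: F u + F u') ->
  (forall c u u', H (c *: u + u') = c *: H u + H u') ->
  (forall k, F (delta_mx 0 k) = H (delta_mx 0 k)) -> forall v, F v = H v.
Proof.
move=> lF lH FH v; rewrite linear_delta// [RHS]linear_delta//.
by apply: eq_bigr => k _; rewrite FH.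
Qed.

End BilinearForms.

(** * The Levi-Civita connection and its curvature *)

Section LeviCivita.
Variables (R : realType) (n : nat).
Implicit Types (G : mfield R n) (U : set 'rV[R]_n) (x u v w z : 'rV[R]_n).

Lemma GamE_delta G x v w :
  Gam G x v w = \sum_i \sum_j (v 0 i * w 0 j) *: Gam G x (delta_mx 0 i) (delta_mx 0 j).
Proof.
apply/rowP => k; rewrite summxE [LHS]mxE; apply: eq_bigr => i _.
rewrite summxE; apply: eq_bigr => j _; rewrite !mxE.
rewrite (bigD1 i)//= (bigD1 j)//= !mxE !eqxx/= !mulr1.
rewrite big1 ?addr0 => [|r /negbTE rq]; last by rewrite !mxE rq mulr0.
rewrite big1 ?addr0 => [|r /negbTE rp]; first by rewrite [RHS]mulrC mulrA.
by apply: big1 => s _; rewrite !mxE rp mulr0 mul0r.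
Qed.

Lemma Gam_delta G x i j k :
  Gam G x (delta_mx 0 i) (delta_mx 0 j) 0 k = christoffel G x k i j.
Proof.
rewrite mxE (bigD1 i)//= (bigD1 j)//= !mxE !eqxx/= !mulr1.
rewrite big1 ?addr0 => [|r /negbTE rq]; last by rewrite !mxE rq mulr0.
rewrite big1 ?addr0 // => r /negbTE rp.
by apply: big1 => s _; rewrite !mxE rp mulr0 mul0r.
Qed.

Lemma GamDr G x v w w' : Gam G x v (w + w') = Gam G x v w + Gam G x v w'.
Proof.
rewrite !(GamE_delta _ _ v) -big_split; apply: eq_bigr => i _ /=.
rewrite -big_split; apply: eq_bigr => j _ /=.
by rewrite -scalerDl mxE mulrDr.
Qed.

Lemma GamZr G x c v w : Gam G x v (c *: w) = c *: Gam G x v w.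
Proof.
rewrite !(GamE_delta _ _ v) scaler_sumr; apply: eq_bigr => i _ /=.
rewrite scaler_sumr; apply: eq_bigr => j _ /=.
by rewrite scalerA mxE mulrCA.
Qed.

Lemma Gam_linl G x c v v' w :
  Gam G x (c *: v + v') w = c *: Gam G x v w + Gam G x v' w.
Proof. by rewrite GamDl GamZl. Qed.
Lemma Gam_linr G x c v w w' :
  Gam G x v (c *: w + w') = c *: Gam G x v w + Gam G x v w'.
Proof. by rewrite GamDr GamZr. Qed.
Lemma Gam0l G x w : Gam G x 0 w = 0.
Proof. by have := GamZl G x 0 0 w; rewrite !scale0r. Qed.
Lemma Gam0r G x w : Gam G x w 0 = 0.
Proof. by have := GamZr G x 0 w 0; rewrite !scale0r. Qed.
Lemma GamNl G x v w : Gam G x (- v) w = - Gam G x v w.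
Proof. by rewrite -scaleN1r GamZl scaleN1r. Qed.

(** What the Koszul formula needs of a metric at one point. Positivity is left out so that it
    applies to [sasaki] as well. *)
Definition metric_at G x := [/\ G x \in unitmx, (G x)^T = G x,
  differentiable G x & forall v, ('D_v G x)^T = 'D_v G x].

Lemma Gam_sym G x v w : metric_at G x -> Gam G x v w = Gam G x w v.
Proof.
case=> _ _ _ sD; rewrite !GamE_delta exchange_big; apply: eq_bigr => i _ /=.
apply: eq_bigr => j _; rewrite mulrC; congr (_ *: _).
by apply/rowP => k; rewrite !Gam_delta christoffelC.
Qed.

Lemma Gam_compat G x v w z : metric_at G x ->
  bform ('D_v G x) w z = bform (G x) (Gam G x v w) z + bform (G x) w (Gam G x v z).
Proof.
case=> Gu sG dG sD.
apply: (@linear_eq_delta _ R^o _ (fun v => bform ('D_v G x) w z)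
  (fun v => bform (G x) (Gam G x v w) z + bform (G x) w (Gam G x v z))).
- by move=> c a b; rewrite derive_dirD// derive_dirZ// bformDm bformZm.
- move=> c a b; rewrite !Gam_linl bformDl bformDr bformZl bformZr /GRing.scale/=.
  ring.
move=> k.
apply: (@linear_eq_delta _ R^o _ (fun w => bform ('D_(delta_mx 0 k) G x) w z)
  (fun w => bform (G x) (Gam G x (delta_mx 0 k) w) z + bform (G x) w (Gam G x (delta_mx 0 k) z))).
- by move=> c a b; rewrite bformDl bformZl.
- move=> c a b; rewrite !Gam_linr !bformDl !bformZl /GRing.scale/=; ring.
move=> i.
apply: (@linear_eq_delta _ R^o _ (fun z => bform ('D_(delta_mx 0 k) G x) (delta_mx 0 i) z)
  (fun z => bform (G x) (Gam G x (delta_mx 0 k) (delta_mx 0 i)) z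
   + bform (G x) (delta_mx 0 i) (Gam G x (delta_mx 0 k) z))).
- by move=> c a b; rewrite bformDr bformZr.
- move=> c a b; rewrite !Gam_linr !bformDr !bformZr /GRing.scale/=; ring.
by move=> j; rewrite bform_delta Gam_metric.
Qed.

Lemma koszul G x v w z : metric_at G x ->
  2 * bform (G x) (Gam G x v w) z =
  bform ('D_v G x) w z + bform ('D_w G x) v z - bform ('D_z G x) v w.
Proof.
move=> mG; have [_ sG _ _] := mG.
rewrite !Gam_compat// (Gam_sym w v mG) (Gam_sym w z mG) (Gam_sym v z mG).
rewrite (bform_sym sG w (Gam G x z v)).
ring.
Qed.

Definition metric_on U G := [/\ open U, smooth_on U G,
  forall x, U x -> (G x)^T = G x &
  forall x v, U x -> v != 0 -> 0 < bform (G x) v v].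

Lemma metric_onS U U' G : open U' -> U' `<=` U -> metric_on U G -> metric_on U' G.
Proof.
move=> oU' UU' [oU sG symG pG]; split=> //.
- exact: smooth_on_sub sG.
- by move=> x /UU'; exact: symG.
- by move=> x v /UU'; exact: pG.
Qed.

Lemma derive_sym U G x v : open U -> U x -> smooth_on U G ->
  (forall x, U x -> (G x)^T = G x) -> ('D_v G x)^T = 'D_v G x.
Proof.
move=> oU Ux sG symG; have dG := smooth_on_differentiable sG Ux.
rewrite -(derive_tr v dG).2; apply: near_eq_derive.
by apply: filterS (open_nbhs_nbhs (conj oU Ux)) => y /symG.
Qed.

Lemma metric_on_at U G x : metric_on U G -> U x -> metric_at G x.
Proof.
move=> [oU sG symG pG] Ux; split.
- by apply: posdef_unitmx => v; exact: pG.
- exact: symG.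
- exact: smooth_on_differentiable sG Ux.
- by move=> v; exact: derive_sym oU Ux sG symG.
Qed.

Lemma chol_invmx (A : 'M[R]_n) : A^T = A -> (forall v, v != 0 -> 0 < bform A v v) ->
  invmx A = (chol A)^T *m chol A.
Proof.
move=> sA pA; have PAP := cholP sA pA.
have H : (chol A)^T *m chol A *m A = 1%:M by rewrite -mulmxA; exact: mulmx1C PAP.
by rewrite -[RHS](mulmxK (posdef_unitmx pA)) H mul1mx.
Qed.

(** The inverse of [G] is P^T P with P = [chol G], so it inherits smoothness from the Cholesky
    factor. *)
Lemma smooth_on_invmx U G : metric_on U G -> smooth_on U (fun x => invmx (G x)).
Proof.
move=> [oU sG symG pG].
apply: (@eq_smooth_on _ _ _ _ (fun x => (chol (G x))^T *m chol (G x))) => //.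
  by move=> x Ux; rewrite chol_invmx// => [|v]; [exact: symG|exact: pG].
have sc : smooth_on U (fun x => chol (G x)) by exact: smooth_on_chol.
by apply: smooth_on_mul => //; exact: smooth_on_tr.
Qed.

Lemma smooth_on_christoffel U G k i j : metric_on U G ->
  smooth_on U (fun x => christoffel G x k i j).
Proof.
move=> mG; have sI := smooth_on_invmx mG; case: mG => oU sG symG pG.
apply: smooth_onM => //; first exact: smooth_on_cst.
apply: smooth_on_sum => // l _; apply: smooth_onM => //; first exact: smooth_on_entry.
have sD a : smooth_on U (fun x => 'D_a G x) by exact: smooth_on_derive.
by apply: smooth_onB => //; first apply: smooth_onD => //; exact: smooth_on_entry.
Qed.

Lemma smooth_on_Gam (V : normedModType R) (U' : set V) U G (p : V -> 'rV[R]_n) (X Y : V ->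
  'rV[R]_n) :
  metric_on U G -> open U' -> (forall a, U' a -> U (p a)) -> smooth_on U' p ->
  smooth_on U' X -> smooth_on U' Y ->
  smooth_on U' (fun a => Gam G (p a) (X a) (Y a)).
Proof.
move=> mG oU' pU sp sX sY; have oU : open U by case: mG.
apply: smooth_on_mx => // r k; under eq_fun do rewrite mxE.
apply: smooth_on_sum => // i _; apply: smooth_on_sum => // j _.
apply: smooth_onM => //; last exact: smooth_on_entry.
apply: smooth_onM => //; last exact: smooth_on_entry.
apply: (@smooth_on_comp_scalar _ _ _ _ U p (fun x => christoffel G x k i j)) => //.
exact: smooth_on_christoffel.
Qed.

Lemma derive_Gam_comp (V : normedModType R) U G (p X Y : V -> 'rV[R]_n) (a u : V) :
  metric_on U G -> U (p a) ->
  differentiable p a -> differentiable X a -> differentiable Y a ->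
  'D_u (fun b => Gam G (p b) (X b) (Y b)) a =
  'D_('D_u p a) (fun y => Gam G y (X a) (Y a)) (p a) + Gam G (p a) ('D_u X a) (Y a)
  + Gam G (p a) (X a) ('D_u Y a).
Proof.
move=> mG Up dp dX dY; have oU : open U by case: mG.
pose c i j (y : 'rV[R]_n) := Gam G y (delta_mx 0 i) (delta_mx 0 j).
have dc i j : differentiable (c i j) (p a).
  apply: (@smooth_on_differentiable _ _ _ U) => //.
  by apply: (smooth_on_Gam (U' := U) (p := id) mG) => //;
    [exact: smooth_on_id|exact: smooth_on_cst|exact: smooth_on_cst].
(* [key] is used twice: for the given maps, and for [id] with frozen arguments. The latter is the
   term on the right that differentiates the Christoffel symbols. *)
have key (V' : normedModType R) (q A B : V' -> 'rV[R]_n) (b v : V') : q b = p a ->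
    differentiable q b -> differentiable A b -> differentiable B b ->
    'D_v (fun y => Gam G (q y) (A y) (B y)) b =
    \sum_i \sum_j (('D_v A b 0 i * B b 0 j) *: c i j (p a)
     + (A b 0 i * 'D_v B b 0 j) *: c i j (p a)
     + (A b 0 i * B b 0 j) *: 'D_('D_v q b) (c i j) (p a)).
  move=> qb dq dA dB.
  have dAi i : differentiable (fun y => A y 0 i) b by exact: differentiable_entry.
  have dBi i : differentiable (fun y => B y 0 i) b by exact: differentiable_entry.
  have dAB i j : differentiable (fun y => A y 0 i * B y 0 j) b.
    exact: (differentiableM (dAi i) (dBi j)).
  have dc' i j : differentiable (c i j) (q b) by rewrite qb.
  have dcq i j : differentiable (c i j \o q) b by exact: differentiable_comp.
  under [fun y => _]eq_fun do rewrite GamE_delta.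
  have D1 i := @derive_bigsum _ _ _ _ (index_enum 'I_n)
    (fun j y => (A y 0 i * B y 0 j) *: c i j (q y)) b v
    (fun j => (derive_scale v (dAB i j) (dcq i j)).1).
  have [_ ->] := @derive_bigsum _ _ _ _ (index_enum 'I_n)
    (fun i y => \sum_j (A y 0 i * B y 0 j) *: c i j (q y)) b v (fun i => (D1 i).1).
  apply: eq_bigr => i _; rewrite (D1 i).2; apply: eq_bigr => j _.
  rewrite (derive_scale v (dAB i j) (dcq i j)).2 (derive_comp v dq (dc' i j)) qb.
  congr (_ + _); rewrite /comp qb.
  rewrite deriveM; [|exact: diff_derivable|exact: diff_derivable].
  rewrite -scalerDl; congr (_ *: _).
  rewrite (derive_entry v 0 i dA) (derive_entry v 0 j dB) addrC /GRing.scale/=.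
  by rewrite [B b 0 j * _]mulrC.
have dcst w : differentiable (fun=> w : 'rV[R]_n) (p a) by exact: differentiable_cst.
rewrite (key _ p X Y a u)// (key _ id (fun=> X a) (fun=> Y a) (p a) ('D_u p a))//.
rewrite (GamE_delta G (p a) ('D_u X a)) (GamE_delta G (p a) (X a)).
rewrite -!big_split; apply: eq_bigr => i _ /=; rewrite -!big_split; apply: eq_bigr => j _ /=.
rewrite !(derive_cst) derive_id !mxE !mul0r !mulr0 !scale0r !add0r.
by rewrite [LHS]addrC [LHS]addrA.
Qed.

Lemma derive_Gam U G (X Y : vfield R n) x u : metric_on U G -> U x ->
  differentiable X x -> differentiable Y x ->
  'D_u (fun y => Gam G y (X y) (Y y)) x =
  'D_u (fun y => Gam G y (X x) (Y x)) x + Gam G x ('D_u X x) (Y x)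
  + Gam G x (X x) ('D_u Y x).
Proof.
move=> mG Ux dX dY.
have did : differentiable (id : 'rV[R]_n -> 'rV[R]_n) x by [].
have E := @derive_Gam_comp _ U G id X Y x u mG Ux did dX dY.
rewrite derive_id in E; exact: E.
Qed.

Lemma differentiable_bigsum (V W : normedModType R) (I : Type) (r : seq I) (f : I -> V -> W) (a :
  V) :
  (forall i, differentiable (f i) a) -> differentiable (fun y => \sum_(i <- r) f i y) a.
Proof. by move=> df; have [] := derive_bigsum r 0 df. Qed.

Lemma derive_dir_field U (Z Y : vfield R n) x u : open U -> U x ->
  smooth_on U Z -> differentiable Y x ->
  differentiable (fun y => 'D_(Y y) Z y) x /\
  'D_u (fun y => 'D_(Y y) Z y) x = 'D_('D_u Y x) Z x + 'D_u (fun y => 'D_(Y x) Z y) x.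
Proof.
move=> oU Ux sZ dY.
have dYi i : differentiable (fun y => Y y 0 i) x by exact: differentiable_entry.
have dZ i : differentiable (fun y => 'D_(delta_mx 0 i) Z y) x.
  by apply: smooth_on_differentiable Ux; exact: smooth_on_derive.
have nU := open_nbhs_nbhs (conj oU Ux).
have E (A : vfield R n) : differentiable A x ->
    differentiable (fun y => 'D_(A y) Z y) x /\ 'D_u (fun y => 'D_(A y) Z y) x =
    \sum_i ('D_u A x 0 i *: 'D_(delta_mx 0 i) Z x +
            A x 0 i *: 'D_u (fun y => 'D_(delta_mx 0 i) Z y) x).
  move=> dA.
  have dAi i : differentiable (fun y => A y 0 i) x by exact: differentiable_entry.
  have EA : \near x, \sum_i A x 0 i *: 'D_(delta_mx 0 i) Z x = 'D_(A x) Z x.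
    apply: filterS nU => y Uy; rewrite [RHS]derive_dir_row//.
    exact: smooth_on_differentiable Uy.
  have [d1 d2] := @derive_bigsum _ _ _ _ (index_enum 'I_n)
    (fun i y => A y 0 i *: 'D_(delta_mx 0 i) Z y) x u
    (fun i => (derive_scale u (dAi i) (dZ i)).1).
  split; first exact: near_eq_differentiable EA d1.
  rewrite -(near_eq_derive u EA) d2; apply: eq_bigr => i _.
  by rewrite (derive_scale u (dAi i) (dZ i)).2 (derive_entry u 0 i dA).
split; first exact: (E Y dY).1.
have E2 : 'D_u (fun y => 'D_(Y x) Z y) x =
    \sum_i ('D_u (fun=> Y x) x 0 i *: 'D_(delta_mx 0 i) Z x +
            Y x 0 i *: 'D_u (fun y => 'D_(delta_mx 0 i) Z y) x).
  exact: (E (fun=> Y x) (differentiable_cst _ _)).2.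
apply: etrans (E Y dY).2 _; rewrite big_split; congr (_ + _).
  by rewrite -derive_dir_row//; exact: smooth_on_differentiable sZ Ux.
apply: etrans (esym E2); apply: eq_bigr => i _.
by rewrite derive_cst mxE scale0r add0r.
Qed.

Lemma smooth_on_dir_row U (Z Y : vfield R n) : open U ->
  smooth_on U Z -> smooth_on U Y -> smooth_on U (fun y => 'D_(Y y) Z y).
Proof.
move=> oU sZ sY.
apply: (@eq_smooth_on _ _ _ _ (fun y => \sum_i Y y 0 i *: 'D_(delta_mx 0 i) Z y)) => //.
  by move=> y Uy; rewrite [RHS]derive_dir_row//; exact: smooth_on_differentiable Uy.
apply: smooth_on_sum => // i _; apply: smooth_on_scale => //.
  exact: smooth_on_entry.
exact: smooth_on_derive.
Qed.

Lemma smooth_on_nabla U G (X Y : vfield R n) : metric_on U G ->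
  smooth_on U X -> smooth_on U Y -> smooth_on U (nabla G X Y).
Proof.
move=> mG sX sY; have oU : open U by case: mG.
apply: smooth_onD => //; first exact: smooth_on_dir_row.
by apply: (smooth_on_Gam (U' := U) (p := id) mG) => //; exact: smooth_on_id.
Qed.

(** The curvature as a trilinear function of vectors at one point, written with Christoffel symbols.
    [curvE] identifies it with [curv], so that [curv] depends only on the values of its arguments at
    the point. *)
Definition Rm G x u v w : 'rV[R]_n :=
  'D_u (fun y => Gam G y v w) x - 'D_v (fun y => Gam G y u w) x
  + Gam G x u (Gam G x v w) - Gam G x v (Gam G x u w).

Lemma nabla_metric U G (X Y Z : vfield R n) x : metric_on U G -> U x ->
  differentiable Y x -> differentiable Z x ->
  'D_(X x) (fun y => bform (G y) (Y y) (Z y)) x =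
  bform (G x) (nabla G X Y x) (Z x) + bform (G x) (Y x) (nabla G X Z x).
Proof.
move=> mG Ux dY dZ; have mGx := metric_on_at mG Ux; have [_ _ dG _] := mGx.
by rewrite derive_bform// Gam_compat// /nabla bformDl bformDr; ring.
Qed.

Lemma nabla_nabla U G (X Y Z : vfield R n) x : metric_on U G -> U x ->
  differentiable Y x -> smooth_on U Z ->
  nabla G X (nabla G Y Z) x =
  'D_('D_(X x) Y x) Z x + 'D_(X x) (fun y => 'D_(Y x) Z y) x
  + ('D_(X x) (fun y => Gam G y (Y x) (Z x)) x + Gam G x ('D_(X x) Y x) (Z x)
  + Gam G x (Y x) ('D_(X x) Z x))
  + (Gam G x (X x) ('D_(Y x) Z x) + Gam G x (X x) (Gam G x (Y x) (Z x))).
Proof.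
move=> mG Ux dY sZ; have oU : open U by case: mG.
have dZ := smooth_on_differentiable sZ Ux.
have [d1 E1] := derive_dir_field (X x) oU Ux sZ dY.
have d2 : differentiable (fun y => Gam G y (Y y) (Z y)) x.
  have dYi i : differentiable (fun y => Y y 0 i) x by exact: differentiable_entry.
  have dZi i : differentiable (fun y => Z y 0 i) x by exact: differentiable_entry.
  apply: differentiable_mx => i k; under eq_fun do rewrite mxE.
  apply: differentiable_bigsum => a; apply: differentiable_bigsum => b.
  apply: differentiableM => //; apply: differentiableM => //.
  by apply: (smooth_on_differentiable (smooth_on_christoffel _ _ _ mG) Ux).
rewrite {1}/nabla deriveD; [|exact: diff_derivable|exact: diff_derivable].
by rewrite E1 (derive_Gam _ mG)// -GamDr.
Qed.

(** The second derivatives of [Z] cancel by [schwarz], and the terms that differentiate [X] and [Y]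
    cancel against the bracket. *)
Lemma curvE U G (X Y Z : vfield R n) x : metric_on U G -> U x ->
  differentiable X x -> differentiable Y x -> smooth_on U Z ->
  curv G X Y Z x = Rm G x (X x) (Y x) (Z x).
Proof.
move=> mG Ux dX dY sZ; have oU : open U by case: mG.
have dZ := smooth_on_differentiable sZ Ux.
rewrite /curv !(nabla_nabla _ mG)// /nabla /bracket /Rm.
rewrite derive_dirD// derive_dirN// GamDl GamNl.
rewrite (@schwarz _ _ _ _ _ Z x (X x) (Y x) oU Ux sZ).
have zz (a1 a2 a3 a4 a5 a6 a7 b1 b3 b4 b6 b7 : 'rV[R]_n) :
  a1 + a2 + (a3 + a4 + a5) + (a6 + a7) - (b1 + a2 + (b3 + b4 + a6) + (a5 + b7)) -
  (a1 - b1 + (a4 - b4)) = a3 - b3 + a7 - b7.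
  by apply/rowP => k; rewrite !mxE; ring.
exact: zz.
Qed.

End LeviCivita.

Lemma nablaE (R : realType) n (G : mfield R n) (X Y : vfield R n) x :
  nabla G X Y x = 'D_(X x) Y x + Gam G x (X x) (Y x).
Proof. by []. Qed.

Lemma curv_def (R : realType) n (G : mfield R n) (X Y Z : vfield R n) x :
  curv G X Y Z x = nabla G X (nabla G Y Z) x - nabla G Y (nabla G X Z) x
           - nabla G (bracket X Y) Z x.
Proof. by []. Qed.

Definition DGam (R : realType) n (G : mfield R n) x u v w : 'rV[R]_n :=
  'D_u (fun y => Gam G y v w) x.

Lemma RmE (R : realType) n (G : mfield R n) x u v w : Rm G x u v w =
  DGam G x u v w - DGam G x v u w
  + Gam G x u (Gam G x v w) - Gam G x v (Gam G x u w).
Proof. by []. Qed.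

Lemma endoE (R : realType) n (phi : mfield R n) (X : vfield R n) x :
  endo_app phi X x = X x *m phi x.
Proof. by []. Qed.

Lemma bform_rows (R : realType) n m (A : 'M[R]_n) (P Q : 'M[R]_(m, n)) i j :
  bform A (row i P) (row j Q) = (P *m A *m Q^T) i j.
Proof. by rewrite /bform -row_mul mxE [RHS]mxE; apply: eq_bigr => k _; rewrite !mxE. Qed.

Lemma bform_mulr (R : realType) n (A B : 'M[R]_n) v w :
  bform (A *m B^T) v w = bform A v (w *m B).
Proof. by rewrite /bform trmx_mul !mulmxA. Qed.

Opaque Gam nabla curv Rm bform endo_app.

(** * Symmetries of the curvature tensor and its commutation with [phi] *)

Section Curvature.
Variables (R : realType) (n : nat) (G : mfield R n) (U : set 'rV[R]_n).
Hypothesis mG : metric_on U G.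
Implicit Types (x u v w z : 'rV[R]_n).

Let oU : open U. Proof. by case: mG. Qed.
Let sG x (Ux : U x) : (G x)^T = G x. Proof. by case: mG => _ _ H _; exact: H. Qed.
Let pG x (Ux : U x) v : v != 0 -> 0 < bform (G x) v v.
Proof. by case: mG => _ _ _ H; exact: H. Qed.

Lemma smooth_on_Gam_cst v w : smooth_on U (fun y => Gam G y v w).
Proof.
by apply: (smooth_on_Gam (U' := U) (p := id) mG) => //;
  [exact: smooth_on_id|exact: smooth_on_cst|exact: smooth_on_cst].
Qed.

Lemma differentiable_Gam_cst v w x : U x -> differentiable (fun y => Gam G y v w) x.
Proof. by move=> Ux; exact: smooth_on_differentiable (smooth_on_Gam_cst v w) Ux. Qed.

Lemma DGam_lin1 x c u u' v w : U x ->
  DGam G x (c *: u + u') v w = c *: DGam G x u v w + DGam G x u' v w.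
Proof.
move=> Ux; have d := differentiable_Gam_cst v w Ux.
by rewrite /DGam derive_dirD// derive_dirZ.
Qed.

Lemma DGam_lin2 x c u v v' w : U x ->
  DGam G x u (c *: v + v') w = c *: DGam G x u v w + DGam G x u v' w.
Proof.
move=> Ux; have d a := differentiable_Gam_cst a w Ux.
rewrite /DGam; under [fun y => _]eq_fun do rewrite Gam_linl.
have [d' E] := derive_scale u (differentiable_cst c x) (d v).
rewrite deriveD; [|exact: diff_derivable|exact: diff_derivable].
by rewrite E derive_cst scale0r add0r.
Qed.

Lemma DGam_sym x u v w : U x -> DGam G x u v w = DGam G x u w v.
Proof.
move=> Ux; apply: near_eq_derive.
by apply: filterS (open_nbhs_nbhs (conj oU Ux)) => y Uy; exact: Gam_sym (metric_on_at mG Uy).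
Qed.

Lemma DGam_lin3 x c u v w w' : U x ->
  DGam G x u v (c *: w + w') = c *: DGam G x u v w + DGam G x u v w'.
Proof. by move=> Ux; rewrite !(DGam_sym _ v)// DGam_lin2. Qed.

Lemma Rm_skew x u v w : Rm G x u v w = - Rm G x v u w.
Proof.
rewrite !RmE; move: (DGam _ _ _ _ _) (DGam _ _ _ _ _) (Gam G _ _ _) (Gam G _ _ _).
by move=> a1 a2 a3 a4; apply/rowP => k; rewrite !mxE; ring.
Qed.

Lemma Rm_lin1 x c u u' v w : U x ->
  Rm G x (c *: u + u') v w = c *: Rm G x u v w + Rm G x u' v w.
Proof.
move=> Ux; rewrite !RmE DGam_lin1// DGam_lin2// !Gam_linl Gam_linr.
move: (DGam _ _ _ _ _) (DGam _ _ _ _ _) (DGam _ _ _ _ _) (DGam _ _ _ _ _) => a1 a2 a3 a4.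
move: (Gam G _ _ _) (Gam G _ _ _) (Gam G _ _ _) (Gam G _ _ _) => b1 b2 b3 b4.
by apply/rowP => k; rewrite !mxE; ring.
Qed.

Lemma Rm_lin2 x c u v v' w : U x ->
  Rm G x u (c *: v + v') w = c *: Rm G x u v w + Rm G x u v' w.
Proof.
move=> Ux; rewrite Rm_skew Rm_lin1// opprD -scalerN -!Rm_skew.
by rewrite -[Rm G x u v w]opprK -Rm_skew scalerN.
Qed.

Lemma Rm_lin3 x c u v w w' : U x ->
  Rm G x u v (c *: w + w') = c *: Rm G x u v w + Rm G x u v w'.
Proof.
move=> Ux; rewrite !RmE !DGam_lin3// !Gam_linr.
move: (DGam _ _ _ _ _) (DGam _ _ _ _ _) (DGam _ _ _ _ _) (DGam _ _ _ _ _) => a1 a2 a3 a4.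
move: (Gam G _ _ _) (Gam G _ _ _) (Gam G _ _ _) (Gam G _ _ _) => b1 b2 b3 b4.
by apply/rowP => k; rewrite !mxE; ring.
Qed.

Lemma bianchi x u v w : U x -> Rm G x u v w + Rm G x v w u + Rm G x w u v = 0.
Proof.
move=> Ux; have mGx := metric_on_at mG Ux; rewrite !RmE.
rewrite (DGam_sym u w v)// (DGam_sym v w u)// (DGam_sym w v u)//.
rewrite (Gam_sym w u mGx) (Gam_sym v w mGx) (Gam_sym v u mGx).
move: (DGam _ _ _ _ _) (DGam _ _ _ _ _) (DGam _ _ _ _ _) => a1 a2 a3.
move: (Gam G _ _ _) (Gam G _ _ _) (Gam G _ _ _) => b1 b2 b3.
by apply/rowP => k; rewrite !mxE; ring.
Qed.

(** For constant [w] and [z] the second derivatives of g(w, z) along [u] and [v] commute. Expanding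
    both orders by metric compatibility, the mixed terms cancel and the skew-adjointness of R(u, v)
    remains. *)
Lemma Rm_metric x u v w z : U x ->
  bform (G x) (Rm G x u v w) z = - bform (G x) w (Rm G x u v z).
Proof.
move=> Ux; pose f y := bform (G y) w z.
have sf : smooth_on U f.
  by apply: smooth_on_bform => //; [case: mG|exact: smooth_on_cst|exact: smooth_on_cst].
have nab a b y : nabla G (fun=> a) (fun=> b) y = Gam G y a b.
  by rewrite nablaE derive_cst add0r.
have Df a y : U y -> 'D_a f y = bform (G y) (Gam G y a w) z + bform (G y) w (Gam G y a z).
  move=> Uy; have := @nabla_metric _ _ U G (fun=> a) (fun=> w) (fun=> z) y mG Uy.
  by rewrite !nab; apply; exact: differentiable_cst.
have DDf a b : 'D_a (fun y => 'D_b f y) x =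
    bform (G x) (DGam G x a b w + Gam G x a (Gam G x b w)) z
    + bform (G x) (Gam G x b w) (Gam G x a z)
    + (bform (G x) (Gam G x a w) (Gam G x b z)
    + bform (G x) w (DGam G x a b z + Gam G x a (Gam G x b z))).
  transitivity ('D_a (fun y => bform (G y) (Gam G y b w) z + bform (G y) w (Gam G y b z)) x).
    by apply: near_eq_derive; apply: filterS (open_nbhs_nbhs (conj oU Ux)) => y; exact: Df.
  have dc q : differentiable (fun=> q : 'rV[R]_n) x by exact: differentiable_cst.
  have dG2 q := differentiable_Gam_cst b q Ux.
  have E1 := @nabla_metric _ _ U G (fun=> a) (fun y => Gam G y b w) (fun=> z) x mG Ux (dG2 w) (dc
    z).
  have E2 := @nabla_metric _ _ U G (fun=> a) (fun=> w) (fun y => Gam G y b z) x mG Ux (dc w) (dG2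
    z).
  have dd (X Y : vfield R n) : smooth_on U X -> smooth_on U Y ->
    derivable (fun y => bform (G y) (X y) (Y y)) x a.
    move=> sX sY; apply/diff_derivable/(@smooth_on_differentiable _ _ _ U) => //.
    by apply: smooth_on_bform => //; case: mG.
  rewrite deriveD; [|apply: dd; [exact: smooth_on_Gam_cst|exact: smooth_on_cst]
    |apply: dd; [exact: smooth_on_cst|exact: smooth_on_Gam_cst]].
  rewrite E1 E2 !nab; congr (_ + _ + (_ + _)).
have S := schwarz_scalar u v oU Ux sf.
have {}S : 'D_u (fun y => 'D_v f y) x = 'D_v (fun y => 'D_u f y) x by exact: esym.
rewrite !DDf in S; rewrite !RmE !bformDl !bformNl !bformDr !bformNr.
rewrite !bformDl !bformDr in S; move: S.
move: (bform _ (DGam G x u v w) z) (bform _ (DGam G x v u w) z) => a1 a2.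
move: (bform _ (Gam G x u (Gam G x v w)) z) (bform _ (Gam G x v (Gam G x u w)) z) => a3 a4.
move: (bform _ (Gam G x v w) _) (bform _ (Gam G x u w) _) => a5 a6.
move: (bform _ w _) (bform _ w _) (bform _ w _) (bform _ w _) => a7 a8 a9 a10.
lra.
Qed.

(** Four instances of the Bianchi identity together with the two skew symmetries form a linear
    system that yields the pair symmetry. *)
Lemma Rm_pair x u v w z : U x ->
  bform (G x) (Rm G x u v w) z = bform (G x) (Rm G x w z u) v.
Proof.
move=> Ux; pose B a b c d := bform (G x) (Rm G x a b c) d.
have B12 a b c d : B a b c d = - B b a c d by rewrite /B Rm_skew bformNl.
have B34 a b c d : B a b c d = - B a b d c.
  by rewrite /B Rm_metric// (bform_sym (sG Ux)).
have Bi a b c d : B a b c d + B b c a d + B c a b d = 0.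
  by rewrite /B -!bformDl bianchi// bform0l.
have b1 := Bi u v w z; have b2 := Bi v w z u; have b3 := Bi w z u v; have b4 := Bi z u v w.
rewrite -/(B u v w z) -/(B w z u v).
have h4 : B z u w v = B u z v w by rewrite (B12 z u w v) (B34 u z w v) opprK.
have h5 : B u w z v = B w u v z by rewrite (B12 u w z v) (B34 w u z v) opprK.
rewrite (B34 v w z u) (B34 w z v u) (B12 z v w u) in b2.
rewrite h4 h5 in b3; rewrite (B34 z u v w) h4 (B34 u v z w) (B34 v z u w) in b4.
move: (B u v w z) (B w z u v) (B v w u z) (B w u v z) (B v z w u) (B u z v w) b1 b2 b3 b4.
by move=> a a' b c c' b'; lra.
Qed.

Variable phi : mfield R n.
Hypothesis sphi : smooth_on U phi.
Hypothesis phi_self : forall x v w, U x ->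
  bform (G x) (v *m phi x) w = bform (G x) v (w *m phi x).
Hypothesis phi_parallel : forall X Y : vfield R n,
  smooth_on U X -> smooth_on U Y -> forall x, U x -> nabla_endo G phi X Y x = 0.

Lemma nabla_near (X Y Y' : vfield R n) x :
  (\near x, Y x = Y' x) -> nabla G X Y x = nabla G X Y' x.
Proof. by move=> YY'; rewrite !nablaE (near_eq_derive _ YY') (nbhs_singleton YY'). Qed.

Lemma eq_nabla (X Y Y' : vfield R n) x : U x -> (forall y, U y -> Y y = Y' y) ->
  nabla G X Y x = nabla G X Y' x.
Proof.
move=> Ux H; apply: nabla_near.
by apply: filterS (open_nbhs_nbhs (conj oU Ux)) => y; exact: H.
Qed.

Lemma smooth_on_endo (X : vfield R n) : smooth_on U X -> smooth_on U (endo_app phi X).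
Proof. by move=> sX; exact: smooth_on_mul. Qed.

Lemma nabla_phi (X Y : vfield R n) x : smooth_on U X -> smooth_on U Y -> U x ->
  nabla G X (endo_app phi Y) x = endo_app phi (nabla G X Y) x.
Proof.
by move=> sX sY Ux; apply/eqP; rewrite -subr_eq0; apply/eqP; exact: phi_parallel.
Qed.

(** Since [phi] is parallel, it commutes with covariant differentiation and hence with the curvature
    operators. *)
Lemma Rm_phi x u v w : U x -> Rm G x u v (w *m phi x) = Rm G x u v w *m phi x.
Proof.
move=> Ux.
have sc a : smooth_on U (fun=> a : 'rV[R]_n) by exact: smooth_on_cst.
have dc a : differentiable (fun=> a : 'rV[R]_n) x by exact: differentiable_cst.
have sw : smooth_on U (endo_app phi (fun=> w)) by exact: smooth_on_endo.
rewrite -(@curvE _ _ U G (fun=> u) (fun=> v) (endo_app phi (fun=> w)) x mG Ux)//.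
rewrite -(@curvE _ _ U G (fun=> u) (fun=> v) (fun=> w) x mG Ux)//.
have H a b : nabla G (fun=> a) (nabla G (fun=> b) (endo_app phi (fun=> w))) x =
    nabla G (fun=> a) (nabla G (fun=> b) (fun=> w)) x *m phi x.
  apply: etrans (@eq_nabla _ _ (endo_app phi (nabla G (fun=> b) (fun=> w))) x Ux _) _.
    by move=> y Uy; exact: nabla_phi.
  rewrite (nabla_phi (sc a) _ Ux)//.
  exact: (smooth_on_nabla mG (sc b) (sc w)).
have sb : smooth_on U (bracket (fun=> u) (fun=> v)).
  by rewrite /bracket; under eq_fun do rewrite !derive_cst subr0; exact: sc.
rewrite !curv_def (H u v) (H v u) (nabla_phi sb (sc w) Ux) endoE.
rewrite [RHS]mulmxBl [in RHS]mulmxBl.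
reflexivity.
Qed.

(** By pair symmetry [u] and [v] become the argument of R(w, z) and the vector it is tested against;
    there [phi] passes through R and is self-adjoint. This is the purity of the curvature with
    respect to [phi]. *)
Lemma Rm_phi12 x u v w : U x -> Rm G x u (v *m phi x) w = Rm G x (u *m phi x) v w.
Proof.
move=> Ux; apply: (bform_inj (pG Ux)) => z.
rewrite (Rm_pair _ _ _ _ Ux) [RHS](Rm_pair _ _ _ _ Ux) Rm_phi//.
by rewrite -(phi_self _ _ Ux).
Qed.

End Curvature.

(** * Orthonormal frames and the operators of the equation *)

Section Frames.
Variables (R : realType) (n : nat) (G : mfield R n) (U : set 'rV[R]_n).
Hypothesis mG : metric_on U G.
Implicit Types (x u v w z : 'rV[R]_n) (X Y Z e : vfield R n).

Let oU : open U. Proof. by case: mG. Qed.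

(** An orthonormal frame that is smooth on all of [U], to be used instead of [frame], which is
    chosen anew at each point. *)
Definition Ef (i : 'I_n) : vfield R n := fun y => row i (chol (G y)).

Lemma smooth_on_Ef i : smooth_on U (Ef i).
Proof. by case: mG => _ sG symG pG; apply: smooth_on_row => //; exact: smooth_on_chol. Qed.

Lemma Ef_orthonormal y i j : U y -> bform (G y) (Ef i y) (Ef j y) = (i == j)%:R.
Proof.
move=> Uy; case: mG => _ _ symG pG; rewrite bform_rows cholP ?mxE//; first exact: symG.
by move=> v; exact: pG.
Qed.

Lemma frameP x : U x -> orthonormal_frame G x (frame G x).
Proof.
move=> Ux; rewrite /frame.
apply: (@xgetPex _ _ [set e | orthonormal_frame G x e]).
exists Ef; exists U; split=> //; first exact: smooth_on_Ef.
by move=> y Uy i j; exact: Ef_orthonormal.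
Qed.

(** All that is known of [frame G x] is that it is smooth and orthonormal near [x]. Once the traced
    expression is seen to depend bilinearly on the values at [x], it is a contraction with the
    inverse metric and any orthonormal basis will do. [T] may differentiate [e], whence the
    neighbourhoods [N] on which [e] is smooth. *)
Lemma Tr_tensor (W : lmodType R) (T : vfield R n -> W) (B : 'rV[R]_n -> 'rV[R]_n -> W) x :
  U x ->
  (forall c u u' v, B (c *: u + u') v = c *: B u v + B u' v) ->
  (forall c u u' v, B v (c *: u + u') = c *: B v u + B v u') ->
  (forall e N, open N -> N `<=` U -> N x -> smooth_on N e -> T e = B (e x) (e x)) ->
  Tr G x T = \sum_i B (Ef i x) (Ef i x).
Proof.
move=> Ux Bl Br TB; have [N [oN Nx sN oN1]] := frameP Ux.
pose P : 'M[R]_n := \matrix_(i, j) frame G x i x 0 j.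
have Pi i : row i P = frame G x i x by apply/rowP => j; rewrite !mxE.
have PAP : P *m G x *m P^T = 1%:M.
  by apply/matrixP => i j; rewrite -bform_rows !Pi mxE; exact: oN1.
have [_ _ symG pG] := mG.
rewrite (orthonormal_trace Bl Br (cholP (symG _ Ux) (fun v => pG x v Ux))).
rewrite -(orthonormal_trace Bl Br PAP); apply: eq_bigr => i _; rewrite Pi.
apply: (TB _ (N `&` U)); [exact: openI|exact: subIsetr|by []|].
by apply: smooth_on_sub (sN i) => y [].
Qed.

(* Components of (nabla_u A)(v). *)
Definition Btr (A : mfield R n) x u v :=
  v *m 'D_u A x + Gam G x u (v *m A x) - Gam G x u v *m A x.

Lemma nabla_mul (A : mfield R n) e f x : differentiable A x -> differentiable f x ->
  nabla G e (fun y => f y *m A y) x - nabla G e f x *m A x = Btr A x (e x) (f x).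
Proof.
move=> dA df; have [_ E] := derive_mul (e x) df dA.
rewrite !nablaE E mulmxDl /Btr.
move: (_ *m 'D_ _ _ _) (Gam G x (e x) (_ *m _)) ('D_(e x) f x *m A x) (Gam G x (e x) (f x) *m A
  x) => a b c d.
by apply/rowP => k; rewrite !mxE; ring.
Qed.

Lemma Btr_linl (A : mfield R n) x c u u' v : differentiable A x ->
  Btr A x (c *: u + u') v = c *: Btr A x u v + Btr A x u' v.
Proof.
move=> dA; rewrite /Btr derive_dirD// derive_dirZ// !Gam_linl mulmxDl mulmxDr.
rewrite -scalemxAl -scalemxAr.
move: (_ *m _) (_ *m _) (_ *m _) (_ *m _) => a1 a2 a3 a4.
move: (Gam G _ _ _) (Gam G _ _ _) => b1 b2.
by apply/rowP => k; rewrite !mxE; ring.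
Qed.

Lemma Btr_linr (A : mfield R n) x c u u' v :
  Btr A x v (c *: u + u') = c *: Btr A x v u + Btr A x v u'.
Proof.
rewrite /Btr !mulmxDl -!scalemxAl !Gam_linr mulmxDl -scalemxAl.
move: (_ *m _) (_ *m _) (_ *m _) (_ *m _) => a1 a2 a3 a4.
move: (Gam G _ _ _) (Gam G _ _ _) => b1 b2.
by apply/rowP => k; rewrite !mxE; ring.
Qed.

(* The endomorphism v |-> nabla_v X. *)
Definition Acov X : mfield R n :=
  fun y => \matrix_(i, j) nabla G (fun=> delta_mx 0 i) X y 0 j.

Lemma AcovE X y v : differentiable X y ->
  v *m Acov X y = 'D_v X y + Gam G y v (X y).
Proof.
move=> dX.
apply: (@linear_eq_delta _ 'rV[R]_n _ (fun v => v *m Acov X y) (fun v => 'D_v X y + Gam G y v (X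
  y))).
- by move=> c a b; rewrite mulmxDl -scalemxAl.
- by move=> c a b; rewrite derive_dirD// derive_dirZ// Gam_linl scalerDr addrACA.
by move=> k; rewrite -rowE; apply/rowP => j; rewrite 2!mxE nablaE.
Qed.

Lemma Acov_nabla X e y : differentiable X y -> nabla G e X y = e y *m Acov X y.
Proof. by move=> dX; rewrite AcovE// nablaE. Qed.

Lemma smooth_on_Acov X : smooth_on U X -> smooth_on U (Acov X).
Proof.
move=> sX; apply: smooth_on_mx => // i j; under eq_fun do rewrite mxE.
apply: smooth_on_entry => //.
have sc : smooth_on U (fun=> delta_mx 0 i : 'rV[R]_n) by exact: smooth_on_cst.
exact: (smooth_on_nabla mG sc sX).
Qed.

Definition Lap X : vfield R n := fun x =>
  - \sum_i (nabla G (Ef i) (nabla G (Ef i) X) x - nabla G (nabla G (Ef i) (Ef i)) X x).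

Lemma smooth_on_Lap X : smooth_on U X -> smooth_on U (Lap X).
Proof.
move=> sX; apply: smooth_onN => //; apply: smooth_on_sum => // i _.
have sE := smooth_on_Ef i.
apply: smooth_onB => //; apply: smooth_on_nabla => //; exact: smooth_on_nabla.
Qed.

(** With A = nabla X, the second covariant derivative is (nabla_e A)(e): the derivatives of [e]
    cancel and only the value [e x] remains, as [Tr_tensor] requires. *)
Lemma nabla2_tensor X e N x : open N -> N `<=` U -> N x -> smooth_on N e ->
  smooth_on U X ->
  nabla G e (nabla G e X) x - nabla G (nabla G e e) X x = Btr (Acov X) x (e x) (e x).
Proof.
move=> oN NU Nx se sX; have Ux := NU _ Nx.
have dX := smooth_on_differentiable sX Ux.
have dA := smooth_on_differentiable (smooth_on_Acov sX) Ux.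
have de := smooth_on_differentiable se Nx.
rewrite -nabla_mul// (Acov_nabla (nabla G e e) dX); congr (_ - _).
apply: nabla_near; apply: filterS (open_nbhs_nbhs (conj oN Nx)) => y /NU Uy.
by rewrite Acov_nabla//; exact: smooth_on_differentiable sX Uy.
Qed.

Lemma rough_lapE X x : smooth_on U X -> U x -> rough_lap G X x = Lap X x.
Proof.
move=> sX Ux; have dA := smooth_on_differentiable (smooth_on_Acov sX) Ux.
rewrite /rough_lap /Lap; congr (- _).
rewrite (@Tr_tensor _ _ (Btr (Acov X) x)) //.
- apply: eq_bigr => i _; symmetry.
  by apply: (@nabla2_tensor _ _ U) => //; exact: smooth_on_Ef.
- by move=> *; exact: Btr_linl.
- by move=> *; exact: Btr_linr.
- by move=> e N oN NU Nx se; exact: nabla2_tensor se sX.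
Qed.

(** Multilinearity reduces the claim to constant arguments, where [curvE] expresses R by covariant
    derivatives. The domain [V] is arbitrary because time-dependent fields live on the product with
    the time axis. *)
Lemma smooth_on_Rm (V : normedModType R) (U' : set V) (p X Y Z : V -> 'rV[R]_n) :
  open U' -> (forall a, U' a -> U (p a)) -> smooth_on U' p ->
  smooth_on U' X -> smooth_on U' Y -> smooth_on U' Z ->
  smooth_on U' (fun a => Rm G (p a) (X a) (Y a) (Z a)).
Proof.
move=> oU' pU sp sX sY sZ.
apply: (@eq_smooth_on _ _ _ _ (fun a => \sum_i \sum_j \sum_k (X a 0 i * Y a 0 j * Z a 0 k) *:
   Rm G (p a) (delta_mx 0 i) (delta_mx 0 j) (delta_mx 0 k))) => //.
  move=> a /pU Ua.
  rewrite [RHS](@linear_delta _ _ _ (fun u => Rm G (p a) u (Y a) (Z a))); last first.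
    by move=> *; exact: Rm_lin1 mG _ _ _ _ _ _ Ua.
  apply: eq_bigr => i _.
  rewrite [in RHS](@linear_delta _ _ _ (fun u => Rm G (p a) _ u (Z a))); last first.
    by move=> *; exact: Rm_lin2 mG _ _ _ _ _ _ Ua.
  rewrite scaler_sumr; apply: eq_bigr => j _.
  rewrite [in RHS](@linear_delta _ _ _ (fun u => Rm G (p a) _ _ u)); last first.
    by move=> *; exact: Rm_lin3 mG _ _ _ _ _ _ Ua.
  by rewrite scalerA scaler_sumr; apply: eq_bigr => k _; rewrite scalerA.
apply: smooth_on_sum => // i _; apply: smooth_on_sum => // j _; apply: smooth_on_sum => // k _.
apply: smooth_on_scale => //.
  by do 2?apply: smooth_onM => //; exact: smooth_on_entry.
apply: (@smooth_on_comp _ _ _ _ _ _ U p (fun y => Rm G y _ _ _)) => //.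
have sc a : smooth_on U (fun=> a : 'rV[R]_n) by exact: smooth_on_cst.
apply: (@eq_smooth_on _ _ _ _ (curv G (fun=> delta_mx 0 i) (fun=> delta_mx 0 j) (fun=> delta_mx 0
  k))) => //.
  by move=> y Uy; rewrite (curvE mG Uy).
have sb : smooth_on U (bracket (fun=> delta_mx 0 i : 'rV[R]_n) (fun=> delta_mx 0 j)).
  by rewrite /bracket; under eq_fun do rewrite !derive_cst subr0; exact: sc.
apply: (@eq_smooth_on _ _ _ _ (fun x => _ - _ - _) _ oU (fun x _ => esym (curv_def _ _ _ _ _))).
have sn a b : smooth_on U (nabla G (fun=> a) (nabla G (fun=> b) (fun=> delta_mx 0 k))).
  exact: (smooth_on_nabla mG (sc _) (smooth_on_nabla mG (sc _) (sc _))).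
apply: smooth_onB => //; first exact: smooth_onB.
exact: (smooth_on_nabla mG).
Qed.

Definition Rf X Y Z : vfield R n := fun y => Rm G y (X y) (Y y) (Z y).

Lemma smooth_on_Rf X Y Z : smooth_on U X -> smooth_on U Y -> smooth_on U Z ->
  smooth_on U (Rf X Y Z).
Proof. by move=> sX sY sZ; apply: (@smooth_on_Rm _ U id) => //; exact: smooth_on_id. Qed.

(* The endomorphism v |-> R(v, Y) Z. *)
Definition Acurv Y Z : mfield R n :=
  fun y => \matrix_(i, j) Rm G y (delta_mx 0 i) (Y y) (Z y) 0 j.

Lemma AcurvE Y Z y v : U y -> v *m Acurv Y Z y = Rm G y v (Y y) (Z y).
Proof.
move=> Uy.
apply: (@linear_eq_delta _ 'rV[R]_n _ (fun v => v *m Acurv Y Z y) (fun v => Rm G y v (Y y) (Z y))).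
- by move=> c a b; rewrite mulmxDl -scalemxAl.
- by move=> c a b; exact: Rm_lin1 mG _ _ _ _ _ _ Uy.
by move=> k; rewrite -rowE; apply/rowP => j; rewrite !mxE.
Qed.

Lemma smooth_on_Acurv Y Z : smooth_on U Y -> smooth_on U Z -> smooth_on U (Acurv Y Z).
Proof.
move=> sY sZ; apply: smooth_on_mx => // i j; under eq_fun do rewrite mxE.
apply: smooth_on_entry => //.
have sc : smooth_on U (fun=> delta_mx 0 i : 'rV[R]_n) by exact: smooth_on_cst.
exact: (@smooth_on_Rf (fun=> delta_mx 0 i) Y Z sc sY sZ).
Qed.

Variable phi : mfield R n.
Hypothesis sphi : smooth_on U phi.

(* Polarization of [Sfield]: S(X) = [S2 X X]. *)
Definition S2 X Y : vfield R n :=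
  fun x => \sum_i Rm G x (X x *m phi x) (nabla G (Ef i) Y x) (Ef i x).

Lemma smooth_on_S2 X Y : smooth_on U X -> smooth_on U Y -> smooth_on U (S2 X Y).
Proof.
move=> sX sY; apply: smooth_on_sum => // i _.
have sE := smooth_on_Ef i.
apply: (@smooth_on_Rm _ U id) => //; first exact: smooth_on_id.
- exact: smooth_on_mul.
- exact: (smooth_on_nabla mG).
Qed.

Lemma SfieldE X x : smooth_on U X -> U x -> Sfield G phi X x = S2 X X x.
Proof.
move=> sX Ux; have dX := smooth_on_differentiable sX Ux.
rewrite /Sfield (@Tr_tensor _ _ (fun u v => Rm G x (X x *m phi x) (u *m Acov X x) v)) //.
- by apply: eq_bigr => i _; rewrite -Acov_nabla.
- by move=> c u u' v; rewrite mulmxDl -scalemxAl (Rm_lin2 mG).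
- by move=> c u u' v; rewrite (Rm_lin3 mG).
move=> e N oN NU Nx se; have mN := metric_onS oN NU mG.
have sXN := smooth_on_sub NU sX.
have de := smooth_on_differentiable se Nx.
rewrite (curvE mN Nx) ?endoE -?Acov_nabla//.
- apply: (@smooth_on_differentiable _ _ _ N) => //.
  by apply: smooth_on_mul => //; exact: smooth_on_sub sphi.
- by apply: (@smooth_on_differentiable _ _ _ N) => //; exact: smooth_on_nabla mN _ _.
Qed.

Lemma eq_Lap X Y x : (forall y, U y -> X y = Y y) -> U x -> Lap X x = Lap Y x.
Proof.
move=> XY Ux; rewrite /Lap; congr (- _); apply: eq_bigr => i _; congr (_ - _).
  by apply: (eq_nabla mG) => // y Uy; exact: (eq_nabla mG).
exact: (eq_nabla mG).
Qed.

(** By the Leibniz rule for (nabla_e R)(e, S) xi, the traced expression of the equation equals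
    nabla_e (R(e, S) xi) - R(nabla_e e, S) xi + R(e, S) nabla_e xi. The first two terms are the form
    in which integration by parts delivers it. *)
Lemma sesqui_lhsE (d1 d2 : R) xi x : smooth_on U xi -> U x ->
  sesqui_lhs d1 d2 G phi xi x =
  d1 *: Lap xi x + d2 *: Lap (Lap xi) x
  - d2 *: \sum_i (nabla G (Ef i) (Rf (Ef i) (S2 xi xi) xi) x
     - Rf (nabla G (Ef i) (Ef i)) (S2 xi xi) xi x
     + Rf (Ef i) (S2 xi xi) (nabla G (Ef i) xi) x).
Proof.
move=> sxi Ux; rewrite /sesqui_lhs.
set S := Sfield G phi xi.
have SE y : U y -> S y = S2 xi xi y by exact: SfieldE.
have sS2 := smooth_on_S2 sxi sxi.
have sS : smooth_on U S by apply: eq_smooth_on sS2 => // y Uy; rewrite SE.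
have LE y : U y -> rough_lap G xi y = Lap xi y by exact: rough_lapE.
have sL : smooth_on U (rough_lap G xi).
  by apply: eq_smooth_on (smooth_on_Lap sxi) => // y Uy; rewrite LE.
rewrite LE// rough_lapE// (eq_Lap LE Ux); congr (_ - _ *: _).
have dxi := smooth_on_differentiable sxi Ux.
have sA := smooth_on_Acurv sS2 sxi.
have dA := smooth_on_differentiable sA Ux.
pose B u v := Btr (Acurv (S2 xi xi) xi) x u v + Rm G x u (S2 xi xi x) (v *m Acov xi x).
have key e N : open N -> N `<=` U -> N x -> smooth_on N e ->
    nabla G e (Rf e (S2 xi xi) xi) x - Rf (nabla G e e) (S2 xi xi) xi x
     + Rf e (S2 xi xi) (nabla G e xi) x = B (e x) (e x).
  move=> oN NU Nx se; have de := smooth_on_differentiable se Nx.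
  rewrite /B -nabla_mul// -Acov_nabla// /Rf AcurvE//; congr (_ - _ + _).
  apply: nabla_near; apply: filterS (open_nbhs_nbhs (conj oN Nx)) => y /NU Uy.
  by rewrite AcurvE.
rewrite (@Tr_tensor _ _ B) //.
- by apply: eq_bigr => i _; rewrite (key _ U)//; exact: smooth_on_Ef.
- move=> c u u' v; rewrite /B Btr_linl// (Rm_lin1 mG)//.
  move: (Btr _ _ _ _) (Btr _ _ _ _) (Rm _ _ _ _ _) (Rm _ _ _ _ _) => a1 a2 a3 a4.
  by apply/rowP => k; rewrite !mxE; ring.
- move=> c u u' v; rewrite /B Btr_linr// mulmxDl -scalemxAl (Rm_lin3 mG)//.
  move: (Btr _ _ _ _) (Btr _ _ _ _) (Rm _ _ _ _ _) (Rm _ _ _ _ _) => a1 a2 a3 a4.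
  by apply/rowP => k; rewrite !mxE; ring.
move=> e N oN NU Nx se; rewrite -(key e N)//.
have mN := metric_onS oN NU mG.
have de y : N y -> differentiable e y by exact: smooth_on_differentiable.
have sxiN := smooth_on_sub NU sxi; have sSN := smooth_on_sub NU sS.
have dS y : N y -> differentiable S y by exact: smooth_on_differentiable.
have sne := smooth_on_nabla mN se se.
have snx := smooth_on_nabla mN se sxiN.
have snS := smooth_on_nabla mN se sSN.
have cE y : N y -> curv G e S xi y = Rf e (S2 xi xi) xi y.
  by move=> Ny; rewrite (curvE mN Ny) ?/Rf ?SE//; [exact: NU|exact: de|exact: dS].
rewrite /nabla_curv (eq_nabla mN _ Nx cE).
rewrite (curvE mN Nx (smooth_on_differentiable sne Nx) (dS _ Nx) sxiN).
rewrite (curvE mN Nx (de _ Nx) (dS _ Nx) snx) /Rf SE//.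
move: (nabla G e _ _) (curv G e _ xi x) (Rm G x _ _ _) (Rm G x _ _ _) => a b c d.
by apply/rowP => k; rewrite !mxE; ring.
Qed.

End Frames.

(** * The phi-Sasaki metric and the tension field *)

Section Sasaki.
Variables (R : realType) (n : nat) (G phi : mfield R n) (U : set 'rV[R]_n).
Hypothesis mG : metric_on U G.
Hypothesis sphi : smooth_on U phi.
Hypothesis phi_self : forall x v w, U x ->
  bform (G x) (v *m phi x) w = bform (G x) v (w *m phi x).
Hypothesis phi_parallel : forall X Y : vfield R n,
  smooth_on U X -> smooth_on U Y -> forall x, U x -> nabla_endo G phi X Y x = 0.
Hypothesis phi2 : forall x, U x -> phi x *m phi x = 1%:M.
Implicit Types (x u v w : 'rV[R]_n) (z a b c : 'rV[R]_(n + n)) (X Y e : vfield R n).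

Let oU : open U. Proof. by case: mG. Qed.
Let sG : smooth_on U G. Proof. by case: mG. Qed.
Let symG x (Ux : U x) : (G x)^T = G x. Proof. by case: mG => _ _ H _; exact: H. Qed.
Let pG x (Ux : U x) v : v != 0 -> 0 < bform (G x) v v.
Proof. by case: mG => _ _ _ H; exact: H. Qed.

(** Matrix of the form g(v, phi w), the vertical part of the Sasaki metric; [phi] acts on row
    vectors from the right, hence the transpose. *)
Definition Pm : mfield R n := fun y => G y *m (phi y)^T.

Lemma PmE y v w : bform (Pm y) v w = bform (G y) v (w *m phi y).
Proof. exact: bform_mulr. Qed.

Lemma smooth_on_Pm : smooth_on U Pm.
Proof. by apply: smooth_on_mul => //; exact: smooth_on_tr. Qed.

Lemma Pm_sym y v w : U y -> bform (Pm y) v w = bform (Pm y) w v.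
Proof. by move=> Uy; rewrite !PmE -phi_self// (bform_sym (symG Uy)). Qed.

(** Both g and [phi] are parallel, so g(., phi .) is parallel for the connection of g. The Koszul
    computation for [sasaki] and the integrations by parts rest on this. *)
Lemma Pm_compat x u v w : U x -> bform ('D_u Pm x) v w =
  bform (Pm x) (Gam G x u v) w + bform (Pm x) v (Gam G x u w).
Proof.
move=> Ux; have sc (q : 'rV[R]_n) : smooth_on U (fun=> q) by exact: smooth_on_cst.
have dc (q : 'rV[R]_n) : differentiable (fun=> q) x by exact: differentiable_cst.
have dP := smooth_on_differentiable smooth_on_Pm Ux.
have := derive_bform u dP (dc v) (dc w).
rewrite !derive_cst bform0l bform0r !addr0 => <-.
have sw : smooth_on U (endo_app phi (fun=> w)) by exact: smooth_on_endo mG _ sphi _ _.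
have := @nabla_metric _ _ U G (fun=> u) (fun=> v) (endo_app phi (fun=> w)) x mG Ux (dc v)
  (smooth_on_differentiable sw Ux).
rewrite (nabla_phi phi_parallel)// !nablaE !derive_cst !add0r.
rewrite !endoE !nablaE derive_cst add0r !PmE => <-.
by under eq_fun do rewrite PmE; under [in RHS]eq_fun do rewrite endoE.
Qed.

Let H := sasaki G phi.
Definition U2 : set 'rV[R]_(n + n) := [set z | U (lsubmx z)].

Lemma smooth_on_lsubmx (A : set 'rV[R]_(n + n)) :
  smooth_on A (lsubmx : 'rV[R]_(n + n) -> 'rV[R]_n).
Proof.
apply: (@smooth_on_sub _ _ _ _ setT) => //; apply: smooth_on_mx => [|i j]; first exact: openT.
have -> : (fun y : 'rV[R]_(n + n) => lsubmx y i j) = (fun y => y 0 (lshift n j)).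
  by apply/funext => y; rewrite mxE ord1.
exact: smooth_on_coord.
Qed.

Lemma smooth_on_rsubmx (A : set 'rV[R]_(n + n)) :
  smooth_on A (rsubmx : 'rV[R]_(n + n) -> 'rV[R]_n).
Proof.
apply: (@smooth_on_sub _ _ _ _ setT) => //; apply: smooth_on_mx => [|i j]; first exact: openT.
have -> : (fun y : 'rV[R]_(n + n) => rsubmx y i j) = (fun y => y 0 (rshift n j)).
  by apply/funext => y; rewrite mxE ord1.
exact: smooth_on_coord.
Qed.

Lemma differentiable_lsub z : differentiable (lsubmx : 'rV[R]_(n + n) -> 'rV[R]_n) z.
Proof. by apply: (@smooth_on_differentiable _ _ _ setT) => //; exact: smooth_on_lsubmx. Qed.

Lemma differentiable_rsub z : differentiable (rsubmx : 'rV[R]_(n + n) -> 'rV[R]_n) z.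
Proof. by apply: (@smooth_on_differentiable _ _ _ setT) => //; exact: smooth_on_rsubmx. Qed.

Lemma open_U2 : open U2.
Proof.
have /continuousP : continuous (lsubmx : 'rV[R]_(n + n) -> 'rV[R]_n).
  by move=> z; apply: differentiable_continuous; exact: differentiable_lsub.
exact.
Qed.

Lemma derive_coord k (y v : 'rV[R]_k) i : 'D_v (fun y : 'rV[R]_k => y 0 i : R) y = v 0 i.
Proof. by rewrite -(derive_entry v 0 i (F := id)) ?derive_id. Qed.

Lemma derive_lsub z a : 'D_a (lsubmx : 'rV[R]_(n + n) -> 'rV[R]_n) z = lsubmx a.
Proof.
apply/matrixP => i j; rewrite derive_entry; last exact: differentiable_lsub.
have -> : (fun y : 'rV[R]_(n + n) => lsubmx y i j) = (fun y => y 0 (lshift n j)).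
  by apply/funext => y; rewrite mxE ord1.
by rewrite derive_coord mxE ord1.
Qed.

Lemma derive_rsub z a : 'D_a (rsubmx : 'rV[R]_(n + n) -> 'rV[R]_n) z = rsubmx a.
Proof.
apply/matrixP => i j; rewrite derive_entry; last exact: differentiable_rsub.
have -> : (fun y : 'rV[R]_(n + n) => rsubmx y i j) = (fun y => y 0 (rshift n j)).
  by apply/funext => y; rewrite mxE ord1.
by rewrite derive_coord mxE ord1.
Qed.

Lemma HE z a b : bform (H z) a b = bform (G (lsubmx z)) (lsubmx a) (lsubmx b)
  + bform (Pm (lsubmx z)) (vpart G z a) (vpart G z b).
Proof. by rewrite sasakiE PmE. Qed.

Lemma vpart_row z v w : vpart G z (row_mx v w) = w + Gam G (lsubmx z) v (rsubmx z).
Proof. by rewrite /vpart row_mxKl row_mxKr. Qed.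

Lemma smooth_on_vpart a : smooth_on U2 (fun z => vpart G z a).
Proof.
apply: smooth_onD; [exact: open_U2|exact: smooth_on_cst|].
apply: (smooth_on_Gam mG open_U2) => //.
- exact: smooth_on_lsubmx.
- exact: smooth_on_cst.
- exact: smooth_on_rsubmx.
Qed.

Lemma smooth_on_comp_lsub k (F : 'rV[R]_n -> 'M[R]_k) : smooth_on U F ->
  smooth_on U2 (fun z => F (lsubmx z)).
Proof.
by move=> sF; apply: smooth_on_comp sF => //; [exact: open_U2|exact: smooth_on_lsubmx].
Qed.

Lemma smooth_on_H : smooth_on U2 H.
Proof.
apply: smooth_on_mx => [|i j]; first exact: open_U2.
under eq_fun do rewrite -bform_delta HE.
apply: smooth_onD; first exact: open_U2.
  apply: smooth_on_bform; [exact: open_U2|exact: smooth_on_comp_lsub|..]; exact: smooth_on_cst.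
apply: smooth_on_bform; [exact: open_U2| |exact: smooth_on_vpart..].
by apply: smooth_on_comp_lsub; exact: smooth_on_Pm.
Qed.

Lemma H_sym z : U2 z -> (H z)^T = H z.
Proof.
move=> Uz; apply/matrixP => i j; rewrite mxE -!bform_delta !HE.
by rewrite Pm_sym// (bform_sym (symG Uz)).
Qed.

Lemma Pm_nondeg x v : U x -> (forall w, bform (Pm x) v w = 0) -> v = 0.
Proof.
move=> Ux H0; apply: (bform_eq0 (pG Ux)) => w.
by have := H0 (w *m phi x); rewrite PmE -mulmxA phi2// mulmx1.
Qed.

(** The metric need not be definite, so [a] is shown to vanish by testing: horizontal lifts detect
    its base component, vertical vectors its vertical part. *)
Lemma H_nondeg z a : U2 z -> (forall b, bform (H z) a b = 0) -> a = 0.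
Proof.
move=> Uz H0.
have l0 : lsubmx a = 0.
  apply: (bform_eq0 (pG Uz)) => w.
  have := H0 (row_mx w (- Gam G (lsubmx z) w (rsubmx z))).
  by rewrite HE vpart_row row_mxKl addNr bform0r addr0.
have v0 : vpart G z a = 0.
  apply: (Pm_nondeg Uz) => w; have := H0 (row_mx 0 w).
  by rewrite HE vpart_row row_mxKl bform0r add0r Gam0l addr0.
move: v0; rewrite /vpart l0 Gam0l addr0 => r0.
by rewrite -[a]hsubmxK l0 r0 row_mx0.
Qed.

Lemma metric_at_H z : U2 z -> metric_at H z.
Proof.
move=> Uz; split.
- by apply: nondegenerate_unitmx => a; exact: H_nondeg.
- exact: H_sym.
- exact: smooth_on_differentiable smooth_on_H Uz.
- by move=> v; exact: derive_sym open_U2 Uz smooth_on_H H_sym.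
Qed.

Definition DK z a b := DGam G (lsubmx z) (lsubmx a) (lsubmx b) (rsubmx z)
  + Gam G (lsubmx z) (lsubmx b) (rsubmx a).
(** Covariant derivative along [a] of the vertical part of the constant vector [b] of the tangent
    bundle, seen as a field along the projection. It is what differentiating [sasaki] produces. *)
Definition NN z a b := DK z a b + Gam G (lsubmx z) (lsubmx a) (vpart G z b).

Lemma derive_vpart z a b : U2 z -> 'D_a (fun y => vpart G y b) z = DK z a b.
Proof.
move=> Uz; rewrite /vpart.
have dc w : differentiable (fun=> w : 'rV[R]_n) z by exact: differentiable_cst.
have d : differentiable (fun y => Gam G (lsubmx y) (lsubmx b) (rsubmx y)) z.
  apply: (@smooth_on_differentiable _ _ _ U2) => //.
  by apply: (smooth_on_Gam mG open_U2) => //;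
   [exact: smooth_on_lsubmx|exact: smooth_on_cst|exact: smooth_on_rsubmx].
rewrite deriveD; [|exact: derivable_cst|exact: diff_derivable].
rewrite derive_cst add0r.
rewrite (derive_Gam_comp _ mG Uz (differentiable_lsub z) (dc _) (differentiable_rsub z)).
by rewrite derive_lsub derive_rsub derive_cst Gam0l addr0.
Qed.

Lemma derive_H z a b c : U2 z -> bform ('D_a H z) b c =
  bform (G (lsubmx z)) (Gam G (lsubmx z) (lsubmx a) (lsubmx b)) (lsubmx c)
  + bform (G (lsubmx z)) (lsubmx b) (Gam G (lsubmx z) (lsubmx a) (lsubmx c))
  + (bform (Pm (lsubmx z)) (NN z a b) (vpart G z c)
  + bform (Pm (lsubmx z)) (vpart G z b) (NN z a c)).
Proof.
move=> Uz.
have dH := smooth_on_differentiable smooth_on_H Uz.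
have dc k (w : 'rV[R]_k) : differentiable (fun=> w : 'rV[R]_k) z by exact: differentiable_cst.
have := derive_bform a dH (dc _ b) (dc _ c).
rewrite !derive_cst bform0l bform0r !addr0 => <-.
under eq_fun do rewrite HE.
have dG := smooth_on_differentiable sG Uz.
have dP := smooth_on_differentiable smooth_on_Pm Uz.
have dl := differentiable_lsub z.
have dGl : differentiable (fun y => G (lsubmx y)) z.
  exact: (@differentiable_comp _ _ _ _ lsubmx G).
have dPl : differentiable (fun y => Pm (lsubmx y)) z.
  exact: (@differentiable_comp _ _ _ _ lsubmx Pm).
have dv (q : 'rV[R]_(n + n)) := smooth_on_differentiable (smooth_on_vpart q) Uz.
have E1 := derive_bform a dGl (dc _ (lsubmx b)) (dc _ (lsubmx c)).
have E2 := derive_bform a dPl (dv b) (dv c).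
have eG : 'D_a (fun y => G (lsubmx y)) z = 'D_(lsubmx a) G (lsubmx z).
  by have E := derive_comp a dl dG; rewrite derive_lsub in E; exact: E.
have eP : 'D_a (fun y => Pm (lsubmx y)) z = 'D_(lsubmx a) Pm (lsubmx z).
  by have E := derive_comp a dl dP; rewrite derive_lsub in E; exact: E.
rewrite !derive_cst bform0l bform0r !addr0 eG Gam_compat in E1; last exact: metric_on_at mG Uz.
rewrite eP Pm_compat// !derive_vpart// in E2.
rewrite deriveD; last 2 first.
- apply/diff_derivable/(@smooth_on_differentiable _ _ _ U2) => //.
  by apply: smooth_on_bform; [exact: open_U2|exact: smooth_on_comp_lsub|exact: smooth_on_cst..].
- apply/diff_derivable/(@smooth_on_differentiable _ _ _ U2) => //.
  apply: smooth_on_bform;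
    [exact: open_U2|exact: smooth_on_comp_lsub smooth_on_Pm|exact: smooth_on_vpart..].
by rewrite E1 E2 /NN !(bformDl (Pm _)) !(bformDr (Pm _)); ring.
Qed.

(** The terms in the fibre components of [a] and [c] cancel. What is left is the curvature applied
    to the fibre coordinate, the obstruction to integrability of the horizontal distribution. *)
Lemma NN_anti z a c : U2 z -> NN z a c - NN z c a = Rm G (lsubmx z) (lsubmx a) (lsubmx c) (rsubmx
  z).
Proof.
move=> Uz; rewrite /NN /DK /vpart RmE !GamDr.
move: (DGam _ _ _ _ _) (DGam _ _ _ _ _) => d1 d2.
move: (Gam G _ _ _) (Gam G _ _ _) (Gam G _ _ _) (Gam G _ _ _) => g1 g2 g3 g4.
by apply/rowP => k; rewrite !mxE; ring.
Qed.

(** Equal arguments suffice because the tension field is a trace. The right-hand side is the vector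
    with base component [w] and vertical part [NN z a a]; nondegeneracy reduces the claim to the
    Koszul formula. *)
Lemma Gam_sasaki z a : U2 z ->
  let w := Gam G (lsubmx z) (lsubmx a) (lsubmx a)
    + Rm G (lsubmx z) (rsubmx z *m phi (lsubmx z)) (vpart G z a) (lsubmx a) in
  Gam H z a a = row_mx w (NN z a a - Gam G (lsubmx z) w (rsubmx z)).
Proof.
move=> Uz w.
have wE : w = Gam G (lsubmx z) (lsubmx a) (lsubmx a)
    + Rm G (lsubmx z) (rsubmx z *m phi (lsubmx z)) (vpart G z a) (lsubmx a) by [].
clearbody w; apply/eqP; rewrite -subr_eq0; apply/eqP/(H_nondeg Uz) => c.
apply/eqP; rewrite bformBl subr_eq0; apply/eqP.
apply: (@mulfI _ 2) => //.
rewrite koszul; last exact: metric_at_H.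
have -> : bform (H z) (row_mx w (NN z a a - Gam G (lsubmx z) w (rsubmx z))) c =
    bform (G (lsubmx z)) w (lsubmx c) + bform (Pm (lsubmx z)) (NN z a a) (vpart G z c).
  by rewrite HE vpart_row row_mxKl subrK.
apply: (etrans (congr2 (fun p q => p + p - q) (derive_H a a c Uz) (derive_H c a a Uz))).
rewrite wE bformDl.
(* [NN_anti] produces R(a, c) applied to the fibre coordinate. Pair symmetry, and the passage of
   [phi] between the first two arguments of R, free the test vector [c] from the curvature. *)
have -> : bform (G (lsubmx z)) (Rm G (lsubmx z) (rsubmx z *m phi (lsubmx z)) (vpart G z a)
  (lsubmx a)) (lsubmx c)
   = bform (Pm (lsubmx z)) (vpart G z a) (NN z a c - NN z c a).
  rewrite NN_anti// -(Rm_phi12 mG sphi phi_self phi_parallel)// (Rm_pair mG)//.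
  by rewrite PmE -phi_self// (bform_sym (symG Uz)).
rewrite bformBr.
rewrite (Pm_sym (vpart G z a) (NN z c a))// (bform_sym (symG Uz) (lsubmx a) (Gam G _ (lsubmx c) _)).
rewrite (bform_sym (symG Uz) (lsubmx a)) (Gam_sym (lsubmx c) (lsubmx a))//;
  last exact: metric_on_at mG Uz.
ring.
Qed.

Lemma derive_row_mx (V : normedModType R) p q (f : V -> 'rV[R]_p) (h : V -> 'rV[R]_q) (y v : V) :
  differentiable f y -> differentiable h y ->
  differentiable (fun y => row_mx (f y) (h y)) y /\
  'D_v (fun y => row_mx (f y) (h y)) y = row_mx ('D_v f y) ('D_v h y).
Proof.
move=> df dh.
have d : differentiable (fun y => row_mx (f y) (h y)) y.
  apply: differentiable_mx => i j; under eq_fun do rewrite mxE.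
  by case: splitP => k _; exact: differentiable_entry.
split=> //; apply/matrixP => i j; rewrite derive_entry// mxE.
under eq_fun do rewrite mxE.
by case: splitP => k _; rewrite derive_entry.
Qed.

Lemma dmap_as_map X e y : smooth_on U X -> U y ->
  dmap (as_map X) e y = row_mx (e y) ('D_(e y) X y).
Proof.
move=> sX Uy; have dX := smooth_on_differentiable sX Uy.
have did : differentiable (id : 'rV[R]_n -> 'rV[R]_n) y by [].
have [_ E] := @derive_row_mx _ _ _ id X y (e y) did dX.
by rewrite /dmap /as_map E derive_id.
Qed.

(** [A] is the base component. Subtracting [Gam G x A (X x)] in the fibre component makes the
    vertical part exactly the second covariant derivative of [X]. The curvature comes from
    [Gam_sasaki]. *)
Lemma nabla_dmapE X e N x : open N -> N `<=` U -> N x -> smooth_on N e ->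
  smooth_on U X ->
  let A := Rm G x (X x *m phi x) (nabla G e X x) (e x) in
  nabla_dmap G H (as_map X) e e x =
  row_mx A (nabla G e (nabla G e X) x - nabla G (nabla G e e) X x - Gam G x A (X x)).
Proof.
move=> oN NU Nx se sX A; have Ux := NU _ Nx.
have dX := smooth_on_differentiable sX Ux.
have de := smooth_on_differentiable se Nx.
have mN := metric_onS oN NU mG; have sXN := smooth_on_sub NU sX.
have [dd Ed] := derive_dir_field (e x) oN Nx sXN de.
rewrite /nabla_dmap !dmap_as_map//.
have [_ E] := derive_row_mx (e x) de dd.
have -> : 'D_(e x) (dmap (as_map X) e) x =
    row_mx ('D_(e x) e x) ('D_(e x) (fun y => 'D_(e y) X y) x).
  rewrite -E; apply: near_eq_derive.
  by apply: filterS (open_nbhs_nbhs (conj oN Nx)) => y /NU Uy; rewrite dmap_as_map.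
set a := row_mx (e x) ('D_(e x) X x).
have zE : lsubmx (as_map X x) = x /\ rsubmx (as_map X x) = X x.
  by rewrite /as_map row_mxKl row_mxKr.
have Uz : U2 (as_map X x) by rewrite /U2/= zE.1.
(* The image of [e] under the differential of [X] has base component [e] and vertical part nabla_e
   X. *)
have Ka : vpart G (as_map X x) a = nabla G e X x.
  by rewrite vpart_row zE.1 zE.2 nablaE.
rewrite Gam_sasaki// zE.1 zE.2 Ka /NN /DK zE.1 zE.2 Ka row_mxKl row_mxKr -/A; clearbody A.
rewrite (nabla_nabla _ mN Nx de sXN) Ed opp_row_mx !add_row_mx; congr row_mx.
  rewrite !nablaE; move: ('D_ _ e x) (Gam G x _ _) A => p q r.
  by apply/rowP => k; rewrite !mxE; ring.
rewrite [nabla G (nabla G e e) X x]nablaE [nabla G e X x]nablaE [nabla G e e x]nablaE /DGam.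
rewrite !(GamDl G x) GamDr.
move: (Gam G x A _) (Gam G x (Gam G x _ _) _) (Gam G x (e x) (Gam G x _ _)) => g1 g2 g3.
move: (Gam G x ('D_ _ _ _) _) (Gam G x (e x) ('D_ _ _ _)) => g4 g5.
move: ('D_ _ (fun y => 'D_ _ X y) x) ('D_ _ (fun y => Gam G y _ _) x) => d1 d2.
rewrite derive_dirD//.
move: ('D_ _ X x) ('D_ _ X x) => d3 d4.
by apply/rowP => k; rewrite !mxE; ring.
Qed.

Lemma tensionE X x : smooth_on U X -> U x ->
  tension G H (as_map X) x =
  row_mx (S2 G phi X X x) (- Lap G X x - Gam G x (S2 G phi X X x) (X x)).
Proof.
move=> sX Ux; rewrite /tension.
have dX := smooth_on_differentiable sX Ux.
have dA := smooth_on_differentiable (smooth_on_Acov mG sX) Ux.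
pose A u v := Rm G x (X x *m phi x) (u *m Acov G X x) v.
pose B u v : 'rV[R]_(n + n) := row_mx (A u v) (Btr G (Acov G X) x u v - Gam G x (A u v) (X x)).
have Al (c : R) u u' v : A (c *: u + u') v = c *: A u v + A u' v.
  by rewrite /A mulmxDl -scalemxAl (Rm_lin2 mG).
have Ar (c : R) u u' v : A v (c *: u + u') = c *: A v u + A v u'.
  by rewrite /A (Rm_lin3 mG).
rewrite (Tr_tensor mG (B := B)) //.
- rewrite /B; transitivity (row_mx (\sum_i A (Ef G i x) (Ef G i x))
    (\sum_i Btr G (Acov G X) x (Ef G i x) (Ef G i x)
     - Gam G x (\sum_i A (Ef G i x) (Ef G i x)) (X x))).
    rewrite (big_morph (fun v => Gam G x v (X x)) (id1 := 0) (op1 := +%R)).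
    + rewrite -sumrB; elim: (index_enum _) => [|i r IH].
        by rewrite !big_nil row_mx0.
      by rewrite !big_cons IH add_row_mx.
    + by move=> v w; exact: GamDl.
    + exact: Gam0l.
  have -> : \sum_i A (Ef G i x) (Ef G i x) = S2 G phi X X x.
    by apply: eq_bigr => i _; rewrite /A -Acov_nabla.
  congr (row_mx _ (_ - _)); rewrite opprK; apply: eq_bigr => i _.
  by rewrite (nabla2_tensor mG oU)//; exact: smooth_on_Ef.
- move=> c u u' v; rewrite /B Al Btr_linl// Gam_linl scale_row_mx add_row_mx; congr row_mx.
  move: (Btr _ _ _ _ _) (Btr _ _ _ _ _) (Gam _ _ _ _) (Gam _ _ _ _) => a1 a2 a3 a4.
  by apply/rowP => k; rewrite !mxE; ring.
- move=> c u u' v; rewrite /B Ar Btr_linr Gam_linl scale_row_mx add_row_mx; congr row_mx.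
  move: (Btr _ _ _ _ _) (Btr _ _ _ _ _) (Gam _ _ _ _) (Gam _ _ _ _) => a1 a2 a3 a4.
  by apply/rowP => k; rewrite !mxE; ring.
move=> e N oN NU Nx se; rewrite (nabla_dmapE oN NU Nx se sX) /B /A -Acov_nabla//.
by rewrite (nabla2_tensor mG oN).
Qed.

Lemma tension_density X x : smooth_on U X -> U x ->
  bform (H (as_map X x)) (tension G H (as_map X) x) (tension G H (as_map X) x) =
  bform (G x) (S2 G phi X X x) (S2 G phi X X x) + bform (Pm x) (Lap G X x) (Lap G X x).
Proof.
move=> sX Ux; rewrite tensionE// HE vpart_row /as_map !row_mxKl !row_mxKr subrK.
by rewrite bformNl bformNr opprK.
Qed.

Lemma dmap_density X x : smooth_on U X -> U x ->
  sq_dmap G H (as_map X) x =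
  n%:R + \sum_i bform (Pm x) (nabla G (Ef G i) X x) (nabla G (Ef G i) X x).
Proof.
move=> sX Ux; have dX := smooth_on_differentiable sX Ux.
rewrite /sq_dmap.
pose B u v : R^o := bform (G x) u v + bform (Pm x) (u *m Acov G X x) (v *m Acov G X x).
rewrite (Tr_tensor mG (W := R^o) (B := B)) //.
- rewrite /B big_split; congr (_ + _).
    under eq_bigr do rewrite (Ef_orthonormal mG)// eqxx.
    by rewrite sumr_const card_ord.
  by apply: eq_bigr => i _; rewrite -!Acov_nabla.
- move=> c u u' v; rewrite /B mulmxDl -scalemxAl !bformDl !bformZl /GRing.scale/=.
  ring.
- move=> c u u' v; rewrite /B mulmxDl -scalemxAl !bformDr !bformZr /GRing.scale/=.
  ring.
move=> e N oN NU Nx se; rewrite dmap_as_map// HE /as_map vpart_row !row_mxKl row_mxKr.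
by rewrite /B -nablaE -Acov_nabla.
Qed.

End Sasaki.

Transparent bform.

Lemma bform_mulmxl (R : realType) n (A B : 'M[R]_n) v w :
  bform A (v *m B) w = bform (B *m A) v w.
Proof. by rewrite /bform !mulmxA. Qed.

Lemma bform_row_entry (R : realType) n (A P : 'M[R]_n) v i :
  (v *m A *m P^T) 0 i = bform A v (row i P).
Proof. by rewrite /bform !mxE; apply: eq_bigr => k _; rewrite !mxE. Qed.

Opaque bform.

(** * Divergence and the first variation in a chart *)

Section VolumeDensity.
Variables (R : realType) (n : nat) (G : mfield R n) (U : set 'rV[R]_n).
Hypothesis mG : metric_on U G.
Implicit Types (x u v w : 'rV[R]_n) (X Y V e : vfield R n).

Let oU : open U. Proof. by case: mG. Qed.
Let symG x (Ux : U x) : (G x)^T = G x. Proof. by case: mG => _ _ H _; exact: H. Qed.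
Let pG x (Ux : U x) v : v != 0 -> 0 < bform (G x) v v.
Proof. by case: mG => _ _ _ H; exact: H. Qed.

Lemma Ef_trace x (T : 'M[R]_n) : U x ->
  \sum_i bform (G x) (Ef G i x *m T) (Ef G i x) = \tr T.
Proof.
move=> Ux; have Gu := posdef_unitmx (pG Ux).
rewrite (@orthonormal_trace _ R^o _ (G x) (chol (G x))
   (fun u v => bform (G x) (u *m T) v)); last exact: cholP (symG Ux) (pG Ux).
- transitivity (\sum_k \sum_l (T *m G x) k l * (invmx (G x)) l k).
    apply: eq_bigr => k _; apply: eq_bigr => l _.
    rewrite bform_mulmxl bform_delta /GRing.scale/= mulrC; congr (_ * _).
    by rewrite -[in LHS](symG Ux) -trmx_inv mxE.
  rewrite -[in RHS](mulmx1 T) -(mulmxV Gu) mulmxA.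
  by apply: eq_bigr => k _; rewrite [RHS]mxE.
- by move=> c u u' v; rewrite mulmxDl -scalemxAl bformDl bformZl.
- by move=> c u u' v; rewrite bformDr bformZr.
Qed.

Definition vol x : R := Num.sqrt (\det (G x)).

Lemma det_gt0 x : U x -> 0 < \det (G x).
Proof.
move=> Ux; have PGP := cholP (symG Ux) (pG Ux).
have : \det (chol (G x)) ^+ 2 * \det (G x) = 1.
  by have := congr1 determinant PGP; rewrite !det_mulmx det_tr det1 => <-; ring.
move=> E.
have P0 : \det (chol (G x)) ^+ 2 != 0.
  by apply/eqP => P0; move: E; rewrite P0 mul0r => /eqP; rewrite eq_sym oner_eq0.
have Pp : 0 < \det (chol (G x)) ^+ 2 by rewrite lt0r P0 sqr_ge0.
by rewrite -(pmulr_rgt0 _ Pp) E.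
Qed.

Lemma vol_gt0 x : U x -> 0 < vol x.
Proof. by move=> Ux; rewrite sqrtr_gt0 det_gt0. Qed.

Lemma smooth_on_vol : smooth_on U vol.
Proof.
apply: smooth_on_sqrt => //; first exact: det_gt0.
by apply: smooth_on_det => //; case: mG.
Qed.

Definition GamT x v : 'M[R]_n := \matrix_(k, l) Gam G x v (delta_mx 0 k) 0 l.

Lemma GamTE x v w : w *m GamT x v = Gam G x v w.
Proof.
apply: (@linear_eq_delta _ 'rV[R]_n _ (fun w => w *m GamT x v) (fun w => Gam G x v w)).
- by move=> c a b; rewrite mulmxDl -scalemxAl.
- by move=> c a b; rewrite Gam_linr.
by move=> k; rewrite -rowE; apply/rowP => j; rewrite !mxE.
Qed.

(** Jacobi's formula applied to vol^2 = det G gives det G times tr(G^-1 D_v G), and metric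
    compatibility makes that trace twice the trace of w |-> Gam v w. *)
Lemma derive_vol x v : U x -> 'D_v vol x = vol x * \tr (GamT x v).
Proof.
move=> Ux; have mGx := metric_on_at mG Ux; have [Gu _ dG sD] := mGx.
have d0 := det_gt0 Ux; have v0 := vol_gt0 Ux.
have dv := smooth_on_differentiable smooth_on_vol Ux.
have vv : 'D_v (fun y => vol y * vol y) x = \det (G x) * \tr (invmx (G x) *m 'D_v G x).
  rewrite -jacobi_formula//; apply: near_eq_derive.
  apply: filterS (open_nbhs_nbhs (conj oU Ux)) => y Uy.
  by rewrite -expr2 sqr_sqrtr// ltW// det_gt0.
rewrite deriveM in vv; [|exact: diff_derivable|exact: diff_derivable].
have tr2 : \tr (invmx (G x) *m 'D_v G x) = 2 * \tr (GamT x v).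
  transitivity (\sum_k \sum_l invmx (G x) k l *:
     (bform ('D_v G x) (delta_mx 0 k) (delta_mx 0 l) : R^o)).
    rewrite /mxtrace; apply: eq_bigr => k _; rewrite mxE; apply: eq_bigr => l _.
    rewrite bform_delta; congr (_ * _).
    by rewrite -[in LHS]sD mxE.
  rewrite -(@orthonormal_trace _ R^o _ (G x) (chol (G x))
     (fun u w => bform ('D_v G x) u w)); last exact: cholP (symG Ux) (pG Ux).
  - transitivity (\sum_i 2 * bform (G x) (Ef G i x *m GamT x v) (Ef G i x)).
      apply: eq_bigr => i _; rewrite (Gam_compat _ _ _ mGx) GamTE.
      by rewrite [X in _ + X](bform_sym (symG Ux)) -mulr2n mulr_natl.
    by rewrite -big_distrr/= Ef_trace.
  - by move=> c u u' w; rewrite bformDl bformZl.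
  - by move=> c u u' w; rewrite bformDr bformZr.
rewrite tr2 in vv.
have D2 : vol x * vol x = \det (G x) by rewrite -expr2 sqr_sqrtr// ltW.
rewrite -D2 in vv; apply: (@mulfI _ (2 * vol x)); first by rewrite mulf_neq0// gt_eqF.
move: vv; rewrite /GRing.scale/= => vv.
have -> : 2 * vol x * 'D_v vol x = vol x * 'D_v vol x + vol x * 'D_v vol x by ring.
by rewrite vv; ring.
Qed.

Definition divg X x := \sum_j bform (G x) (nabla G (Ef G j) X x) (Ef G j x).

Lemma divgE X x : U x -> differentiable X x ->
  divg X x = \sum_a ('D_(delta_mx 0 a) X x 0 a + Gam G x (X x) (delta_mx 0 a) 0 a).
Proof.
move=> Ux dX; transitivity (\tr (Acov G X x)).
  rewrite -(Ef_trace (Acov G X x) Ux); apply: eq_bigr => j _.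
  by rewrite -Acov_nabla.
apply: eq_bigr => a _; rewrite mxE nablaE mxE.
by rewrite (Gam_sym _ _ (metric_on_at mG Ux)).
Qed.

(** The left-hand side is the divergence of [f X]; its Christoffel trace is absorbed by the
    derivative of [vol]. *)
Lemma divergence_coord (f : 'rV[R]_n -> R) X x : U x ->
  differentiable f x -> differentiable X x ->
  ('D_(X x) f x + f x * divg X x) * vol x =
  \sum_a 'D_(delta_mx 0 a) (fun y => f y * vol y * X y 0 a) x.
Proof.
move=> Ux df dX; have dv := smooth_on_differentiable smooth_on_vol Ux.
have dXa a : differentiable (fun y => X y 0 a) x by exact: differentiable_entry.
rewrite divgE// derive_dir_row//.
have -> : \sum_a ('D_(delta_mx 0 a) X x 0 a + Gam G x (X x) (delta_mx 0 a) 0 a)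
   = \sum_a ('D_(delta_mx 0 a) X x 0 a + X x 0 a * \tr (GamT x (delta_mx 0 a))).
  rewrite !big_split; congr (_ + _); rewrite /mxtrace.
  under [RHS]eq_bigr do rewrite mulr_sumr; rewrite exchange_big/=.
  apply: eq_bigr => k _.
  have := linear_delta (X x) (fun c u u' => Gam_linl G x c u u' (delta_mx 0 k)).
  move=> ->; rewrite summxE; apply: eq_bigr => a _.
  by rewrite !mxE.
rewrite big_distrr -big_split big_distrl; apply: eq_bigr => a _ /=.
rewrite deriveM; [|exact/diff_derivable/differentiableM|exact: diff_derivable].
rewrite deriveM; [|exact: diff_derivable|exact: diff_derivable].
rewrite derive_vol// derive_entry// /GRing.scale/=; ring.
Qed.

Lemma Ef_expand x v : U x -> v = \sum_i bform (G x) v (Ef G i x) *: Ef G i x.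
Proof.
move=> Ux; have PGP := cholP (symG Ux) (pG Ux).
have H : (chol (G x))^T *m chol (G x) *m G x = 1%:M.
  by rewrite -mulmxA; exact: mulmx1C PGP.
have H' : G x *m (chol (G x))^T *m chol (G x) = 1%:M.
  by rewrite -mulmxA; exact: mulmx1C H.
rewrite -[LHS]mulmx1 -H' !mulmxA [LHS]mulmx_sum_row; apply: eq_bigr => i _.
by rewrite bform_row_entry.
Qed.

(** Since g(e_i, e_j) is constant, g(nabla_{e_j} e_i, e_j) = - g(nabla_{e_j} e_j, e_i). Summing over
    [j] gives the coefficients of the right-hand side in the frame. *)
Lemma divg_Ef_sum x : U x ->
  \sum_i divg (Ef G i) x *: Ef G i x = - \sum_j nabla G (Ef G j) (Ef G j) x.
Proof.
move=> Ux.
have dE i : differentiable (Ef G i) x.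
  exact: smooth_on_differentiable (smooth_on_Ef mG i) Ux.
have anti i j : bform (G x) (nabla G (Ef G j) (Ef G i) x) (Ef G j x) =
   - bform (G x) (nabla G (Ef G j) (Ef G j) x) (Ef G i x).
  have := @nabla_metric _ _ U G (Ef G j) (Ef G i) (Ef G j) x mG Ux (dE i) (dE j).
  rewrite (bform_sym (symG Ux) (Ef G i x)) => E.
  apply/eqP; rewrite -addr_eq0 -E; apply/eqP.
  rewrite -[RHS](@derive_cst R _ _ ((i == j)%:R : R) x (Ef G j x)).
  apply: near_eq_derive; apply: filterS (open_nbhs_nbhs (conj oU Ux)) => y Uy.
  by rewrite (Ef_orthonormal mG).
rewrite [in RHS](Ef_expand (\sum_j _) Ux) -sumrN; apply: eq_bigr => i _.
rewrite -scaleNr; congr (_ *: _); rewrite /divg bform_suml -sumrN.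
by apply: eq_bigr => j _; rewrite anti.
Qed.

End VolumeDensity.

(** * Integration by parts and the first variation formula *)

Section FirstVariation.
Variables (R : realType) (n : nat) (G phi : mfield R n) (U K : set 'rV[R]_n).
Hypothesis mG : metric_on U G.
Hypothesis sphi : smooth_on U phi.
Hypothesis phi_self : forall x v w, U x ->
  bform (G x) (v *m phi x) w = bform (G x) v (w *m phi x).
Hypothesis phi_parallel : forall X Y : vfield R n,
  smooth_on U X -> smooth_on U Y -> forall x, U x -> nabla_endo G phi X Y x = 0.
Hypothesis Kclosed : closed K.
Implicit Types (x u v w : 'rV[R]_n) (X Y V e : vfield R n) (f h : 'rV[R]_n -> R).

Let oU : open U. Proof. by case: mG. Qed.
Let symG x (Ux : U x) : (G x)^T = G x. Proof. by case: mG => _ _ H _; exact: H. Qed.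

Definition cK f := smooth_on U f /\ forall x, U x -> ~ K x -> f x = 0.

(* [I] stands for integration over a chart against the Riemannian volume; [K]
   contains the support of the variation field. *)
Variable I : ('rV[R]_n -> R) -> R.
Hypothesis I_eq : forall f h, (forall x, U x -> f x = h x) -> I f = I h.
Hypothesis I_add : forall f h, cK f -> cK h -> I (fun x => f x + h x) = I f + I h.
Hypothesis I_scale : forall c f, cK f -> I (fun x => c * f x) = c * I f.
Hypothesis I_div : forall f X, cK f -> smooth_on U X ->
  I (fun x => 'D_(X x) f x + f x * divg G X x) = 0.

Lemma cK_add f h : cK f -> cK h -> cK (fun x => f x + h x).
Proof.
move=> [sf f0] [sh h0]; split; first exact: smooth_onD.
by move=> x Ux Kx; rewrite f0// h0// addr0.
Qed.

Lemma cK_scale c f : cK f -> cK (fun x => c * f x).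
Proof.
move=> [sf f0]; split; first by apply: smooth_onM => //; exact: smooth_on_cst.
by move=> x Ux Kx; rewrite f0// mulr0.
Qed.

Lemma cK_sum (J : Type) (r : seq J) (f : J -> 'rV[R]_n -> R) :
  (forall i, cK (f i)) -> cK (fun x => \sum_(i <- r) f i x).
Proof.
move=> cf; split; first by apply: smooth_on_sum => // i _; case: (cf i).
by move=> x Ux Kx; rewrite big1// => i _; have [_ ->] := cf i.
Qed.

Lemma I0 : I (fun=> 0) = 0.
Proof.
have c0 : cK (fun=> 0) by split=> //; exact: smooth_on_cst.
rewrite -[RHS](mul0r (I (fun=> 0))) -I_scale//.
by apply: I_eq => x _; rewrite mul0r.
Qed.

Lemma I_sum (J : Type) (r : seq J) (f : J -> 'rV[R]_n -> R) :
  (forall i, cK (f i)) -> I (fun x => \sum_(i <- r) f i x) = \sum_(i <- r) I (f i).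
Proof.
move=> cf; elim: r => [|i r IH].
  by rewrite big_nil -[RHS]I0; apply: I_eq => x _; rewrite big_nil.
rewrite big_cons -IH -I_add//; last exact: cK_sum.
by apply: I_eq => x _; rewrite big_cons.
Qed.

Lemma zero_near (m : nat) (F : 'rV[R]_n -> 'M[R]_(m, n)) x v :
  (forall y, U y -> ~ K y -> F y = 0) -> U x -> ~ K x -> 'D_v F x = 0.
Proof.
move=> F0 Ux Kx; rewrite -(derive_cst (0 : 'M[R]_(m, n)) x v); apply: near_eq_derive.
have nK : nbhs x (~` K) by apply: open_nbhs_nbhs; split=> //; exact: closed_openC.
by apply: filterS (filterI (open_nbhs_nbhs (conj oU Ux)) nK) => y [Uy Ky]; rewrite F0.
Qed.

Lemma nabla_zero X Y x : (forall y, U y -> ~ K y -> Y y = 0) ->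
  U x -> ~ K x -> nabla G X Y x = 0.
Proof. by move=> Y0 Ux Kx; rewrite nablaE (zero_near _ Y0)// Y0// Gam0r addr0. Qed.

Lemma ibp (A : mfield R n) V : smooth_on U A -> smooth_on U V ->
  (forall x, U x -> ~ K x -> V x = 0) \/ (forall x, U x -> ~ K x -> A x = 0) ->
  I (fun x => \sum_i bform (Pm G phi x) (Ef G i x *m A x) (nabla G (Ef G i) V x)) =
  - I (fun x => bform (Pm G phi x) (\sum_i
    (nabla G (Ef G i) (fun y => Ef G i y *m A y) x - nabla G (Ef G i) (Ef G i) x *m A x)) (V x)).
Proof.
move=> sA sV AV1.
have AV0 x : U x -> ~ K x -> A x = 0 \/ V x = 0.
  by move=> Ux Kx; case: AV1 => H; [right|left]; exact: H.
have sE i := smooth_on_Ef mG i.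
have sP := smooth_on_Pm mG sphi.
have sEA i : smooth_on U (fun y => Ef G i y *m A y) by exact: smooth_on_mul.
pose f i x := bform (Pm G phi x) (Ef G i x *m A x) (V x).
have cf i : cK (f i).
  split; first exact: smooth_on_bform.
  by move=> x Ux /(AV0 _ Ux)[] E0; rewrite /f E0 ?mulmx0 ?bform0l ?bform0r.
pose g1 i x := bform (Pm G phi x) (nabla G (Ef G i) (fun y => Ef G i y *m A y) x) (V x).
pose g2 i x := bform (Pm G phi x) (Ef G i x *m A x) (nabla G (Ef G i) V x).
pose g3 i x := bform (Pm G phi x) (nabla G (Ef G i) (Ef G i) x *m A x) (V x).
have cg1 i : cK (g1 i).
  split; first by apply: smooth_on_bform => //; exact: (smooth_on_nabla mG).
  move=> x Ux Kx; rewrite /g1; case: AV1 => E0; first by rewrite E0// bform0r.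
  rewrite nabla_zero ?bform0l// => y Uy Ky; rewrite E0// mulmx0//.
have cg2 i : cK (g2 i).
  split; first by apply: smooth_on_bform => //; exact: (smooth_on_nabla mG).
  move=> x Ux Kx; rewrite /g2; case: AV1 => E0; last by rewrite E0// mulmx0 bform0l.
  by rewrite nabla_zero ?bform0r.
have cg3 i : cK (g3 i).
  split.
    apply: smooth_on_bform => //; apply: smooth_on_mul => //; exact: (smooth_on_nabla mG).
  by move=> x Ux /(AV0 _ Ux)[] E0; rewrite /g3 E0 ?mulmx0 ?bform0l ?bform0r.
have Df i x : U x -> 'D_(Ef G i x) (f i) x = g1 i x + g2 i x.
  move=> Ux; have dEA := smooth_on_differentiable (sEA i) Ux.
  have dV := smooth_on_differentiable sV Ux.
  have dP := smooth_on_differentiable sP Ux.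
  have := derive_bform (Ef G i x) dP dEA dV.
  rewrite /f => ->; rewrite (Pm_compat mG sphi phi_parallel)// /g1 /g2 !nablaE.
  by rewrite !bformDl !bformDr; ring.
have divs x : U x -> \sum_i f i x * divg G (Ef G i) x = - \sum_i g3 i x.
  move=> Ux; rewrite /f /g3 -bform_suml -mulmx_suml -bformNl -mulNmx -(divg_Ef_sum mG)//.
  rewrite mulmx_suml bform_suml; apply: eq_bigr => i _.
  by rewrite -scalemxAl bformZl mulrC.
(* The integrand is sum_i div (f_i e_i), whose integral vanishes term by term. *)
have tot : I (fun x => \sum_i g1 i x + \sum_i g2 i x + (-1) * \sum_i g3 i x) = 0.
  transitivity (I (fun x => \sum_i ('D_(Ef G i x) (f i) x + f i x * divg G (Ef G i) x))).
    apply: I_eq => x Ux; rewrite big_split/= divs// mulN1r -big_split/=.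
    by congr (_ + _); apply: eq_bigr => i _; rewrite Df.
  rewrite I_sum; first by rewrite big1// => i _; exact: I_div.
  move=> i; split.
    apply: smooth_onD => //.
      apply: (@eq_smooth_on _ _ _ _ (fun x => g1 i x + g2 i x)) => //.
        by move=> x Ux; rewrite Df.
      by apply: smooth_onD => //; [case: (cg1 i)|case: (cg2 i)].
    apply: smooth_onM => //; first by case: (cf i).
    apply: smooth_on_sum => // j _; apply: smooth_on_bform => //; first by case: mG.
    exact: (smooth_on_nabla mG).
  move=> x Ux Kx; have [_ ->//] := cf i; rewrite mul0r addr0 Df//.
  by have [_ ->//] := cg1 i; have [_ ->//] := cg2 i; rewrite addr0.
have c1 := cK_sum (index_enum 'I_n) cg1; have c2 := cK_sum (index_enum 'I_n) cg2.
have c3 := cK_sum (index_enum 'I_n) cg3.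
rewrite I_add// in tot; [|exact: cK_add|exact: cK_scale].
rewrite I_add// I_scale// in tot.
have -> : I (fun x => bform (Pm G phi x) (\sum_i
    (nabla G (Ef G i) (fun y => Ef G i y *m A y) x - nabla G (Ef G i) (Ef G i) x *m A x)) (V x))
   = I (fun x => \sum_i g1 i x) + (-1) * I (fun x => \sum_i g3 i x).
  rewrite -I_scale// -I_add//; last exact: cK_scale.
  apply: I_eq => x Ux; rewrite bform_suml mulN1r -sumrN -big_split; apply: eq_bigr => i _.
  by rewrite bformBl.
apply/eqP; rewrite -subr_eq0 opprK -/(I (fun x => \sum_i g2 i x)); apply/eqP.
rewrite -[RHS]tot; ring.
Qed.

Lemma Lap_zero V x : smooth_on U V -> (forall y, U y -> ~ K y -> V y = 0) ->
  U x -> ~ K x -> Lap G V x = 0.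
Proof.
move=> sV V0 Ux Kx; rewrite /Lap big1 ?oppr0// => i _.
rewrite !nabla_zero ?subr0// => y Uy Ky.
by rewrite nabla_zero.
Qed.

Lemma ibp_Lap X V : smooth_on U X -> smooth_on U V ->
  (forall x, U x -> ~ K x -> V x = 0) \/ (forall x, U x -> ~ K x -> X x = 0) ->
  I (fun x => \sum_i bform (Pm G phi x) (nabla G (Ef G i) X x) (nabla G (Ef G i) V x)) =
  I (fun x => bform (Pm G phi x) (Lap G X x) (V x)).
Proof.
move=> sX sV XV0.
have sE i := smooth_on_Ef mG i.
have sA := smooth_on_Acov mG sX; have sP := smooth_on_Pm mG sphi.
have dX x : U x -> differentiable X x by exact: smooth_on_differentiable.
have A0 : (forall x, U x -> ~ K x -> X x = 0) -> forall x, U x -> ~ K x -> Acov G X x = 0.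
  by move=> X0 x Ux Kx; apply/matrixP => i j; rewrite mxE nabla_zero// !mxE.
have AV : (forall x, U x -> ~ K x -> V x = 0) \/ (forall x, U x -> ~ K x -> Acov G X x = 0).
  by case: XV0 => H; [left|right => //; exact: A0].
have E x : U x -> \sum_i (nabla G (Ef G i) (fun y => Ef G i y *m Acov G X y) x
    - nabla G (Ef G i) (Ef G i) x *m Acov G X x) = - Lap G X x.
  move=> Ux; rewrite opprK; apply: eq_bigr => i _; congr (_ - _).
    by apply: (eq_nabla mG) => // y Uy; rewrite -Acov_nabla//; exact: dX.
  by rewrite -Acov_nabla//; exact: dX.
have cL : cK (fun x => bform (Pm G phi x) (Lap G X x) (V x)).
  have sL := smooth_on_Lap mG sX.
  split; first exact: smooth_on_bform.
  move=> x Ux Kx; case: XV0 => H; first by rewrite H// bform0r.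
  by rewrite Lap_zero// bform0l.
transitivity (I (fun x => \sum_i bform (Pm G phi x) (Ef G i x *m Acov G X x) (nabla G (Ef G i) V
  x))).
  by apply: I_eq => x Ux; apply: eq_bigr => i _; rewrite -Acov_nabla//; exact: dX.
rewrite ibp//; have -> : I (fun x => bform (Pm G phi x) (Lap G X x) (V x)) =
    - (-1 * I (fun x => bform (Pm G phi x) (Lap G X x) (V x))) by rewrite mulN1r opprK.
rewrite -I_scale//; congr (- _); apply: I_eq => x Ux.
by rewrite E// bformNl mulN1r.
Qed.

(** The pointwise derivative of the energy density at [X] in the direction [V], as
    [dt_energy_densityP] shows. *)
Definition variation_density (d1 d2 : R) X V x : R :=
  2 * d1 * (\sum_i bform (Pm G phi x) (nabla G (Ef G i) X x) (nabla G (Ef G i) V x))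
  + 2 * d2 * (bform (G x) (S2 G phi X X x) (S2 G phi V X x + S2 G phi X V x)
              + bform (Pm G phi x) (Lap G X x) (Lap G V x)).

Lemma first_variation (d1 d2 : R) X V : smooth_on U X -> smooth_on U V ->
  (forall x, U x -> ~ K x -> V x = 0) ->
  I (variation_density d1 d2 X V) =
  2 * I (fun x => bform (Pm G phi x) (sesqui_lhs d1 d2 G phi X x) (V x)).
Proof.
move=> sX sV V0.
have sE i := smooth_on_Ef mG i.
have sP := smooth_on_Pm mG sphi.
have sS := smooth_on_S2 mG sphi sX sX.
have sLX := smooth_on_Lap mG sX; have sLLX := smooth_on_Lap mG sLX.
have sLV := smooth_on_Lap mG sV.
set S := S2 G phi X X in sS.
have sA := smooth_on_Acurv mG sS sX.
pose B := Acurv G S X.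
pose F i x := nabla G (Ef G i) (Rf G (Ef G i) S X) x - Rf G (nabla G (Ef G i) (Ef G i)) S X x.
pose H i x := Rf G (Ef G i) S (nabla G (Ef G i) X) x.
have sN Y i : smooth_on U Y -> smooth_on U (nabla G (Ef G i) Y).
  by move=> sY; exact: (smooth_on_nabla mG).
have sRf i : smooth_on U (Rf G (Ef G i) S X) by exact: (smooth_on_Rf mG).
have sF i : smooth_on U (F i).
  by apply: smooth_onB => //; [exact: sN|apply: (smooth_on_Rf mG) => //; exact: sN].
have sH i : smooth_on U (H i) by apply: (smooth_on_Rf mG) => //; exact: sN.
have cV (Y : vfield R n) : smooth_on U Y -> cK (fun x => bform (Pm G phi x) (Y x) (V x)).
  move=> sY; split; first exact: smooth_on_bform.
  by move=> x Ux Kx; rewrite V0// bform0r.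
have T1 := ibp_Lap sX sV (or_introl V0).
(* Self-adjointness of the Laplacian for g(., phi .): two integrations by parts through the
   symmetric gradient form. *)
have T2 : I (fun x => bform (Pm G phi x) (Lap G X x) (Lap G V x)) =
    I (fun x => bform (Pm G phi x) (Lap G (Lap G X) x) (V x)).
  rewrite -(ibp_Lap sLX sV (or_introl V0)).
  transitivity (I (fun x => bform (Pm G phi x) (Lap G V x) (Lap G X x))).
    by apply: I_eq => x Ux; rewrite (Pm_sym mG phi_self).
  rewrite -(ibp_Lap sV sLX (or_intror V0)); apply: I_eq => x Ux.
  by apply: eq_bigr => i _; rewrite (Pm_sym mG phi_self).
(* Pair symmetry and [Rm_phi] rewrite g(S, R(phi X, nabla_e V) e) as g(R(e, S) X, phi nabla_e V),
   which has one derivative on [V] and can be integrated by parts. *)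
have T3 : I (fun x => bform (G x) (S x) (S2 G phi X V x)) =
    - I (fun x => bform (Pm G phi x) (\sum_i F i x) (V x)).
  transitivity (I (fun x => \sum_i bform (Pm G phi x) (Ef G i x *m B x) (nabla G (Ef G i) V x))).
    apply: I_eq => x Ux; rewrite bform_sumr; apply: eq_bigr => i _.
    rewrite (AcurvE mG)// (bform_sym (symG Ux)) (Rm_pair mG)// (Rm_phi mG sphi phi_parallel)//.
    by rewrite phi_self// PmE.
  rewrite ibp//; last by left.
  congr (- _); apply: I_eq => x Ux; congr bform; apply: eq_bigr => i _; congr (_ - _).
    by apply: (eq_nabla mG) => // y Uy; rewrite (AcurvE mG).
  by rewrite (AcurvE mG).
(* In this part of the variation of S the field [V] is not differentiated, so the curvature
   symmetries give the identity pointwise. *)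
have T4 x : U x -> bform (G x) (S x) (S2 G phi V X x) =
    - bform (Pm G phi x) (\sum_i H i x) (V x).
  move=> Ux; rewrite bform_sumr bform_suml -sumrN; apply: eq_bigr => i _.
  rewrite (bform_sym (symG Ux)) (Rm_pair mG)// (Rm_metric mG)// PmE.
  by rewrite (bform_sym (symG Ux)) /H /Rf.
pose f1 x := \sum_i bform (Pm G phi x) (nabla G (Ef G i) X x) (nabla G (Ef G i) V x).
pose f2 x := bform (Pm G phi x) (Lap G X x) (Lap G V x).
pose f3 x := bform (G x) (S x) (S2 G phi X V x).
pose f4 x := bform (Pm G phi x) (\sum_i H i x) (V x).
have cf1 : cK f1.
  apply: cK_sum => i; split; first by apply: smooth_on_bform => //; exact: sN.
  by move=> x Ux Kx; rewrite (nabla_zero (Ef G i) V0)// bform0r.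
have cf2 : cK f2.
  split; first exact: smooth_on_bform.
  by move=> x Ux Kx; rewrite /f2 (Lap_zero sV V0)// bform0r.
have cf3 : cK f3.
  split; first by apply: smooth_on_bform => //; [case: mG|exact: (smooth_on_S2 mG)].
  move=> x Ux Kx; rewrite /f3 /S2 big1 ?bform0r// => i _.
  rewrite (nabla_zero (Ef G i) V0)//.
  have := Rm_lin2 mG (-1) (X x *m phi x) 0 0 (Ef G i x) Ux.
  by rewrite scaler0 addr0 scaleN1r addNr.
have cf4 : cK f4 by apply: cV; apply: smooth_on_sum.
have cF : cK (fun x => bform (Pm G phi x) (\sum_i F i x) (V x)).
  by apply: cV; apply: smooth_on_sum.
have cL1 := cV _ sLX; have cL2 := cV _ sLLX.
transitivity (I (fun x => 2 * d1 * f1 x + (2 * d2 * f3 x + (- (2 * d2) * f4 x + 2 * d2 * f2 x)))).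
  apply: I_eq => x Ux; rewrite /variation_density bformDr T4// /f1 /f2 /f3 /f4.
  ring.
rewrite I_add; [|exact: cK_scale|do 2?apply: cK_add; exact: cK_scale].
rewrite I_add; [|exact: cK_scale|apply: cK_add; exact: cK_scale].
rewrite I_add; [|exact: cK_scale|exact: cK_scale].
rewrite !I_scale// T1 T2 T3.
have -> : I (fun x => bform (Pm G phi x) (sesqui_lhs d1 d2 G phi X x) (V x)) =
  I (fun x => d1 * bform (Pm G phi x) (Lap G X x) (V x) +
    (d2 * bform (Pm G phi x) (Lap G (Lap G X) x) (V x) +
     (- d2 * bform (Pm G phi x) (\sum_i F i x) (V x) + - d2 * f4 x))).
  apply: I_eq => x Ux; rewrite (sesqui_lhsE mG sphi)// bformBl bformDl !bformZl.
  rewrite big_split bformDl /f4 -/(F _ x) -/(H _ x); ring.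
rewrite I_add; [|exact: cK_scale|do 2?apply: cK_add; exact: cK_scale].
rewrite I_add; [|exact: cK_scale|apply: cK_add; exact: cK_scale].
rewrite I_add; [|exact: cK_scale|exact: cK_scale].
rewrite !I_scale//; ring.
Qed.

End FirstVariation.

(** * Lebesgue measure on row vectors *)

Section BorelRow.
Variable R : realType.

Local Notation borel_row n := (g_sigma_algebraType (@open 'rV[R]_n)).

Lemma measurable_to_open d (T : measurableType d) (X : ptopologicalType)
    (f : T -> g_sigma_algebraType (@open X)) :
  (forall A : set X, open A -> measurable (f @^-1` A)) -> measurable_fun setT f.
Proof.
move=> mf; apply: (@measurability _ _ _ (g_sigma_algebraType (@open X)) _ _ (@open X)) => //.
by move=> _ [A oA <-]; rewrite setTI; exact: mf.
Qed.

Lemma measurable_open (X : ptopologicalType) (A : set X) : open A ->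
  measurable (A : set (g_sigma_algebraType (@open X))).
Proof. by move=> oA; exact: sub_sigma_algebra. Qed.

Lemma measurable_closed (X : ptopologicalType) (A : set X) : closed A ->
  measurable (A : set (g_sigma_algebraType (@open X))).
Proof.
by move=> cA; rewrite -(setCK A); apply: measurableC; apply: measurable_open; exact: closed_openC.
Qed.

Lemma measurable_continuous_on (X : ptopologicalType) (U : set (g_sigma_algebraType (@open X)))
    (f : g_sigma_algebraType (@open X) -> R) : open (U : set X) ->
  (forall x : X, U x -> {for x, continuous (f : X -> R)}) -> measurable_fun U f.
Proof.
move=> oU cf; apply: (measurability _ (RGenOInfty.measurableE R)).
move=> _ [_ [a ->] <-]; apply: measurable_open.
rewrite openE => x [Ux fx]; rewrite /interior.
have oI : open ([set` `]a, +oo[%O] : set R) by exact: interval_open.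
have nU := open_nbhs_nbhs (conj oU Ux).
have nI : nbhs (f x) ([set` `]a, +oo[%O] : set R) by exact: open_nbhs_nbhs.
by apply: filterS (filterI nU (cf x Ux _ nI)) => y [].
Qed.

Lemma measurable_continuous (X Y : ptopologicalType)
    (f : g_sigma_algebraType (@open X) -> g_sigma_algebraType (@open Y)) :
  continuous (f : X -> Y) -> measurable_fun setT f.
Proof.
move=> /continuousP cf; apply: measurable_to_open => A oA.
by apply: measurable_open; exact: cf.
Qed.

Definition rowcons n (p : R * 'rV[R]_n) : 'rV[R]_n.+1 :=
  row_mx (p.1%:M : 'rV[R]_1) p.2.

Lemma row_ball n (c x : 'rV[R]_n) r : 0 < r -> ball c r x <-> forall i, `|c 0 i - x 0 i| < r.
Proof.
move=> r0; split=> [[_ H] i|H]; first by have := H 0 i; rewrite -ball_normE.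
by split=> // i j; rewrite ord1 -ball_normE; exact: H.
Qed.

Lemma rowcons0 n (p : R * 'rV[R]_n) : rowcons p 0 ord0 = p.1.
Proof. by rewrite /rowcons mxE; case: splitP => k //=; rewrite ord1 mxE eqxx mulr1n. Qed.

Lemma rowconsS n (p : R * 'rV[R]_n) i : rowcons p 0 (lift ord0 i) = p.2 0 i.
Proof.
rewrite /rowcons mxE; case: splitP => k /=; first by rewrite ord1.
by rewrite /bump/= add1n => -[/val_inj ->].
Qed.

Lemma rowcons_ball n (c : 'rV[R]_n.+1) r : 0 < r ->
  @rowcons n @^-1` (ball c r) =
  ball (c 0 ord0) r `*` ball (\row_i c 0 (lift ord0 i) : 'rV[R]_n) r.
Proof.
move=> r0; apply/seteqP; split => p /=.
  move/(row_ball _ _ r0) => H; split => /=.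
    by have := H ord0; rewrite rowcons0 -ball_normE.
  by apply/(row_ball _ _ r0) => i; have := H (lift ord0 i); rewrite rowconsS mxE.
move=> [Ht /(row_ball _ _ r0) Hy]; apply/(row_ball _ _ r0) => i.
case: (unliftP ord0 i) => [k ->|->]; first by have := Hy k; rewrite rowconsS mxE.
by move: Ht; rewrite rowcons0 -ball_normE.
Qed.

(** Balls of row vectors are cubes, so an open set becomes a countable union of boxes, and its
    preimage under [rowcons] a countable union of measurable rectangles. *)
Lemma open_rat_balls n (A : set 'rV[R]_n) : open A ->
  A = \bigcup_(q : ('rV[rat]_n * rat)%type)
    [set x | 0 < q.2 /\ ball (map_mx ratr q.1 : 'rV[R]_n) (ratr q.2) `<=` A /\
             ball (map_mx ratr q.1 : 'rV[R]_n) (ratr q.2) x].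
Proof.
move=> oA; apply/seteqP; split => [x Ax|x [q _ [_ [qA /qA]]]//].
have /nbhs_ballP[e /= e0 eA] := open_nbhs_nbhs (conj oA Ax).
have [r] := rat_in_itvoo (divr_gt0 e0 (ltr0n _ 2) : 0 < e / 2).
rewrite in_itv/= => /andP[r0 re].
have rr : (0 : rat) < r by rewrite -(ltr0q R).
have Hq i : exists q : rat, `|ratr q - x 0 i| < ratr r.
  have [|q] := @rat_in_itvoo R (x 0 i - ratr r) (x 0 i + ratr r).
    by rewrite ltrD2l gtrN.
  rewrite in_itv/= => /andP[q1 q2]; exists q; rewrite ltr_norml.
  by apply/andP; split; lra.
have [c Hc] := choice Hq.
exists ((\row_i c i), r) => //=; split=> //.
have r0' : 0 < ratr r :> R by [].
split; last by apply/(row_ball _ _ r0') => i; rewrite !mxE.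
move=> y /(row_ball _ _ r0') Hy; apply: eA; apply/(row_ball _ _ e0) => i.
have := Hy i; rewrite !mxE => Hyi; have := Hc i => Hci.
rewrite -(subrKA (ratr (c i))) (le_lt_trans (ler_normD _ _))// distrC (splitr e).
by apply: ltrD; [exact: lt_trans re|exact: lt_trans re].
Qed.

Lemma measurable_rowcons n :
  measurable_fun setT (@rowcons n : R * borel_row n -> borel_row n.+1).
Proof.
apply: (@measurable_to_open _ _ 'rV[R]_n.+1) => A oA.
rewrite (open_rat_balls oA) preimage_bigcup.
apply: countable_bigcupT_measurable => [|[c r]] /=; first exact: countableP.
have [[r0 qA]|nq] := pselect (0 < r /\ ball (map_mx ratr c : 'rV[R]_n.+1) (ratr r) `<=` A);
  last first.
  rewrite (_ : _ @^-1` _ = set0); first exact: measurable0.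
  by apply/seteqP; split=> // p /= [h1 [h2 _]]; apply: nq.
rewrite (_ : _ @^-1` _ = @rowcons n @^-1` (ball (map_mx ratr c : 'rV[R]_n.+1) (ratr r)));
  last first.
  by apply/seteqP; split=> [p /= [_ [_]]//|p /= H]; split.
have r0' : 0 < ratr r :> R by rewrite ltr0q.
rewrite rowcons_ball//; apply: measurableX.
  by apply: open_measurable; exact: ball_open.
by apply: measurable_open; exact: ball_open.
Qed.

End BorelRow.

Section LebesgueRow.
Variable R : realType.
Local Notation borel_row n := (g_sigma_algebraType (@open 'rV[R]_n)).
Local Open Scope ereal_scope.

(** The image of Lebesgue measure under a translation agrees with it on intervals, hence everywhere
    by uniqueness. *)
Lemma ge0_integral_translate (f : R -> \bar R) (a : R) :
  measurable_fun setT f -> (forall x, 0 <= f x) ->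
  \int[@lebesgue_measure R]_x f (x + a)%R = \int[@lebesgue_measure R]_x f x.
Proof.
move=> mf f0.
have mt : measurable_fun setT ((fun x => x + a)%R : R -> R).
  exact: measurable_funD.
transitivity (\int[pushforward (@lebesgue_measure R) ((fun x => x + a)%R : R -> measurableTypeR
  R)]_x f x).
  by rewrite ge0_integral_pushforward.
apply: eq_measure_integral => A mA _.
apply/esym/lebesgue_measure_unique => // _ [[u v]] _ <-.
rewrite /pushforward.
transitivity (@lebesgue_measure R `](u - a)%R, (v - a)%R]%classic); last first.
  congr (lebesgue_measure _).
  by apply/seteqP; split=> x /=; rewrite !in_itv/= ltrBlDr lerBrDr.
rewrite !lebesgue_measure_itv/= !lte_fin ltrD2r; case: ifP => // _.
by rewrite -!EFinB; congr (_%:E); ring.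
Qed.

Lemma rowconsD n t s (x y : 'rV[R]_n) :
  (rowcons (t, x) + rowcons (s, y) = rowcons (t + s, x + y) :> 'rV[R]_n.+1)%R.
Proof. by apply/rowP => i; rewrite mxE; case: (unliftP ord0 i) => [k ->|->];
  rewrite ?rowcons0 ?rowconsS ?mxE. Qed.

Lemma rowcons_eta n (v : 'rV[R]_n.+1) :
  v = rowcons (v 0%R ord0, \row_i v 0%R (lift ord0 i)).
Proof.
apply/rowP => i; case: (unliftP ord0 i) => [k ->|->].
  by rewrite rowconsS mxE.
by rewrite rowcons0.
Qed.

Lemma ball_sigma_finite n (mu : {measure set (borel_row n) -> \bar R}) :
  (forall (c : 'rV[R]_n) r, (0 < r)%R -> mu (ball c r) < +oo) -> sigma_finite setT mu.
Proof.
move=> mub; exists (fun k => ball (0 : 'rV[R]_n)%R (k.+1%:R : R)).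
  apply/seteqP; split=> // x _; exists (Num.truncn (`|x|%R : R)) => //=.
  by rewrite -ball_normE /ball_/= sub0r normrN truncnS_gt.
move=> k; split; last exact: mub.
by apply: measurable_open; exact: ball_open.
Qed.

Lemma sigma_finite_measureP d (T : measurableType d) (mu : {measure set T -> \bar R}) :
  sigma_finite setT mu ->
  exists nu : {sigma_finite_measure set T -> \bar R}, nu = mu :> {measure set T -> \bar R}.
Proof.
case: mu => m [c1 c2] sf.
pose mm : {measure set T -> \bar R} := Measure.Pack (Measure.Class c2).
pose b := Measure_isSigmaFinite.Build _ _ _ mm sf.
pose nu : {sigma_finite_measure set T -> \bar R} := HB.pack m c1 c2 b.
by exists nu.
Qed.

Lemma pushforward_measureP d1 d2 (T1 : measurableType d1) (T2 : measurableType d2)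
    (m : {measure set T1 -> \bar R}) (f : T1 -> T2) : measurable_fun setT f ->
  exists nu : {measure set T2 -> \bar R},
    nu = pushforward m f :> (set T2 -> \bar R).
Proof.
move=> mf.
by exists (measure_function_pushforward__canonical__measure_function_Measure m mf).
Qed.

Lemma measurable_translate n (v : 'rV[R]_n) :
  measurable_fun setT (fun x : borel_row n => (x + v)%R : borel_row n).
Proof.
apply: (@measurable_continuous 'rV[R]_n 'rV[R]_n) => x.
have dv : differentiable ((@id 'rV[R]_n) + cst v)%R (x : 'rV[R]_n).
  by apply: differentiableD.
exact: (differentiable_continuous dv).
Qed.

(** The measure in dimension n + 1 is the image of a product measure under [rowcons]. Three
    properties are carried along: the iterated integral links it to [lebesgue_int], translation
    invariance will give integrals of derivatives, and the volume of balls gives the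
    sigma-finiteness needed for the next product. *)
Lemma lebesgue_row_exists n : exists mu : {measure set (borel_row n) -> \bar R},
  [/\ forall f : borel_row n -> \bar R, measurable_fun setT f -> (forall x, 0 <= f x) ->
      \int[mu]_x f x = lebesgue_int f,
    forall (f : borel_row n -> \bar R) (v : 'rV[R]_n), measurable_fun setT f ->
      (forall x, 0 <= f x) ->
      \int[mu]_x f (x + v)%R = \int[mu]_x f x &
    forall (c : 'rV[R]_n) r, (0 < r)%R -> mu (ball c r) = ((2 * r) ^+ n)%:E].
Proof.
elim: n => [|n [mu [muE mut mub]]].
  have e0 (x : 'rV[R]_0) : x = 0%R by rewrite thinmx0.
  exists (\d_(0%R : borel_row 0)); split.
  - by move=> f mf f0; rewrite integral_dirac// diracE mem_set// mul1e.
  - by move=> f v mf f0; rewrite (e0 v); under eq_integral do rewrite addr0.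
  - move=> c r r0; have -> : ball c r = setT.
      by apply/seteqP; split=> // x _; apply/(row_ball _ _ r0) => -[].
    by rewrite expr0; exact: diracT.
have sf : sigma_finite setT mu.
  by apply: ball_sigma_finite => c r r0; rewrite mub// ltry.
(* [mu] is repackaged as a sigma-finite measure, the form in which the product measure and
   Fubini-Tonelli take it. *)
have [muS muSE] := sigma_finite_measureP sf; rewrite -{mu sf}muSE in muE mut mub.
pose mu := (muS : {measure set (borel_row n) -> \bar R}).
pose J : R * borel_row n -> borel_row n.+1 := @rowcons R n.
have mJ : measurable_fun setT J := @measurable_rowcons R n.
have [mu1 mu1p] := @pushforward_measureP _ _ (measurableTypeR R * borel_row n)%type _
  (@lebesgue_measure R \x muS) J mJ.
have mFF (f : borel_row n.+1 -> \bar R) : measurable_fun setT f -> (forall x, 0 <= f x) ->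
    measurable_fun setT (fun t : R => \int[mu]_y f (J (t, y))).
  move=> mf f0.
  apply: (@measurable_fun_fubini_tonelli_F _ _ _ _ R muS (fun p => f (J p))) => //.
  exact: measurableT_comp.
have mu1E (f : borel_row n.+1 -> \bar R) : measurable_fun setT f -> (forall x, 0 <= f x) ->
    \int[mu1]_x f x = \int[@lebesgue_measure R]_t \int[mu]_y f (J (t, y)).
  move=> mf f0; rewrite mu1p ge0_integral_pushforward// preimage_setT.
  apply: (@fubini_tonelli1 _ _ _ _ R (@lebesgue_measure R) muS (f \o J)).
  - exact: measurableT_comp.
  - by move=> p; exact: f0.
have mJt t : measurable_fun setT (fun y : borel_row n => J (t, y)).
  by apply: (measurableT_comp mJ); exact: measurable_pair1.
exists mu1; split.
- move=> f mf f0; rewrite mu1E//=; apply: eq_integral => t _.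
  by rewrite muE//; exact: measurableT_comp.
- move=> f v mf f0.
  have mfv : measurable_fun setT (fun x : borel_row n.+1 => f (x + v)%R).
    exact: (measurableT_comp mf (measurable_translate v)).
  rewrite (mu1E _ mfv (fun x => f0 (x + v)%R)) (mu1E _ mf f0).
  have F0 t : 0 <= \int[mu]_y f (J (t, y)) by apply: integral_ge0 => y _; exact: f0.
  apply: etrans (ge0_integral_translate (v 0%R ord0) (mFF _ mf f0) F0).
  apply: eq_integral => t _.
  rewrite -[RHS](mut _ (\row_i v 0%R (lift ord0 i)))//; last exact: measurableT_comp.
  by apply: eq_integral => y _; congr f; rewrite {1}(rowcons_eta v) rowconsD.
- move=> c r r0; rewrite mu1p /pushforward/= rowcons_ball// product_measure1E; last 2 first.
  + by apply: open_measurable; exact: ball_open.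
  + by apply: measurable_open; exact: ball_open.
  rewrite /= mub// lebesgue_measure_ball ?ltW// -EFinM; congr (_%:E).
  by rewrite exprS mulr_natl.
Qed.

End LebesgueRow.

Lemma compact_ubound (R : realType) (X : topologicalType) (K : set X) (f : X -> R) : compact K ->
  (forall x, K x -> {for x, continuous f}) ->
  exists2 C, 0 <= C & forall x, K x -> `|f x| <= C.
Proof.
move=> cK cf.
have [|C [Cr HC]] := @compact_bounded R R^o (f @` K).
  apply: continuous_compact => //; apply: continuous_in_subspaceT => x.
  by rewrite inE; exact: cf.
exists (`|C| + 1); first by rewrite addr_ge0.
move=> x Kx; have := HC (`|C| + 1); apply; last by exists x.
by rewrite (le_lt_trans (ler_norm C))// ltrDl.
Qed.

Section CompactIntegrals.
Variables (R : realType) (X : ptopologicalType).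
Local Notation borel := (g_sigma_algebraType (@open X)).
Variable nu : {measure set borel -> \bar R}.
Implicit Types (U K : set X) (f : X -> R).

Lemma integrable_dominated (B D : set borel) (f : borel -> R) (C : R) :
  measurable B -> measurable D ->
  (nu D < +oo)%E -> measurable_fun B f ->
  (forall x, B x -> `|f x| <= C * \1_D x) ->
  nu.-integrable B (EFin \o f).
Proof.
move=> mB mD Doo mf fC.
apply: (@le_integrable _ _ _ nu B mB _ (EFin \o (fun x => C * \1_D x))).
- exact/measurable_EFinP.
- move=> x Bx /=; rewrite lee_fin (le_trans (fC x Bx))//.
  exact: ler_norm.
- apply: (@integrableS _ _ _ nu setT) => //.
  rewrite (_ : EFin \o _ = fun x => (C%:E * (\1_D x)%:E)%E); last first.
    by apply/funext => x; rewrite /= EFinM.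
  apply: integrableZl => //; apply/integrableP; split.
    by apply/measurable_EFinP; exact: measurable_indic.
  rewrite (eq_integral (fun x => (\1_D x)%:E)); last first.
    by move=> x _; rewrite gee0_abs// lee_fin.
  by rewrite integral_indic// setIT.
Qed.

Lemma integrable_compact_support U K f : open U -> closed K -> compact K ->
  K `<=` U -> (nu K < +oo)%E -> (forall x, U x -> {for x, continuous f}) ->
  (forall x, U x -> ~ K x -> f x = 0) -> nu.-integrable U (EFin \o f).
Proof.
move=> oU clK cK KU Koo cf f0.
have [C C0 HC] := compact_ubound cK (fun x Kx => cf x (KU x Kx)).
apply: (@integrable_dominated U K f C) => //.
- exact: measurable_open.
- exact: measurable_closed.
- exact: measurable_continuous_on.
move=> x Ux; have [Kx|Kx] := pselect (K x).
  by rewrite indicE mem_set// mulr1 HC.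
by rewrite f0// normr0 mulr_ge0.
Qed.

End CompactIntegrals.

(** * Integration against a measure given by a density in a parametrisation *)

Section Density.
Import HBNNSimple.
Local Open Scope ereal_scope.
Variables (R : realType) (d1 d2 : measure_display)
  (S : measurableType d1) (T : measurableType d2).
Variables (nu : {measure set T -> \bar R}) (mu : {measure set S -> \bar R}).
Variables (D : set T) (I : set S) (p : S -> T) (w : S -> R).
Hypotheses (mD : measurable D) (mI : measurable I) (mp : measurable_fun I p)
  (mw : measurable_fun I w) (w0 : forall x, I x -> (0 <= w x)%R).
Hypothesis nuE : forall A : set T, measurable A -> A `<=` D ->
  nu A = \int[mu]_(x in I) ((\1_A (p x))%:E * (w x)%:E).
Hypothesis pD : forall x, I x -> D (p x).

(** The hypothesis [nuE] is the case of indicators. Finite sums extend it to simple functions, and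
    monotone convergence on both sides to nonnegative measurable functions. *)
Lemma ge0_integral_density (f : T -> \bar R) :
  measurable_fun D f -> (forall x, D x -> 0 <= f x) ->
  \int[nu]_(x in D) f x = \int[mu]_(x in I) (f (p x) * (w x)%:E).
Proof.
move=> mf f0.
pose g := nnsfun_approx mD mf.
have mpw (h : T -> \bar R) : measurable_fun D h ->
    measurable_fun I (fun x => h (p x) * (w x)%:E).
  move=> mh; apply: emeasurable_funM; last exact/measurable_EFinP.
  by apply: (measurable_comp mD _ mh mp) => _ [x Ix <-]; exact: pD.
have gE n : \int[nu]_(x in D) (g n x)%:E = \int[mu]_(x in I) ((g n (p x))%:E * (w x)%:E).
  have m1 y : measurable (D `&` (g n @^-1` [set y])) by exact: measurableI.
  rewrite (_ : \int[nu]_(x in D) _ =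
     \sum_(y \in range (g n)) (y%:E * nu (D `&` (g n @^-1` [set y])))); last first.
    under eq_integral => x _ do rewrite fimfunE -fsumEFin//.
    rewrite ge0_integral_fsum//=; last 2 first.
    - move=> y; apply/measurable_EFinP; apply: measurable_funM => //.
    - move=> y x _; exact: nnfun_muleindic_ge0.
    apply: eq_fsbigr => y _.
    rewrite integralZl_indic_nnsfun//=.
    by rewrite integral_indic// setIC.
  under [RHS]eq_integral => x _.
    rewrite fimfunE -fsumEFin// ge0_mule_fsuml; last by move=> y; exact: nnfun_muleindic_ge0.
    over.
  rewrite ge0_integral_fsum//=; last 2 first.
  - move=> y; apply: (mpw (fun z => (y * \1_(g n @^-1` [set y]) z)%:E)).
    by apply/measurable_EFinP; apply: measurable_funM.
  - move=> y x Ix; rewrite mule_ge0 ?lee_fin ?w0//; exact: nnfun_muleindic_ge0.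
  apply: eq_fsbigr => y; rewrite inE => -[z _ gz].
  have y0 : (0 <= y)%R by rewrite -gz.
  rewrite (nuE (m1 y)); last by move=> ? [].
  rewrite -ge0_integralZl//; last 2 first.
  - apply: (mpw (fun z => (\1_(D `&` (g n @^-1` [set y])) z)%:E)).
    by apply/measurable_EFinP; exact: measurable_indic.
  - by move=> x Ix; rewrite mule_ge0 ?lee_fin ?w0// lee_fin.
  apply: eq_integral => x; rewrite inE => Ix.
  suff -> : \1_(D `&` (g n @^-1` [set y])) (p x) = \1_(g n @^-1` [set y]) (p x) :> R.
    by rewrite muleA -EFinM.
  by rewrite !indicE in_setI (_ : p x \in D)// inE; exact: pD.
have nd x : D x -> {homo (fun n => (g n x)%:E) : m n / (m <= n)%N >-> m <= n}.
  by move=> Dx m n mn; rewrite lee_fin; have /lefP := nd_nnsfun_approx mD mf mn; apply.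
have mgE n : measurable_fun D (EFin \o g n).
  exact/measurable_EFinP/measurable_funTS.
transitivity (\int[nu]_(x in D) limn (fun n => (g n x)%:E)).
  apply: eq_integral => x; rewrite inE => Dx; apply/esym/cvg_lim => //.
  exact: cvg_nnsfun_approx.
rewrite monotone_convergence//; last by move=> n x Dx; rewrite lee_fin.
under eq_fun do rewrite gE.
rewrite -monotone_convergence//; last 3 first.
- by move=> n; apply: (mpw _ (mgE n)).
- by move=> n x Ix; rewrite mule_ge0 ?lee_fin ?w0.
- by move=> x Ix m n mn; rewrite lee_wpmul2r ?lee_fin ?w0//; apply: nd => //; exact: pD.
apply: eq_integral => x; rewrite inE => Ix; apply/cvg_lim => //.
by apply: cvgeMr => //; apply: cvg_nnsfun_approx => //; exact: pD.
Qed.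

End Density.

Section LebesgueRowMeasure.
Variables (R : realType) (n : nat).
Local Notation rV := 'rV[R]_n.

Definition lebesgue_row : {measure set (g_sigma_algebraType (@open rV)) -> \bar R} :=
  projT1 (cid (lebesgue_row_exists R n)).
Local Notation mu := lebesgue_row.

Lemma lebesgue_rowE (f : g_sigma_algebraType (@open rV) -> \bar R) :
  measurable_fun setT f -> (forall x, (0 <= f x)%E) ->
  (\int[mu]_x f x)%E = lebesgue_int f.
Proof. by rewrite /mu; case: cid => ? [H1 H2 H3] /=; exact: H1. Qed.

Lemma lebesgue_row_ball (c : rV) r : 0 < r -> mu (ball c r) = ((2 * r) ^+ n)%:E.
Proof. by rewrite /mu; case: cid => ? [H1 H2 H3] /=; exact: H3. Qed.

Lemma ge0_integral_row_translate (v : rV) (f : g_sigma_algebraType (@open rV) -> \bar R) :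
  measurable_fun setT f -> (forall x, (0 <= f x)%E) ->
  (\int[mu]_x f (x + v)%R = \int[mu]_x f x)%E.
Proof. by rewrite /mu; case: cid => ? [H1 H2 H3] /=; exact: H2. Qed.

Lemma lebesgue_row_translate (v : rV) (A : set (g_sigma_algebraType (@open rV))) :
  measurable A -> mu [set x | A (x + v)] = mu A.
Proof.
move=> mA.
have mAv : measurable ([set x | A (x + v)] : set (g_sigma_algebraType (@open rV))).
  by rewrite -[X in measurable X]setTI; exact: measurable_translate.
have := ge0_integral_row_translate v (f := fun x => (\1_A x)%:E); rewrite !integral_indic// !setIT.
move=> HA.
apply: HA => [|x]; last by rewrite lee_fin.
by apply/measurable_EFinP; exact: measurable_indic.
Qed.

Lemma compact_lebesgue_row (K : set rV) : compact K -> (mu K < +oo)%E.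
Proof.
move=> cK; have [C [Cr HC]] := compact_bounded cK.
have C1 : 0 < `|C| + 1 + 1 by rewrite -addrA ltr_wpDl.
have KC : K `<=` ball (0 : rV) (`|C| + 1 + 1).
  move=> x Kx; rewrite -ball_normE /ball_ /= sub0r normrN.
  rewrite (@le_lt_trans _ _ (`|C| + 1)) ?ltrDl// HC//.
  by rewrite (le_lt_trans (ler_norm C))// ltrDl.
apply: (@le_lt_trans _ _ (mu (ball (0 : rV) (`|C| + 1 + 1)))).
  apply: le_measure => //; rewrite inE.
    by apply: measurable_closed; exact: (compact_closed (@norm_hausdorff _ _)).
  by apply: measurable_open; exact: ball_open.
by rewrite lebesgue_row_ball// ltry.
Qed.

Lemma integrable_translate (v : rV) (f : rV -> R) :
  mu.-integrable setT (EFin \o f) -> mu.-integrable setT (EFin \o (fun x => f (x + v))).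
Proof.
move=> /integrableP[mf foo]; apply/integrableP; split.
  exact: (measurableT_comp mf (measurable_translate v)).
have := @ge0_integral_row_translate v (fun x => `|(EFin \o f) x|%E).
move=> -> //; exact: measurableT_comp.
Qed.

Lemma Rintegral_translate (v : rV) (f : rV -> R) :
  mu.-integrable setT (EFin \o f) ->
  \int[mu]_x f (x + v) = \int[mu]_x f x.
Proof.
move=> intf.
pose phi (x : g_sigma_algebraType (@open rV)) : g_sigma_algebraType (@open rV) := x + v.
have mphi : measurable_fun setT phi := measurable_translate v.
rewrite /Rintegral; congr fine.
have /integrableP[mf _] := intf.
transitivity (\int[pushforward mu phi]_x (EFin \o f) x)%E.
  apply: esym; apply: etrans (integral_pushforward mphi mf _ measurableT) _ => //.
  exact: integrable_translate.
by apply: eq_measure_integral => A mA _; exact: lebesgue_row_translate.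
Qed.

(* The difference quotients of [h] have integral [0] by translation invariance, and
   dominated convergence applies. *)
Lemma Rintegral_derive0 (v : rV) (h : rV -> R) (K : set rV) :
  compact K -> (forall x, differentiable h x) -> continuous (fun x => 'D_v h x) ->
  (forall x, ~ K x -> h x = 0) ->
  mu.-integrable setT (EFin \o (fun x => 'D_v h x)) /\ \int[mu]_x 'D_v h x = 0.
Proof.
move=> cK dh cdh h0.
have clK : closed K by exact: (compact_closed (@norm_hausdorff _ _)).
have nK x : ~ K x -> nbhs x (~` K) by move=> Kx; apply: open_nbhs_nbhs; split=> //;
  exact: closed_openC.
have D0 x : ~ K x -> 'D_v h x = 0.
  move=> Kx; rewrite -(derive_cst (0 : R) x v); apply: near_eq_derive.
  by apply: filterS (nK x Kx) => y Ky; rewrite h0.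
have iD : mu.-integrable setT (EFin \o (fun x => 'D_v h x)).
  apply: (@integrable_compact_support _ _ mu setT K) => //.
  - exact: openT.
  - exact: compact_lebesgue_row.
  - by move=> x _; exact: cdh.
  - by move=> x _; exact: D0.
split=> //.
have [C C0 HC] := compact_ubound cK (fun x _ => cdh x).
have [B [Br HB]] := compact_bounded cK.
(* Radius of a ball that contains every [y] with [y + t *: v] in [K] and |t| < 1: the bound for [K]
   is |B| + 1, and |v| bounds the displacement. *)
pose r := `|B| + 1 + `|v| + 1.
pose Q := ball (0 : rV) r.
have r0 : 0 < r by rewrite ltr_wpDl// !addr_ge0.
have KQ y t : `|t| < 1 -> K (y + t *: v) -> Q y.
  move=> t1 Ky; rewrite /Q -ball_normE /ball_ /= sub0r normrN -[y](addrK (t *: v)).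
  rewrite (le_lt_trans (ler_normB _ _))//.
  have H1 : `|y + t *: v| <= `|B| + 1.
    by apply: (HB (`|B| + 1)) => //; rewrite (le_lt_trans (ler_norm B))// ltrDl.
  have H2 : `|t *: v| <= `|v| by rewrite normrZ ler_piMl// ltW.
  rewrite /r (le_lt_trans (lerD H1 H2))// ltrDl//.
have oQ : open Q by exact: ball_open.
pose f t y := h (y + t *: v).
have df (t : R) (y : rV) : is_derive t (1 : R) (f ^~ y) ('D_v h (y + t *: v)).
  have dl : differentiable (fun t : R => y + t *: v) t.
    by apply: differentiableD; [exact: differentiable_cst|exact: differentiableZl].
  have dlE : 'D_1 (fun t : R => y + t *: v) t = v.
    rewrite deriveD ?derive_cst; [|exact: derivable_cst|].
      by rewrite add0r deriveE// diff_val scale1r.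
    exact: diff_derivable.
  have dfl : differentiable (fun t : R => h (y + t *: v)) t.
    exact: (@differentiable_comp _ _ _ _ (fun t : R => y + t *: v) h).
  apply: DeriveDef; first exact: diff_derivable.
  by rewrite (@derive_comp _ _ _ _ (fun t : R => y + t *: v) h) ?dlE.
have fE t y : partial1of2 f t y = 'D_v h (y + t *: v).
  by rewrite partial1of2E; have [] := df t y.
pose g y := C * \1_Q y.
have intg : mu.-integrable setT (EFin \o g).
  apply: (@integrable_dominated _ _ mu setT Q g C) => //; [|by rewrite lebesgue_row_ball// ltry| |].
  - exact: measurable_open.
  - by apply: measurable_funM => //; apply: measurable_indic; exact: measurable_open.
  - by move=> x _; rewrite ger0_norm// mulr_ge0.
have ih : mu.-integrable setT (EFin \o h).
  apply: (@integrable_compact_support _ _ mu setT K) => //.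
  - exact: openT.
  - exact: compact_lebesgue_row.
  - by move=> x _; exact: differentiable_continuous.
  - by move=> x _; exact: h0.
have inth t : mu.-integrable setT (EFin \o f t) by exact: integrable_translate.
have I0 : (`](-1), 1[%classic : set R) 0 by rewrite /= in_itv/= ltr01 oppr_lt0 ltr01.
have fg t y : (`](-1), 1[%classic : set R) t -> setT y -> `|partial1of2 f t y| <= g y.
  rewrite /= in_itv/= -ltr_norml => t1 _; rewrite fE /g.
  have [Ky|Ky] := pselect (K (y + t *: v)).
    by rewrite indicE mem_set ?mulr1; [exact: HC|exact: (KQ _ t)].
  by rewrite D0// normr0 mulr_ge0.
have derf t y : (`](-1), 1[%classic : set R) t -> setT y -> derivable (f ^~ y) t 1.
  by move=> _ _; have [] := df t y.
have g0 y : 0 <= g y by rewrite mulr_ge0.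
have := @differentiation_under_integral _ _ _ mu f setT measurableT 0 (-1) 1 I0
  (fun t _ => inth t) derf g g0 intg fg.
under eq_Rintegral do rewrite fE scale0r addr0.
move=> <-.
rewrite (_ : (fun t => _) = cst (\int[mu]_y h y)); first exact: derive1_cst.
by apply/funext => t; rewrite /f; exact: Rintegral_translate.
Qed.

End LebesgueRowMeasure.

(** * Integration over a chart against the Riemannian volume density *)

Section ChartIntegral.
Variables (R : realType) (n : nat) (G : mfield R n) (U K : set 'rV[R]_n).
Local Notation rV := 'rV[R]_n.
Local Notation mu := (@lebesgue_row R n).
Hypothesis mG : metric_on U G.
Hypotheses (cptK : compact K) (KU : K `<=` U).
Implicit Types (f h : rV -> R).

Let oU : open U. Proof. by case: mG. Qed.
Let clK : closed K. Proof. exact: (compact_closed (@norm_hausdorff _ _)). Qed.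

Definition chart_int f : R := \int[mu]_(x in U) (f x * vol G x).

Let mU : measurable (U : set (g_sigma_algebraType (@open rV))).
Proof. exact: measurable_open. Qed.

Lemma chart_integrable f : cK U K f -> mu.-integrable U (EFin \o (fun x => f x * vol G x)).
Proof.
move=> [sf f0]; apply: (@integrable_compact_support _ _ mu U K) => //.
- exact: compact_lebesgue_row.
- move=> x Ux; apply: differentiable_continuous; apply: smooth_on_differentiable Ux.
  by apply: smooth_onM => //; exact: smooth_on_vol.
- by move=> x Ux Kx; rewrite f0// mul0r.
Qed.

Lemma chart_int_eq f h : (forall x, U x -> f x = h x) -> chart_int f = chart_int h.
Proof. by move=> fh; apply: eq_Rintegral => x; rewrite inE => Ux; rewrite fh. Qed.

Lemma chart_intD f h : cK U K f -> cK U K h ->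
  chart_int (fun x => f x + h x) = chart_int f + chart_int h.
Proof.
move=> cf ch; rewrite /chart_int -RintegralD//; try exact: chart_integrable.
by apply: eq_Rintegral => x _; rewrite mulrDl.
Qed.

Lemma chart_intZ c f : cK U K f -> chart_int (fun x => c * f x) = c * chart_int f.
Proof.
move=> cf; rewrite /chart_int -RintegralZl//; last exact: chart_integrable.
by apply: eq_Rintegral => x _; rewrite mulrA.
Qed.

Lemma Rintegral_derive_on0 (v : rV) h : cK U K h ->
  mu.-integrable U (EFin \o (fun x => 'D_v h x)) /\ \int[mu]_(x in U) 'D_v h x = 0.
Proof.
move=> [sh h0].
(* Extension of [h] by zero to the whole space: near a point of [K] it is [h] and near any other
   point it is zero, hence it is differentiable everywhere. *)
pose e x := if x \in U then h x else 0.
have eU x : U x -> e x = h x by move=> Ux; rewrite /e mem_set.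
have eK x : ~ K x -> e x = 0.
  by rewrite /e; case: ifPn => //; rewrite inE => Ux Kx; rewrite h0.
have nU x : U x -> nbhs x U by move=> Ux; exact: open_nbhs_nbhs.
have nK x : ~ K x -> nbhs x (~` K).
  by move=> Kx; apply: open_nbhs_nbhs; split=> //; exact: closed_openC.
have neU x : U x -> \forall y \near x, h y = e y.
  by move=> Ux; apply: filterS (nU x Ux) => y Uy; rewrite eU.
have neK x : ~ K x -> \forall y \near x, cst 0 y = e y.
  by move=> Kx; apply: filterS (nK x Kx) => y Ky; rewrite eK.
have DU x : U x -> 'D_v e x = 'D_v h x.
  by move=> Ux; apply/esym; apply: near_eq_derive; exact: neU.
have DK x : ~ K x -> 'D_v e x = 0.
  move=> Kx; rewrite -(derive_cst (0 : R) x v).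
  by apply/esym; apply: near_eq_derive; exact: neK.
have de x : differentiable e x.
  have [Kx|Kx] := pselect (K x).
    apply: near_eq_differentiable (neU x (KU Kx)) _.
    exact: smooth_on_differentiable (KU Kx).
  by apply: near_eq_differentiable (neK x Kx) _; exact: differentiable_cst.
have cde : continuous (fun x => 'D_v e x).
  move=> x; apply: differentiable_continuous; have [Kx|Kx] := pselect (K x).
    apply: (@near_eq_differentiable _ _ _ (fun x => 'D_v h x)).
      by apply: filterS (nU x (KU Kx)) => y Uy; rewrite DU.
    by have := smooth_on_derive v sh; move=> /smooth_on_differentiable; apply; exact: KU.
  apply: (@near_eq_differentiable _ _ _ (cst 0)); last exact: differentiable_cst.
  by apply: filterS (nK x Kx) => y Ky; rewrite DK.
have [inte int0] := Rintegral_derive0 cptK de cde eK.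
have E : (fun x => 'D_v e x) \_ U = (fun x => 'D_v e x).
  apply/funext => x; rewrite patchE; case: ifPn => // /negP Ux.
  by rewrite DK// => /KU Ux'; apply: Ux; rewrite inE.
split.
  have := @integrableS _ _ _ mu setT U (EFin \o (fun x => 'D_v e x)) measurableT mU (@subsetT _
    U) inte.
  by apply: eq_integrable => // x; rewrite inE => Ux /=; rewrite DU.
rewrite -int0 -[in RHS]E -Rintegral_mkcond.
by apply: eq_Rintegral => x; rewrite inE => Ux; rewrite DU.
Qed.

(** By [divergence_coord] the integrand times the volume density is a sum of coordinate derivatives
    of functions that vanish off [K], and each of these has integral zero. *)
Lemma chart_int_div f (X : vfield R n) : cK U K f -> smooth_on U X ->
  chart_int (fun x => 'D_(X x) f x + f x * divg G X x) = 0.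
Proof.
move=> [sf f0] sX.
pose H a x := f x * vol G x * X x 0 a.
have cH a : cK U K (H a).
  split; last by move=> x Ux Kx; rewrite /H f0// !mul0r.
  apply: smooth_onM => //; last exact: smooth_on_entry.
  by apply: smooth_onM => //; exact: smooth_on_vol.
have S (r : seq 'I_n) :
    mu.-integrable U (EFin \o (fun x => \sum_(a <- r) 'D_(delta_mx 0 a) (H a) x)) /\
    \int[mu]_(x in U) (\sum_(a <- r) 'D_(delta_mx 0 a) (H a) x) = 0.
  elim: r => [|a r [IH1 IH2]].
    rewrite (_ : (fun x => _) = cst 0); last by apply/funext => x; rewrite big_nil.
    split; last by rewrite Rintegral_cst// mul0r.
    exact: integrable0.
  rewrite (_ : (fun x => _) = (fun x => 'D_(delta_mx 0 a) (H a) x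
      + \sum_(a <- r) 'D_(delta_mx 0 a) (H a) x)); last first.
    by apply/funext => x; rewrite big_cons.
  have [D1 D2] := Rintegral_derive_on0 (delta_mx 0 a) (cH a).
  split; last by rewrite RintegralD// D2 IH2 addr0.
  by have := integrableD mU D1 IH1; apply: eq_integrable.
rewrite -(S (index_enum 'I_n)).2; apply: eq_Rintegral => x; rewrite inE => Ux.
have dc : differentiable f x by exact: smooth_on_differentiable Ux.
exact: (divergence_coord mG Ux dc (smooth_on_differentiable sX Ux)).
Qed.

End ChartIntegral.

(* [p] and [q] stand for the first derivatives of the metric in two charts, [g] for
   the Hessian of the transition map lowered by the metric: the Koszul formula
   gives the transformation rule of the Christoffel symbols. *)
Lemma koszul_change (R : comPzRingType) (T : Type) (p q g : T -> T -> T -> R) u v w :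
  (forall a b c, p a b c = q a b c + g a b c + g a c b) ->
  (forall a b c, g a b c = g b a c) ->
  q u v w + q v u w - q w u v = p u v w + p v u w - p w u v - 2 * g u v w.
Proof.
by move=> E S; rewrite !E (S v u) (S w u) (S w v); ring.
Qed.

(** * Invariance of the operators under isometric changes of coordinates *)

Section ChangeOfCoordinates.
Variables (R : realType) (n : nat) (U U' : set 'rV[R]_n) (psi psi' : vfield R n).
Variables (G G' phi phi' : mfield R n).
Implicit Types (x u v w z : 'rV[R]_n) (X Y Z : vfield R n).
Hypotheses (mG : metric_on U G) (mG' : metric_on U' G').
Hypotheses (spsi : smooth_on U psi) (spsi' : smooth_on U' psi').
Hypotheses (psiU : forall x, U x -> U' (psi x)) (psiU' : forall y, U' y -> U (psi' y)).
Hypotheses (psiK : forall x, U x -> psi' (psi x) = x)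
  (psiK' : forall y, U' y -> psi (psi' y) = y).
Hypothesis isoG : forall x v w, U x ->
  bform (G' (psi x)) ('D_v psi x) ('D_w psi x) = bform (G x) v w.
Hypotheses (sphi : smooth_on U phi) (sphi' : smooth_on U' phi').
Hypothesis phi_psi : forall x v, U x ->
  'D_v psi x *m phi' (psi x) = 'D_(v *m phi x) psi x.

Let oU : open U. Proof. by case: mG. Qed.
Let oU' : open U'. Proof. by case: mG'. Qed.
Let dpsi x (Ux : U x) : differentiable psi x := smooth_on_differentiable spsi Ux.
Let near_U x (Ux : U x) : nbhs x U. Proof. exact: open_nbhs_nbhs. Qed.
Let pG' x (Ux : U x) v : v != 0 -> 0 < bform (G' (psi x)) v v.
Proof. by case: mG' => _ _ _ H v0; apply: H => //; exact: psiU. Qed.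

(** The classical notion of [psi]-related fields: the components of one vector field of the manifold
    in two charts are related in this sense by the transition map. *)
Definition related X X' := forall x, U x -> X' (psi x) = 'D_(X x) psi x.

Definition push X : vfield R n := fun y => 'D_(X (psi' y)) psi (psi' y).

Lemma related_push X : related X (push X).
Proof. by move=> x Ux; rewrite /push psiK. Qed.

Lemma smooth_on_push X : smooth_on U X -> smooth_on U' (push X).
Proof.
move=> sX; apply: (@smooth_on_comp _ _ _ _ _ U' U psi' (fun x => 'D_(X x) psi x)) => //.
exact: smooth_on_dir_row.
Qed.

Let derive_psiB u v x : U x -> 'D_u psi x - 'D_v psi x = 'D_(u - v) psi x.
Proof. by move=> Ux; have d := dpsi Ux; rewrite derive_dirD// derive_dirN. Qed.

Lemma derive_psi_surj x v : U x -> exists w, 'D_w psi x = v.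
Proof.
move=> Ux; have Ux' := psiU Ux; exists ('D_v psi' (psi x)).
have d' : differentiable psi' (psi x) by exact: smooth_on_differentiable Ux'.
have dp : differentiable psi (psi' (psi x)) by rewrite psiK//; exact: dpsi.
have := derive_comp v d' dp; rewrite psiK// => <-.
rewrite -[RHS](derive_id (psi x) v); apply: near_eq_derive.
by apply: filterS (open_nbhs_nbhs (conj oU' Ux')) => y Uy; rewrite /= psiK'.
Qed.

Lemma psi_bform_inj x a b : U x ->
  (forall z, bform (G' (psi x)) a ('D_z psi x) = bform (G' (psi x)) b ('D_z psi x)) -> a = b.
Proof.
move=> Ux H; apply: (bform_inj (pG' Ux)) => w.
by have [z <-] := derive_psi_surj w Ux.
Qed.

Lemma isoG_derive x u v w : U x ->
  bform ('D_u G x) v w = bform ('D_('D_u psi x) G' (psi x)) ('D_v psi x) ('D_w psi x)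
   + bform (G' (psi x)) ('D_u (fun y => 'D_v psi y) x) ('D_w psi x)
   + bform (G' (psi x)) ('D_v psi x) ('D_u (fun y => 'D_w psi y) x).
Proof.
move=> Ux; have dG' : differentiable G' (psi x).
  by case: mG' => _ sG' _ _; apply: smooth_on_differentiable sG' _; exact: psiU.
have dD a : differentiable (fun y => 'D_a psi y) x.
  exact: smooth_on_differentiable (smooth_on_derive a spsi) Ux.
have dGp : differentiable (fun y => G' (psi y)) x by exact: (differentiable_comp (dpsi Ux) dG').
rewrite -(derive_comp u (dpsi Ux) dG') -derive_bform//.
have dG : differentiable G x by case: mG => _ sG _ _; exact: smooth_on_differentiable Ux.
have dc a : differentiable (fun=> a : 'rV[R]_n) x by exact: differentiable_cst.
have := derive_bform u dG (dc v) (dc w).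
rewrite !derive_cst bform0l bform0r !addr0 => <-; apply: near_eq_derive.
by apply: filterS (near_U Ux) => y Uy; rewrite isoG.
Qed.

(** Both sides are tested against the vectors D_z psi, which exhaust the space, and compared through
    the Koszul formulas of the two metrics. *)
Lemma Gam_psi x v w : U x ->
  Gam G' (psi x) ('D_v psi x) ('D_w psi x) =
  'D_(Gam G x v w) psi x - 'D_v (fun y => 'D_w psi y) x.
Proof.
move=> Ux; apply: (psi_bform_inj Ux) => z.
have m := metric_on_at mG Ux; have m' := metric_on_at mG' (psiU Ux).
rewrite bformBl isoG//; apply: (@mulfI _ 2); first by rewrite pnatr_eq0.
rewrite mulrBr (koszul _ _ _ m') (koszul v w z m).
have sy a b : bform (G' (psi x)) a b = bform (G' (psi x)) b a.
  by apply: bform_sym; case: m'.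
pose g a b c := bform (G' (psi x)) ('D_a (fun y => 'D_b psi y) x) ('D_c psi x).
have E a b c : bform ('D_a G x) b c =
    bform ('D_('D_a psi x) G' (psi x)) ('D_b psi x) ('D_c psi x) + g a b c + g a c b.
  by apply: etrans (isoG_derive a b c Ux) _; congr (_ + _); exact: sy.
have S a b c : g a b c = g b a c by rewrite /g (schwarz b a oU Ux spsi).
exact: (@koszul_change R 'rV[R]_n (fun a b c => bform ('D_a G x) b c)
  (fun a b c => bform ('D_('D_a psi x) G' (psi x)) ('D_b psi x) ('D_c psi x)) g v w z E S).
Qed.

(** The Hessian of [psi] occurs twice with opposite signs: in the derivative of y |-> D_(Y y) psi
    and in [Gam_psi]. *)
Lemma nabla_psi X X' Y Y' : smooth_on U Y -> smooth_on U' Y' ->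
  related X X' -> related Y Y' -> related (nabla G X Y) (nabla G' X' Y').
Proof.
move=> sY sY' rX rY x Ux; have dY := smooth_on_differentiable sY Ux.
have dY' := smooth_on_differentiable sY' (psiU Ux).
rewrite !nablaE rX// rY// Gam_psi//.
have [_ E] := derive_dir_field (X x) oU Ux spsi dY.
have -> : 'D_('D_(X x) psi x) Y' (psi x) = 'D_(X x) (fun y => 'D_(Y y) psi y) x.
  rewrite -(derive_comp (X x) (dpsi Ux) dY'); apply: near_eq_derive.
  by apply: filterS (near_U Ux) => y Uy; rewrite /= rY.
rewrite E derive_dirD; last exact: dpsi.
move: ('D_('D_(X x) Y x) psi x) ('D_(X x) _ x) ('D_(Gam _ _ _ _) psi x) => a b c.
by rewrite addrA addrAC addrK.
Qed.

Lemma related_bracket X X' Y Y' : smooth_on U X -> smooth_on U' X' ->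
  smooth_on U Y -> smooth_on U' Y' ->
  related X X' -> related Y Y' -> related (bracket X Y) (bracket X' Y').
Proof.
move=> sX sX' sY sY' rX rY x Ux.
have [_ _ _ s] := metric_on_at mG Ux; have [_ _ _ s'] := metric_on_at mG' (psiU Ux).
rewrite -(@nabla_torsion_free _ _ G X Y x)// -(@nabla_torsion_free _ _ G' X' Y')//.
rewrite (nabla_psi sY sY' rX rY Ux) (nabla_psi sX sX' rY rX Ux).
exact: derive_psiB.
Qed.

(** The vectors are extended by constant fields in one chart and by their push-forwards in the
    other; naturality of [nabla] and of the bracket carries over to the curvature. *)
Lemma Rm_psi x u v w : U x ->
  Rm G' (psi x) ('D_u psi x) ('D_v psi x) ('D_w psi x) = 'D_(Rm G x u v w) psi x.
Proof.
move=> Ux; have Ux' := psiU Ux.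
have sc a : smooth_on U (fun=> a : 'rV[R]_n) by exact: smooth_on_cst.
pose p a := push (fun=> a).
have sp a : smooth_on U' (p a) by exact: smooth_on_push.
have rp a : related (fun=> a) (p a) by exact: related_push.
have pE a : p a (psi x) = 'D_a psi x by exact: rp.
have dc a := smooth_on_differentiable (sc a) Ux.
have dp a := smooth_on_differentiable (sp a) Ux'.
have E' := curvE mG' Ux' (dp u) (dp v) (sp w).
have E := curvE mG Ux (dc u) (dc v) (sc w).
rewrite -!pE -E' -E !curv_def.
have sn a b : smooth_on U (nabla G (fun=> a) (fun=> b)) by exact: smooth_on_nabla.
have sn' a b : smooth_on U' (nabla G' (p a) (p b)) by exact: smooth_on_nabla.
have rn a b : related (nabla G (fun=> a) (fun=> b)) (nabla G' (p a) (p b)).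
  by apply: nabla_psi.
have rb := related_bracket (sc u) (sp u) (sc v) (sp v) (rp u) (rp v).
rewrite (nabla_psi (sn v w) (sn' v w) (rp u) (rn v w) Ux).
rewrite (nabla_psi (sn u w) (sn' u w) (rp v) (rn u w) Ux).
rewrite (nabla_psi (sc w) (sp w) rb (rp w) Ux).
by rewrite pE !(derive_psiB _ _ Ux).
Qed.

(** The differential of [psi] maps [Ef G] to an orthonormal basis that need not be [Ef G'];
    independence of traces from the basis removes the difference. *)
Lemma onb_trace (W : lmodType R) (B : 'rV[R]_n -> 'rV[R]_n -> W) (e : 'I_n -> 'rV[R]_n) y :
  (forall c u u' v, B (c *: u + u') v = c *: B u v + B u' v) ->
  (forall c u u' v, B v (c *: u + u') = c *: B v u + B v u') ->
  U' y -> (forall i j, bform (G' y) (e i) (e j) = (i == j)%:R) ->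
  \sum_i B (e i) (e i) = \sum_i B (Ef G' i y) (Ef G' i y).
Proof.
move=> Bl Br Uy oe; rewrite (orthonormal_trace Bl Br (A := G' y)); last first.
  by apply: cholP => [|v]; case: mG' => _ _ s p; [exact: s|exact: p].
pose P := \matrix_i e i.
have rP i : row i P = e i by rewrite rowK.
rewrite -(@orthonormal_trace _ _ _ (G' y) P B Bl Br).
  by apply: eq_bigr => i _; rewrite rP.
by apply/matrixP => i j; rewrite -bform_rows !rP oe mxE.
Qed.

Lemma Ef_psi x i j : U x ->
  bform (G' (psi x)) ('D_(Ef G i x) psi x) ('D_(Ef G j x) psi x) = (i == j)%:R.
Proof. by move=> Ux; rewrite isoG// (Ef_orthonormal mG). Qed.

Section RelatedFields.
Variables X X' : vfield R n.
Hypotheses (sX : smooth_on U X) (sX' : smooth_on U' X') (rX : related X X').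

Lemma Acov_psi x v : U x -> 'D_v psi x *m Acov G' X' (psi x) = 'D_(v *m Acov G X x) psi x.
Proof.
move=> Ux; have dX := smooth_on_differentiable sX Ux.
have dX' := smooth_on_differentiable sX' (psiU Ux).
have sc : smooth_on U (fun=> v : 'rV[R]_n) by exact: smooth_on_cst.
have := nabla_psi sX sX' (related_push (fun=> v)) rX Ux.
by rewrite !Acov_nabla// /push psiK.
Qed.

Lemma Btr_psi x v : U x ->
  Btr G' (Acov G' X') (psi x) ('D_v psi x) ('D_v psi x) =
  'D_(Btr G (Acov G X) x v v) psi x.
Proof.
move=> Ux; have Ux' := psiU Ux.
pose c : vfield R n := fun=> v; have sc : smooth_on U c by exact: smooth_on_cst.
have sp := smooth_on_push sc; have rp := related_push c.
have pE : push c (psi x) = 'D_v psi x by exact: rp.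
have T := nabla2_tensor mG oU (@subset_refl _ U) Ux sc sX.
have T' := nabla2_tensor mG' oU' (@subset_refl _ U') Ux' sp sX'.
rewrite -{1}pE -[X in Btr _ _ _ _ X]pE -T' -[X in 'D_X _ _]T.
have r1 := nabla_psi sX sX' rp rX.
have r2 := nabla_psi sc sp rp rp.
have s1 := smooth_on_nabla mG sc sX; have s1' := smooth_on_nabla mG' sp sX'.
by rewrite (nabla_psi s1 s1' rp r1 Ux) (nabla_psi sX sX' r2 rX Ux) derive_psiB.
Qed.

Lemma Lap_psi x : U x -> Lap G' X' (psi x) = 'D_(Lap G X x) psi x.
Proof.
move=> Ux; have Ux' := psiU Ux; have d := dpsi Ux.
have dA' := smooth_on_differentiable (smooth_on_Acov mG' sX') Ux'.
rewrite /Lap derive_dirN// derive_dir_sum//; congr (- _).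
transitivity (\sum_i Btr G' (Acov G' X') (psi x) (Ef G' i (psi x)) (Ef G' i (psi x))).
  apply: eq_bigr => i _.
  exact: (nabla2_tensor mG' oU' (@subset_refl _ U') Ux' (smooth_on_Ef mG' i) sX').
rewrite -(onb_trace (e := fun i => 'D_(Ef G i x) psi x) _ _ Ux' _); last 3 first.
- by move=> c u u' v; exact: Btr_linl.
- by move=> c u u' v; exact: Btr_linr.
- by move=> i j; exact: Ef_psi.
apply: eq_bigr => i _; apply: etrans (Btr_psi _ Ux) _; congr ('D_ _ _ _); apply/esym.
exact: (nabla2_tensor mG oU (@subset_refl _ U) Ux (smooth_on_Ef mG i) sX).
Qed.

Lemma S2_psi x : U x -> S2 G' phi' X' X' (psi x) = 'D_(S2 G phi X X x) psi x.
Proof.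
move=> Ux; have Ux' := psiU Ux; have d := dpsi Ux.
have dX := smooth_on_differentiable sX Ux.
have dX' := smooth_on_differentiable sX' Ux'.
rewrite /S2 derive_dir_sum//.
pose B u v := Rm G' (psi x) (X' (psi x) *m phi' (psi x)) (u *m Acov G' X' (psi x)) v.
transitivity (\sum_i B (Ef G' i (psi x)) (Ef G' i (psi x))).
  by apply: eq_bigr => i _; rewrite Acov_nabla.
rewrite -(onb_trace (e := fun i => 'D_(Ef G i x) psi x) _ _ Ux' _); last 3 first.
- by move=> c u u' v; rewrite /B mulmxDl -scalemxAl (Rm_lin2 mG').
- by move=> c u u' v; rewrite /B (Rm_lin3 mG').
- by move=> i j; exact: Ef_psi.
apply: eq_bigr => i _; rewrite /B (rX Ux) (phi_psi (X x) Ux) (Acov_psi (Ef G i x) Ux).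
by apply: etrans (Rm_psi _ _ _ Ux) _; rewrite Acov_nabla.
Qed.

Lemma Pm_psi x v w : U x ->
  bform (Pm G' phi' (psi x)) ('D_v psi x) ('D_w psi x) = bform (Pm G phi x) v w.
Proof. by move=> Ux; rewrite !PmE phi_psi// isoG. Qed.

Lemma dmap_density_psi x : U x ->
  \sum_i bform (Pm G' phi' (psi x)) (nabla G' (Ef G' i) X' (psi x)) (nabla G' (Ef G' i) X' (psi x))
  = \sum_i bform (Pm G phi x) (nabla G (Ef G i) X x) (nabla G (Ef G i) X x).
Proof.
move=> Ux; have Ux' := psiU Ux.
have dX := smooth_on_differentiable sX Ux.
have dX' := smooth_on_differentiable sX' Ux'.
pose B u v : R^o :=
  bform (Pm G' phi' (psi x)) (u *m Acov G' X' (psi x)) (v *m Acov G' X' (psi x)).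
transitivity (\sum_i B (Ef G' i (psi x)) (Ef G' i (psi x))).
  by apply: eq_bigr => i _; rewrite Acov_nabla.
rewrite -(onb_trace (e := fun i => 'D_(Ef G i x) psi x) _ _ Ux' _); last 3 first.
- by move=> c u u' v; rewrite /B mulmxDl -scalemxAl bformDl bformZl.
- by move=> c u u' v; rewrite /B mulmxDl -scalemxAl bformDr bformZr.
- by move=> i j; exact: Ef_psi.
by apply: eq_bigr => i _; rewrite /B Acov_psi// Pm_psi// Acov_nabla.
Qed.

Lemma tension_density_psi x : U x ->
  bform (G' (psi x)) (S2 G' phi' X' X' (psi x)) (S2 G' phi' X' X' (psi x))
  + bform (Pm G' phi' (psi x)) (Lap G' X' (psi x)) (Lap G' X' (psi x)) =
  bform (G x) (S2 G phi X X x) (S2 G phi X X x)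
  + bform (Pm G phi x) (Lap G X x) (Lap G X x).
Proof. by move=> Ux; rewrite S2_psi// Lap_psi// Pm_psi// isoG. Qed.

End RelatedFields.

End ChangeOfCoordinates.

(** * Bump functions and time-dependent fields *)

Section Plateau.
Variable R : realType.
Implicit Types (s t h : R) (k : nat).

Lemma derivable_flat0 (f : R -> R) (C : R) : f 0 = 0 ->
  (forall h, `|f h| <= C * h ^+ 2) -> is_derive (0 : R) (1 : R) f 0.
Proof.
move=> f0 fC.
have H : h^-1 *: (f (h *: 1 + 0) - f 0) @[h --> (0 : R)^'] --> (0 : R).
  apply: norm_cvg0; apply: (@squeeze_cvgr _ _ _ _ (fun=> 0 : R) (fun h : R => C * `|h|)).
  - near=> h; rewrite normr_ge0 /= f0 subr0 addr0 [_ *: 1]mulr1 normrZ normfV.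
    have h0 : 0 < `|h| by rewrite normr_gt0; near: h; exact: nbhs_dnbhs_neq.
    by rewrite ler_pdivrMl// mulrCA -expr2 real_normK ?num_real.
  - exact: cvg_cst.
  - rewrite -[X in _ --> X](mulr0 C); apply: cvgM; first exact: cvg_cst.
    apply: cvg_trans (cvg_app _ (@nbhs_dnbhs R 0)) _.
    by rewrite -[X in _ --> X](@normr0 R R); exact: norm_continuous.
apply: DeriveDef; first by apply/cvg_ex; exists 0.
exact: cvg_lim H.
Unshelve. all: end_near. Qed.

(* Derivatives of these functions are combinations of functions of the same kind. *)
Definition flat k s : R := if 0 < s then s^-1 ^+ k * expR (- s^-1) else 0.

(** With u = 1/h, raising 1 + x <= exp x at x = u/(k+2) to the power k+2 gives exp(-u) <=
    ((k+2)/u)^(k+2). The exponent k+2 leaves h^2 after multiplication by u^k, which makes the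
    derivative at the origin vanish. *)
Lemma flat_bound k h : `|flat k h| <= (k.+2%:R ^+ k.+2) * h ^+ 2.
Proof.
rewrite /flat; case: ifPn => [h0|_]; last first.
  by rewrite normr0; apply: mulr_ge0; [apply: exprn_ge0; exact: ler0n|exact: sqr_ge0].
have u0 : 0 < h^-1 by rewrite invr_gt0.
rewrite ger0_norm; last by rewrite mulr_ge0 ?exprn_ge0 ?expR_ge0 ?ltW.
set u := h^-1 in u0 *.
have m0 : 0 < k.+2%:R :> R by rewrite ltr0n.
have E : (u / k.+2%:R) ^+ k.+2 <= expR u.
  rewrite (_ : expR u = expR (u / k.+2%:R) ^+ k.+2); last first.
    by rewrite -expRM_natl mulrC divfK// gt_eqF.
  rewrite lerXn2r// ?nnegrE ?expR_ge0 ?divr_ge0 ?ltW//.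
  by rewrite (lt_le_trans _ (expR_ge1Dx _))// ltrDr.
have H : expR (- u) <= (k.+2%:R / u) ^+ k.+2.
  rewrite expRN -[X in _ <= X]invrK lef_pV2 ?posrE ?expR_gt0 ?invr_gt0 ?exprn_gt0 ?divr_gt0//.
  by rewrite -exprVn invf_div.
apply: le_trans (ler_wpM2l _ H) _; first by rewrite exprn_ge0 ?ltW.
have -> : h = u^-1 by rewrite /u invrK.
rewrite expr_div_n; move: (k.+2%:R ^+ k.+2) => N.
rewrite le_eqVlt; apply/orP; left; apply/eqP.
rewrite !exprVn -addn2 exprD; field.
by rewrite expf_neq0 gt_eqF.
Qed.

Lemma flat_derive k s : is_derive s (1 : R) (flat k) (- (k%:R * flat k.+1 s) + flat k.+2 s).
Proof.
have [s0|s0|->] := ltgtP s 0.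
- have E : \forall t \near s, cst 0 t = flat k t.
    near=> t; rewrite /flat ltNge (_ : t <= 0)//.
    by near: t; apply: filterS (lt_nbhsl s0) => t /ltW.
  rewrite /flat ltNge (ltW s0)/= mulr0 oppr0 addr0.
  apply: DeriveDef; last by rewrite -(near_eq_derive _ E) derive_cst.
  apply: diff_derivable; exact: near_eq_differentiable E (differentiable_cst _ _).
- have E : \forall t \near s, t^-1 ^+ k * expR (- t^-1) = flat k t.
    near=> t; rewrite /flat (_ : 0 < t)//.
    by near: t; exact: lt_nbhsr.
  have sn0 : s != 0 by rewrite gt_eqF.
  have D : is_derive s (1 : R) (fun t => t^-1 ^+ k * expR (- t^-1))
      (- (k%:R * flat k.+1 s) + flat k.+2 s).
    have d1 : is_derive s (1 : R) (fun t => t^-1) (- s ^- 2).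
      by apply: is_derive_eq; [exact: (is_deriveV (f := id) sn0)|rewrite [_ *: _]mulr1].
    have d2 := is_deriveX k d1.
    have d3 : is_derive s (1 : R) (fun t => - t^-1) (s ^- 2).
      by rewrite -[X in is_derive _ _ _ X]opprK; exact: (is_deriveN d1).
    have d4 := @is_derive1_comp _ expR (fun t => - t^-1) s _ _ (is_derive_expR (- s^-1)) d3.
    rewrite (_ : (fun t => _) = (fun t => t^-1) ^+ k * (expR \o (fun t => - t^-1))); last first.
      by apply/funext => t; rewrite !fctE.
    have d5 := is_deriveM d2 d4.
    apply: is_derive_eq.
    rewrite /flat s0 /= /GRing.scale/= !fctE.
    move: (expR _) => e; clear -sn0; case: k => [|k].
      by rewrite (mulr0n 1) !mul0r mulr0 addr0 oppr0 add0r expr0 mul1r exprVn mulrC.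
    rewrite !exprS !exprVn; field; rewrite ?expf_neq0 ?sn0 //.
  case: D => d1 d2; apply: DeriveDef; last by rewrite -(near_eq_derive _ E).
  apply: diff_derivable; apply: near_eq_differentiable E _; exact/derivable1_diffP.
- rewrite /flat ltxx mulr0 oppr0 addr0.
  by apply: derivable_flat0 (flat_bound k); rewrite /flat ltxx.
Unshelve. all: end_near. Qed.

Lemma smooth_flat k : smooth_on setT (flat k).
Proof.
apply/smooth_Ck => j; elim: j k => [|j IH] k.
  move=> l x; rewrite leqn0 size_eq0 => /eqP -> _ /=.
  by have [d _] := flat_derive k x; exact/derivable1_diffP.
apply/CkS; split=> [x _|v].
  by have [d _] := flat_derive k x; exact/derivable1_diffP.
apply: (@eq_Ck _ _ _ _ _ (fun s => v * (- (k%:R) * flat k.+1 s + flat k.+2 s))) => //.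
- exact: openT.
- move=> x _; have [d e] := flat_derive k x.
  by rewrite derive_real ?e ?mulNr//; exact/derivable1_diffP.
- by apply: CkM; [exact: openT|exact: Ck_cst|apply: CkD => //; [exact: openT|apply: CkM => //;
  [exact: openT|exact: Ck_cst]]].
Qed.

(** The standard smooth transition from 0 to 1. The denominator never vanishes, since [s] and
    [1 - s] are not both nonpositive. *)
Definition smooth_step s : R := flat 0 s / (flat 0 s + flat 0 (1 - s)).

Lemma flat0_gt0 s : 0 < s -> 0 < flat 0 s.
Proof. by move=> s0; rewrite /flat s0 expr0 mul1r expR_gt0. Qed.

Lemma flat0_ge0 s : 0 <= flat 0 s.
Proof. by have [/flat0_gt0/ltW//|s0] := ltP 0 s; rewrite /flat ltNge s0. Qed.

Lemma step_den_gt0 s : 0 < flat 0 s + flat 0 (1 - s).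
Proof.
have [s0|s0] := ltP 0 s; first by rewrite ltr_wpDr ?flat0_ge0 ?flat0_gt0.
by rewrite ltr_wpDl ?flat0_ge0 ?flat0_gt0// subr_gt0 (le_lt_trans s0).
Qed.

Lemma step_ge0 s : 0 <= smooth_step s.
Proof. by rewrite divr_ge0 ?flat0_ge0 ?ltW ?step_den_gt0. Qed.

Lemma step_le0 s : s <= 0 -> smooth_step s = 0.
Proof. by move=> s0; rewrite /smooth_step /flat ltNge s0 mul0r. Qed.

Lemma step_ge1 s : 1 <= s -> smooth_step s = 1.
Proof.
move=> s1; rewrite /smooth_step (_ : flat 0 (1 - s) = 0) ?addr0.
  by rewrite divff ?gt_eqF ?flat0_gt0// (lt_le_trans _ s1).
by rewrite /flat subr_gt0 ltNge s1.
Qed.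

Lemma smooth_on_step : smooth_on setT smooth_step.
Proof.
have oT := @openT R.
have s1 : smooth_on setT (fun s => flat 0 (1 - s)).
  apply: (@smooth_on_comp_real _ _ setT setT (fun s : R => 1 - s) (flat 0)) => //.
    by apply: smooth_onB => //; [exact: smooth_on_cst|exact: smooth_on_id].
  exact: smooth_flat.
apply: smooth_onM => //; first exact: smooth_flat.
apply: smooth_onV => //; first by move=> x _; rewrite gt_eqF ?step_den_gt0.
by apply: smooth_onD => //; exact: smooth_flat.
Qed.

Lemma plateau_exists n (c : 'rV[R]_n) r : 0 < r -> exists b : 'rV[R]_n -> R,
  [/\ smooth_on setT b, forall x, 0 <= b x, forall x, ball c (r / 2) x -> b x = 1 &
      forall x, ~ ball c r x -> b x = 0].
Proof.
(* At |x_i - c_i| = a r the value is 2 (1 - a^2): at least 1 for a <= 1/2 and at most 0 for a >= 1.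
   The square keeps it smooth where an absolute value would not, and a product over coordinates
   suffices because balls are cubes. *)
move=> r0; pose q (x : 'rV[R]_n) i : R := 2 * (1 - ((x 0 i - c 0 i) / r) ^+ 2).
have qn (x : 'rV[R]_n) i : ((x 0 i - c 0 i) / r) ^+ 2 = (`|c 0 i - x 0 i| / r) ^+ 2.
  by rewrite -real_normK ?num_real// normf_div distrC (gtr0_norm r0).
exists (fun x => \prod_i smooth_step (q x i)); split.
- apply: smooth_on_prod; first exact: openT.
  move=> i; apply: (@smooth_on_comp_real _ _ setT setT (fun x => q x i)) => //;
    [exact: openT| |exact: smooth_on_step].
  have oT := @openT 'rV[R]_n; apply: smooth_onM => //; first exact: smooth_on_cst.
  apply: smooth_onB => //; first exact: smooth_on_cst.
  have sl : smooth_on setT (fun x : 'rV[R]_n => (x 0 i - c 0 i) / r).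
    apply: smooth_onM => //; last exact: smooth_on_cst.
    apply: smooth_onB => //; last exact: smooth_on_cst.
    by apply: smooth_on_entry => //; exact: smooth_on_id.
  exact: smooth_onM.
- by move=> x; apply: prodr_ge0 => i _; exact: step_ge0.
- move=> x /row_ball H; apply: big1 => i _; apply: step_ge1; rewrite /q qn.
  have := H ltac:(by rewrite divr_gt0) i; move: `|_| (normr_ge0 (c 0 i - x 0 i)) => a a0 ar.
  have ar' : a / r <= 1 / 2 by rewrite ler_pdivrMr//; lra.
  have a0' : 0 <= a / r by rewrite divr_ge0// ltW.
  nra.
- move=> x Hx; have [i Hi] : exists i, r <= `|c 0 i - x 0 i|.
    apply: contrapT => H; apply: Hx; apply/(row_ball _ _ r0) => i.
    by rewrite ltNge; apply/negP => Hi; apply: H; exists i.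
  rewrite (bigD1 i)//= step_le0 ?mul0r// /q qn.
  have : 1 <= `|c 0 i - x 0 i| / r by rewrite ler_pdivlMr// mul1r.
  move: (_ / r) => a; nra.
Qed.

End Plateau.

Section Curves.
Variables (R : realType) (n m : nat).
Implicit Types (a b : R -> 'rV[R]_n) (t : R).

Lemma derive_lin (B : 'rV[R]_n -> 'rV[R]_m) a t :
  (forall c u v, B (c *: u + v) = c *: B u + B v) -> differentiable a t ->
  differentiable (fun s => B (a s)) t /\ 'D_1 (fun s => B (a s)) t = B ('D_1 a t).
Proof.
move=> lB da.
have E : (fun s => B (a s)) = (fun s => \sum_i a s 0 i *: B (delta_mx 0 i)).
  by apply/funext => s; rewrite (linear_delta _ lB).
have D i := derive_scale (1 : R) (differentiable_entry 0 i da)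
  (@differentiable_cst _ _ _ (B (delta_mx 0 i)) t).
have [d E2] := derive_bigsum (index_enum 'I_n) (1 : R) (fun i => (D i).1).
rewrite E; split; first exact: d.
rewrite E2 [RHS](linear_delta _ lB); apply: eq_bigr => i _.
by rewrite (D i).2 derive_cst scaler0 addr0 derive_entry.
Qed.

Lemma derive_bilin (B : 'rV[R]_n -> 'rV[R]_n -> 'rV[R]_m) a b t :
  (forall c u u' v, B (c *: u + u') v = c *: B u v + B u' v) ->
  (forall c u u' v, B v (c *: u + u') = c *: B v u + B v u') ->
  differentiable a t -> differentiable b t ->
  differentiable (fun s => B (a s) (b s)) t /\
  'D_1 (fun s => B (a s) (b s)) t = B ('D_1 a t) (b t) + B (a t) ('D_1 b t).
Proof.
move=> lB rB da db.
have E : (fun s => B (a s) (b s)) = (fun s => \sum_i a s 0 i *: B (delta_mx 0 i) (b s)).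
  by apply/funext => s; rewrite (@linear_delta _ _ _ (fun u => B u (b s))).
have L i := @derive_lin (B (delta_mx 0 i)) b t (fun c u v => rB c u v _) db.
have D i := derive_scale (1 : R) (differentiable_entry 0 i da) (L i).1.
have [d E2] := derive_bigsum (index_enum 'I_n) (1 : R) (fun i => (D i).1).
rewrite E; split; first exact: d.
rewrite E2 [X in X + _](@linear_delta _ _ _ (fun u => B u (b t)))//.
rewrite [X in _ + X](@linear_delta _ _ _ (fun u => B u ('D_1 b t)))// -big_split.
apply: eq_bigr => i _ /=.
by rewrite (D i).2 (L i).2 derive_entry.
Qed.

End Curves.

(** * Time-dependent vector fields in a chart and the derivative of the energy density *)

Section TimeDependent.
Variables (R : realType) (n : nat) (G phi : mfield R n) (U : set 'rV[R]_n).
Variables (W : set (R * 'rV[R]_n)).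
Hypothesis mG : metric_on U G.
Hypothesis sphi : smooth_on U phi.
Hypothesis phi_self : forall x v w, U x ->
  bform (G x) (v *m phi x) w = bform (G x) v (w *m phi x).
Hypothesis oW : open W.
Hypothesis WU : forall z, W z -> U z.2.
Local Notation rV := 'rV[R]_n.
Local Notation Z := (R * rV)%type.
Implicit Types (t : R) (x u v w : rV) (z : Z) (F H : Z -> rV) (e X : vfield R n).

Let oU : open U. Proof. by case: mG. Qed.

Definition slice (T : Type) (F : Z -> T) t : rV -> T := fun x => F (t, x).

Lemma derive_slice (T : normedModType R) (F : Z -> T) t x v :
  differentiable F (t, x) ->
  differentiable (slice F t) x /\ 'D_v (slice F t) x = 'D_((0 : R), v) F (t, x).
Proof.
move=> dF; pose i y : Z := (t, y).
have d1 : differentiable (fun=> t : R) x by exact: differentiable_cst.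
have d2 : differentiable (@id rV) x by [].
have di : differentiable i x by exact: (differentiable_pair d1 d2).
have Di : 'D_v i x = (0, v).
  have e1 : 'd (fun=> t : R) x v = 0 by rewrite -deriveE// derive_cst.
  have e2 : 'd (@id rV) x v = v by rewrite -deriveE// derive_id.
  by rewrite deriveE// (diff_pair d1 d2); congr (_, _).
split; first exact: (@differentiable_comp _ _ _ _ i F).
by have := @derive_comp _ _ _ _ i F x v di dF; rewrite Di.
Qed.

Definition dt (T : normedModType R) (F : Z -> T) z : T := 'D_((1 : R), (0 : rV)) F z.

Lemma derive_time (T : normedModType R) (F : Z -> T) t x :
  differentiable F (t, x) ->
  differentiable (fun s => F (s, x)) t /\
  'D_1 (fun s => F (s, x)) t = dt F (t, x).
Proof.
move=> dF; pose i (s : R) : Z := (s, x).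
have d1 : differentiable (fun=> x : rV) t by exact: differentiable_cst.
have d2 : differentiable (@id R) t by [].
have di : differentiable i t by exact: (differentiable_pair d2 d1).
have Di : 'D_1 i t = (1, 0).
  have e1 : 'd (fun=> x : rV) t 1 = 0 by rewrite -deriveE// derive_cst.
  have e2 : 'd (@id R) t 1 = 1 by rewrite -deriveE// derive_id.
  by rewrite deriveE// (diff_pair d2 d1); congr (_, _).
split; first exact: (@differentiable_comp _ _ _ _ i F).
by have := @derive_comp _ _ _ _ i F t 1 di dF; rewrite Di.
Qed.

(* Here [z = (t, x)], and [e] differentiates in the direction of [x] only. *)
Definition nablaP e F z : rV := 'D_((0 : R), e z.2) F z + Gam G z.2 (e z.2) (F z).

Lemma near_slice t x : W (t, x) -> \forall y \near x, W (t, y).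
Proof.
move=> Wz; have : nbhs (t, x) W by exact: open_nbhs_nbhs.
by case=> -[A B] /= [nA nB] AB; apply: filterS nB => y By; apply: AB; split=> //=;
  exact: nbhs_singleton.
Qed.

Lemma nabla_slice e F t x : smooth_on W F -> W (t, x) ->
  nabla G e (slice F t) x = slice (nablaP e F) t x.
Proof.
move=> sF Wz; have [_ E] := derive_slice (e x) (smooth_on_differentiable sF Wz).
by rewrite nablaE E.
Qed.

Lemma nabla_slice_slice e e' F t x : smooth_on W F -> smooth_on W (nablaP e F) -> W (t, x) ->
  nabla G e' (nabla G e (slice F t)) x = slice (nablaP e' (nablaP e F)) t x.
Proof.
move=> sF sN Wz; rewrite -(nabla_slice e' sN Wz); apply: nabla_near.
by apply: filterS (near_slice Wz) => y Wy; exact: nabla_slice.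
Qed.

Lemma smooth_on_base m k (A : rV -> 'M[R]_(m, k)) : smooth_on U A -> smooth_on W (fun z => A z.2).
Proof. by move=> sA; apply: (@smooth_on_comp _ _ _ _ _ W U snd A) => //; exact: smooth_on_snd. Qed.

Lemma derive_dir_prod (T : normedModType R) (F : Z -> T) z v : differentiable F z ->
  'D_((0 : R), v) F z = \sum_i v 0 i *: 'D_((0 : R), (delta_mx 0 i : rV)) F z.
Proof.
move=> dF; rewrite {1}(row_sum_delta v).
rewrite (_ : (_, _) = \sum_i (v 0 i *: ((0 : R), (delta_mx 0 i : rV)))); last first.
  elim: (index_enum _) => [|i r IH]; first by rewrite !big_nil.
  rewrite !big_cons -IH; congr (_, _); rewrite /= addr0.
  by rewrite scaler0.
by rewrite derive_dir_sum//; apply: eq_bigr => i _; rewrite derive_dirZ.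
Qed.

Lemma smooth_on_nablaP e F : smooth_on U e -> smooth_on W F -> smooth_on W (nablaP e F).
Proof.
move=> se sF; have seW := smooth_on_base se.
apply: smooth_onD => //; last first.
  by apply: (smooth_on_Gam (p := snd) mG) => //; exact: smooth_on_snd.
apply: (@eq_smooth_on _ _ _ _ (fun z => \sum_i e z.2 0 i *: 'D_((0 : R), (delta_mx 0 i : rV)) F
  z)) => //.
  by move=> z Wz; rewrite [RHS]derive_dir_prod//; exact: smooth_on_differentiable Wz.
apply: smooth_on_sum => // i _; apply: smooth_on_scale => //; last exact: smooth_on_derive.
exact: smooth_on_entry.
Qed.

Lemma smooth_on_dt (T : normedModType R) (F : Z -> T) : smooth_on W F -> smooth_on W (dt F).
Proof. exact: smooth_on_derive. Qed.

(** Time and space derivatives commute by [schwarz], and the Christoffel term is linear in the field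
    with coefficients independent of time. *)
Lemma dt_nablaP e F z : smooth_on U e -> smooth_on W F -> W z ->
  dt (nablaP e F) z = nablaP e (dt F) z.
Proof.
case: z => t x se sF Wz.
have dN := smooth_on_differentiable (smooth_on_nablaP se sF) Wz.
have [_ <-] := derive_time dN.
have dF := smooth_on_differentiable sF Wz.
have dDF := smooth_on_differentiable (smooth_on_derive ((0 : R), e x) sF) Wz.
have [d1 E1] := derive_time dDF; have [d2 E2] := derive_time dF.
have [d3 E3] := @derive_lin _ _ _ (Gam G x (e x)) _ t (fun c u v => Gam_linr _ _ c _ u v) d2.
suff H : 'D_1 (fun s => 'D_((0 : R), e x) F (s, x) + Gam G x (e x) (F (s, x))) t =
  'D_((0 : R), e x) (dt F) (t, x) + Gam G x (e x) (dt F (t, x)) by exact: H.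
rewrite deriveD; [|exact: diff_derivable|exact: diff_derivable].
have E4 : dt (fun z => 'D_((0 : R), e x) F z) (t, x) = 'D_((0 : R), e x) (dt F) (t, x).
  exact: (schwarz _ _ oW Wz sF).
by rewrite E1 E3 E2 E4.
Qed.

Definition LapP F z : rV :=
  - \sum_i (nablaP (Ef G i) (nablaP (Ef G i) F) z - nablaP (nabla G (Ef G i) (Ef G i)) F z).

Let sE i : smooth_on U (Ef G i). Proof. exact: (smooth_on_Ef mG). Qed.
Let sEE i : smooth_on U (nabla G (Ef G i) (Ef G i)).
Proof. exact: (smooth_on_nabla mG (sE i) (sE i)). Qed.

Lemma Lap_slice F t x : smooth_on W F -> W (t, x) -> Lap G (slice F t) x = LapP F (t, x).
Proof.
move=> sF Wz.
have E i : nabla G (Ef G i) (nabla G (Ef G i) (slice F t)) x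
    - nabla G (nabla G (Ef G i) (Ef G i)) (slice F t) x =
    nablaP (Ef G i) (nablaP (Ef G i) F) (t, x) - nablaP (nabla G (Ef G i) (Ef G i)) F (t, x).
  have E1 := nabla_slice_slice (Ef G i) sF (smooth_on_nablaP (sE i) sF) Wz.
  have E2 := nabla_slice (nabla G (Ef G i) (Ef G i)) sF Wz.
  by rewrite E1 E2.
by rewrite /Lap (eq_bigr _ (fun i _ => E i)).
Qed.

Lemma smooth_on_LapP F : smooth_on W F -> smooth_on W (LapP F).
Proof.
move=> sF; apply: smooth_onN => //; apply: smooth_on_sum => // i _.
have s1 := smooth_on_nablaP (sE i) sF.
apply: smooth_onB => //; [exact: (smooth_on_nablaP (sE i) s1)|exact: (smooth_on_nablaP (sEE i) sF)].
Qed.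

Lemma eq_nablaP e F H z : W z -> (forall y, W y -> F y = H y) -> nablaP e F z = nablaP e H z.
Proof.
move=> Wz FH; rewrite /nablaP (FH _ Wz).
suff -> : 'D_((0 : R), e z.2) F z = 'D_((0 : R), e z.2) H z by [].
apply: near_eq_derive.
by apply: filterS (open_nbhs_nbhs (conj oW Wz)) => y; exact: FH.
Qed.

Lemma dt_LapP F z : smooth_on W F -> W z -> dt (LapP F) z = LapP (dt F) z.
Proof.
move=> sF Wz; have s1 i := smooth_on_nablaP (sE i) sF.
have s2 i := smooth_on_nablaP (sE i) (s1 i).
have s3 i := smooth_on_nablaP (sEE i) sF.
have d i : differentiable (fun z => nablaP (Ef G i) (nablaP (Ef G i) F) z
    - nablaP (nabla G (Ef G i) (Ef G i)) F z) z.
  by apply: smooth_on_differentiable Wz; exact: smooth_onB.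
have [d' E] := derive_bigsum (index_enum 'I_n) ((1 : R), (0 : rV)) d.
suff H : - 'D_((1 : R), (0 : rV)) (fun z => \sum_i (nablaP (Ef G i) (nablaP (Ef G i) F) z
    - nablaP (nabla G (Ef G i) (Ef G i)) F z)) z = LapP (dt F) z.
  by apply: etrans H; apply: deriveN; exact: diff_derivable.
rewrite E /LapP; congr (- _); apply: eq_bigr => i _.
rewrite deriveB; last 2 first.
- apply: diff_derivable; exact: smooth_on_differentiable (s2 i) Wz.
- apply: diff_derivable; exact: smooth_on_differentiable (s3 i) Wz.
congr (_ - _); last exact: (dt_nablaP (sEE i) sF Wz).
apply: etrans (dt_nablaP (sE i) (s1 i) Wz) _; apply: eq_nablaP => // y Wy.
exact: (dt_nablaP (sE i) sF Wy).
Qed.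

Definition S2P F H z : rV :=
  \sum_i Rm G z.2 (F z *m phi z.2) (nablaP (Ef G i) H z) (Ef G i z.2).

Lemma S2_slice F H t x : smooth_on W H -> W (t, x) ->
  S2 G phi (slice F t) (slice H t) x = S2P F H (t, x).
Proof.
move=> sH Wz; rewrite /S2 /S2P; apply: eq_bigr => i _.
by rewrite (nabla_slice _ sH Wz).
Qed.

Lemma smooth_on_S2P F H : smooth_on W F -> smooth_on W H -> smooth_on W (S2P F H).
Proof.
move=> sF sH; apply: smooth_on_sum => // i _.
apply: (smooth_on_Rm mG (p := snd)) => //; first exact: smooth_on_snd.
- by apply: smooth_on_mul => //; exact: smooth_on_base.
- exact: smooth_on_nablaP.
- by apply: smooth_on_base; exact: sE.
Qed.

Lemma dt_S2P F H z : smooth_on W F -> smooth_on W H -> W z ->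
  dt (S2P F H) z = S2P (dt F) H z + S2P F (dt H) z.
Proof.
case: z => t x sF sH Wz; have Ux : U x := WU Wz.
have [_ <-] := derive_time (smooth_on_differentiable (smooth_on_S2P sF sH) Wz).
have [dF EF] := derive_time (smooth_on_differentiable sF Wz).
pose B i u v := Rm G x (u *m phi x) v (Ef G i x).
have sN i := smooth_on_nablaP (sE i) sH.
have dN i := derive_time (smooth_on_differentiable (sN i) Wz).
have Bl i c u u' v : B i (c *: u + u') v = c *: B i u v + B i u' v.
  by rewrite /B mulmxDl -scalemxAl (Rm_lin1 mG).
have Br i c u u' v : B i v (c *: u + u') = c *: B i v u + B i v u'.
  by rewrite /B (Rm_lin2 mG).
have D i := derive_bilin (Bl i) (Br i) dF (dN i).1.
have [_ E] := derive_bigsum (index_enum 'I_n) (1 : R) (fun i => (D i).1).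
apply: etrans E _.
rewrite /S2P -big_split; apply: eq_bigr => i _ /=.
have E1 := dt_nablaP (sE i) sH Wz.
by rewrite (D i).2 EF (dN i).2 E1.
Qed.

Definition energy_density (d1 d2 : R) X x : R :=
  d1 * (n%:R + \sum_i bform (Pm G phi x) (nabla G (Ef G i) X x) (nabla G (Ef G i) X x))
  + d2 * (bform (G x) (S2 G phi X X x) (S2 G phi X X x)
          + bform (Pm G phi x) (Lap G X x) (Lap G X x)).

Definition energy_densityP (d1 d2 : R) F z : R :=
  d1 * (n%:R + \sum_i bform (Pm G phi z.2) (nablaP (Ef G i) F z) (nablaP (Ef G i) F z))
  + d2 * (bform (G z.2) (S2P F F z) (S2P F F z)
          + bform (Pm G phi z.2) (LapP F z) (LapP F z)).

Lemma energy_density_slice d1 d2 F t x : smooth_on W F -> W (t, x) ->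
  energy_density d1 d2 (slice F t) x = energy_densityP d1 d2 F (t, x).
Proof.
move=> sF Wz; rewrite /energy_density (S2_slice _ sF Wz) (Lap_slice sF Wz).
have E i := nabla_slice (Ef G i) sF Wz.
by under eq_bigr => i _ do rewrite (E i).
Qed.

Lemma smooth_on_energy_densityP d1 d2 F : smooth_on W F ->
  smooth_on W (energy_densityP d1 d2 F).
Proof.
move=> sF; have sP := smooth_on_base (smooth_on_Pm mG sphi).
have sG : smooth_on W (fun z => G z.2) by apply: smooth_on_base; case: mG.
have sS := smooth_on_S2P sF sF; have sL := smooth_on_LapP sF.
apply: smooth_onD => //; apply: smooth_onM => //; try exact: smooth_on_cst.
  apply: smooth_onD => //; first exact: smooth_on_cst.
  apply: smooth_on_sum => // i _; have sN := smooth_on_nablaP (sE i) sF.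
  exact: smooth_on_bform.
by apply: smooth_onD => //; exact: smooth_on_bform.
Qed.

Lemma dt_bform (A : rV -> 'M[R]_n) F t x : smooth_on U A -> smooth_on W F -> W (t, x) ->
  (forall v w, bform (A x) v w = bform (A x) w v) ->
  dt (fun z => bform (A z.2) (F z) (F z)) (t, x) = 2 * bform (A x) (F (t, x)) (dt F (t, x)).
Proof.
move=> sA sF Wz symA.
have sB : smooth_on W (fun z => bform (A z.2) (F z) (F z)).
  by apply: smooth_on_bform => //; exact: smooth_on_base.
have [_ <-] := derive_time (smooth_on_differentiable sB Wz).
have [dF EF] := derive_time (smooth_on_differentiable sF Wz).
have dA : differentiable (fun=> A x) t by exact: differentiable_cst.
apply: etrans (derive_bform (1 : R) dA dF dF) _.
rewrite derive_cst EF (symA (dt F (t, x))) mulr_natl mulr2n.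
have -> : bform (0 : 'M[R]_n) (F (t, x)) (F (t, x)) = 0.
  by rewrite bformE big1// => i _; rewrite big1// => j _; rewrite mxE !mul0r.
by rewrite add0r.
Qed.

(** Only the field and the velocity at time [t] enter on the right, which is why arbitrary
    variations reduce to linear ones. *)
Lemma dt_energy_densityP d1 d2 F t x : smooth_on W F -> W (t, x) ->
  dt (energy_densityP d1 d2 F) (t, x) =
  variation_density G phi d1 d2 (slice F t) (slice (dt F) t) x.
Proof.
move=> sF Wz; have Ux : U x := WU Wz.
have sPU := smooth_on_Pm mG sphi; have sP := smooth_on_base sPU.
have sGU : smooth_on U G by case: mG.
have sG := smooth_on_base sGU.
have symP v w : bform (Pm G phi x) v w = bform (Pm G phi x) w v by exact: (Pm_sym mG phi_self).
have symG v w : bform (G x) v w = bform (G x) w v.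
  by apply: bform_sym; have [_ s _ _] := metric_on_at mG Ux.
have sS := smooth_on_S2P sF sF; have sL := smooth_on_LapP sF.
have sN i := smooth_on_nablaP (sE i) sF; have sd : smooth_on W (dt F) by exact: smooth_on_dt.
have bN i : smooth_on W (fun z => bform (Pm G phi z.2) (nablaP (Ef G i) F z) (nablaP (Ef G i) F z)).
  exact: smooth_on_bform.
have bS : smooth_on W (fun z => bform (G z.2) (S2P F F z) (S2P F F z)) by exact: smooth_on_bform.
have bL : smooth_on W (fun z => bform (Pm G phi z.2) (LapP F z) (LapP F z)) by exact:
  smooth_on_bform.
have dN i := smooth_on_differentiable (bN i) Wz.
have dS := smooth_on_differentiable bS Wz; have dL := smooth_on_differentiable bL Wz.
have [dN' EN] := derive_bigsum (index_enum 'I_n) ((1 : R), (0 : rV)) dN.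
have dc (c : R) : differentiable (fun=> c : R) (t, x) by exact: differentiable_cst.
have dA : differentiable (fun z : Z => n%:R + \sum_i bform (Pm G phi z.2) (nablaP (Ef G i) F z)
   (nablaP (Ef G i) F z)) (t, x) by exact: differentiableD.
have dB : differentiable (fun z : Z => bform (G z.2) (S2P F F z) (S2P F F z) +
   bform (Pm G phi z.2) (LapP F z) (LapP F z)) (t, x) by exact: differentiableD.
have scale (c : R) (f : Z -> R) : differentiable f (t, x) ->
    dt (fun z => c * f z) (t, x) = c * dt f (t, x).
  by move=> df; apply: deriveZ; exact: diff_derivable.
have add (f h : Z -> R) : differentiable f (t, x) -> differentiable h (t, x) ->
    dt (fun z => f z + h z) (t, x) = dt f (t, x) + dt h (t, x).
  by move=> df dh; apply: deriveD; exact: diff_derivable.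
apply: etrans (add _ _ (differentiableM (dc d1) dA) (differentiableM (dc d2) dB)) _.
rewrite (scale _ _ dA) (scale _ _ dB) (add _ _ (dc _) dN') (add _ _ dS dL).
have cE : dt (fun=> n%:R : R) (t, x) = 0 by exact: derive_cst.
rewrite cE {cE}.
have {}EN : dt (fun z => \sum_i bform (Pm G phi z.2) (nablaP (Ef G i) F z) (nablaP (Ef G i) F z))
  (t, x)
    = \sum_i dt (fun z => bform (Pm G phi z.2) (nablaP (Ef G i) F z) (nablaP (Ef G i) F z)) (t, x).
  exact: EN.
rewrite EN {EN}.
have EN' i : dt (fun z => bform (Pm G phi z.2) (nablaP (Ef G i) F z) (nablaP (Ef G i) F z)) (t, x)
    = 2 * bform (Pm G phi x) (nabla G (Ef G i) (slice F t) x) (nabla G (Ef G i) (slice (dt F) t) x).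
  have E1 := nabla_slice (Ef G i) sF Wz; have E2 := nabla_slice (Ef G i) sd Wz.
  have E3 := dt_nablaP (sE i) sF Wz.
  by rewrite (dt_bform sPU (sN i) Wz symP) E1 E2 E3.
rewrite (eq_bigr _ (fun i _ => EN' i)) -mulr_sumr.
rewrite (dt_bform sGU sS Wz symG) (dt_bform sPU sL Wz symP).
have E1 := Lap_slice sF Wz; have E2 := Lap_slice sd Wz; have E3 := dt_LapP sF Wz.
have E4 := S2_slice F sF Wz; have E5 := S2_slice (dt F) sF Wz.
have E6 := S2_slice F sd Wz; have E7 := dt_S2P sF sF Wz.
rewrite /variation_density E1 E2 E4 E5 E6 E7 E3.
by rewrite add0r !mulrA -mulrDr mulrA [d1 * 2]mulrC [d2 * 2]mulrC.
Qed.

End TimeDependent.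

Local Notation coord := Defs.coord.

(** * The energy on the manifold *)

Section Charts.
Variables (R : realType) (n : nat) (M : manifold R n).
Implicit Types (c d : chart M) (p : M) (x y v w : 'rV[R]_n) (O : set M) (A : set 'rV[R]_n).

Lemma img_coord c p : dom c p -> img c (coord c p).
Proof. by move=> cp; exists p. Qed.

Lemma dom_param c x : img c x -> dom c (param c x).
Proof. by case=> p cp <-; rewrite coordK. Qed.

Lemma paramK c x : img c x -> coord c (param c x) = x.
Proof. by case=> p cp <-; rewrite coordK. Qed.

Lemma open_img c : open (img c). Proof. exact: img_open. Qed.

Lemma near_param c x O : img c x -> open O -> O (param c x) -> \forall y \near x, O (param c y).
Proof.
move=> ix oO Ox; have cc := param_continuous (mem_set ix : x \in coord c @` dom c).
by have := cc O (open_nbhs_nbhs (conj oO Ox)).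
Qed.

Lemma near_coord c p A : dom c p -> open A -> A (coord c p) -> \forall q \near p, A (coord c q).
Proof.
move=> cp oA Ax; have cc := Defs.coord_continuous (mem_set cp : p \in dom c).
by have := cc A (open_nbhs_nbhs (conj oA Ax)).
Qed.

Lemma open_param_preimage c O : open O -> open [set x | img c x /\ O (param c x)].
Proof.
move=> oO; rewrite openE => x [ix Ox]; rewrite /interior.
have ni : nbhs (x : 'rV[R]_n) (img c) by apply: open_nbhs_nbhs; split=> //; exact: open_img.
by apply: filterS (filterI ni (near_param ix oO Ox)) => y [].
Qed.

Lemma open_coord_preimage c A : open A -> open [set p | dom c p /\ A (coord c p)].
Proof.
move=> oA; rewrite openE => p [cp Ap]; rewrite /interior.
have nd : nbhs (p : M) (dom c) by apply: open_nbhs_nbhs; split=> //; exact: dom_open.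
by apply: filterS (filterI nd (near_coord cp oA Ap)) => q [].
Qed.

Definition overlap c d : set 'rV[R]_n := coord c @` (dom c `&` dom d).

Lemma overlapE c d x : overlap c d x <-> img c x /\ dom d (param c x).
Proof.
split=> [[p [cp dp] <-]|[ix dx]]; first by rewrite coordK//; split=> //; exact: img_coord.
by exists (param c x); [split=> //; exact: dom_param|exact: paramK].
Qed.

Lemma open_overlap c d : open (overlap c d).
Proof.
rewrite (_ : overlap c d = [set x | img c x /\ dom d (param c x)]).
  by apply: open_param_preimage; exact: dom_open.
by apply/seteqP; split=> x /=; rewrite overlapE.
Qed.

Lemma overlap_img c d : overlap c d `<=` img c.
Proof. by move=> x /overlapE[]. Qed.

Definition trans c d : vfield R n := coord d \o param c.

Lemma transE c d p : dom c p -> trans c d (coord c p) = coord d p.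
Proof. by move=> cp; rewrite /trans /= coordK. Qed.

Lemma overlap_trans c d x : overlap c d x -> overlap d c (trans c d x).
Proof. by case=> p [cp dp] <-; rewrite transE//; exists p. Qed.

Lemma transK c d x : overlap c d x -> trans d c (trans c d x) = x.
Proof. by case=> p [cp dp] <-; rewrite !transE. Qed.

Lemma smooth_on_trans c d : smooth_on (overlap c d) (trans c d).
Proof. exact: transition_smooth. Qed.

Lemma overlap_coord c d p : dom c p -> dom d p -> overlap c d (coord c p).
Proof. by move=> cp dp; exists p. Qed.

Variables (phi : endo_field M) (g : riemannian_metric M).

Lemma metric_on_img c : metric_on (img c) (g c).
Proof.
split; [exact: open_img|exact: gcomp_smooth| |].
- by move=> x; exact: gcomp_sym.
- by move=> x v; exact: gcomp_pos.
Qed.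

Lemma metric_on_overlap c d : metric_on (overlap c d) (g c).
Proof. apply: (@metric_onS _ _ (img c)); last exact: metric_on_img.
  exact: open_overlap.
exact: overlap_img. Qed.

Lemma smooth_on_phi c : smooth_on (img c) (phi c).
Proof. exact: ecomp_smooth. Qed.

Lemma trans_iso c d x v w : overlap c d x ->
  bform (g d (trans c d x)) ('D_v (trans c d) x) ('D_w (trans c d) x) = bform (g c x) v w.
Proof. by case=> p [cp dp] <-; rewrite transE//; exact: gcomp_change. Qed.

Lemma trans_phi c d x v : overlap c d x ->
  'D_v (trans c d) x *m phi d (trans c d x) = 'D_(v *m phi c x) (trans c d) x.
Proof. by case=> p [cp dp] <-; rewrite transE//; exact: ecomp_change. Qed.

Lemma trans_field (X : vector_field M) c d : related (overlap c d) (trans c d) (X c) (X d).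
Proof. by move=> x [p [cp dp] <-]; rewrite transE//; exact: vcomp_change. Qed.

Hypothesis phi2 : forall c x, img c x -> phi c x *m phi c x = 1%:M.
Hypothesis phi_self : forall c x v w, img c x ->
  bform (g c x) (v *m phi c x) w = bform (g c x) v (w *m phi c x).
Hypothesis phi_par : forall c (X Y : vfield R n),
  smooth_on (img c) X -> smooth_on (img c) Y ->
  forall x, img c x -> nabla_endo (g c) (phi c) X Y x = 0.

(** The chart in [dxi_density] is chosen separately at each point. Naturality under transition maps
    lets any chart around [p] be used, so that the density is given by one smooth formula throughout
    a chart. *)
Lemma dxi_densityE (xi : vector_field M) c p : dom c p ->
  dxi_density phi g xi p = n%:R + \sum_i bform (Pm (g c) (phi c) (coord c p))
    (nabla (g c) (Ef (g c) i) (xi c) (coord c p)) (nabla (g c) (Ef (g c) i) (xi c) (coord c p)).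
Proof.
move=> cp; rewrite /dxi_density; set d := chart_at p;
  have dp : dom d p := projT2 (cid (dom_cover p)).
have ip := img_coord dp.
have E0 := dmap_density (phi d) (metric_on_img d) (@vcomp_smooth _ _ _ xi d) ip.
apply: etrans E0 _.
have sub c' d' : overlap c' d' `<=` img c' := @overlap_img c' d'.
have := @dmap_density_psi _ _ _ _ (trans c d) (trans d c) _ _ (phi c) (phi d)
  (metric_on_overlap c d) (metric_on_overlap d c) (@smooth_on_trans c d) (@smooth_on_trans d c)
  (@overlap_trans c d) (@transK c d) (@transK d c) (@trans_iso c d)
  (@trans_phi c d) (xi c) (xi d)
  (smooth_on_sub (sub _ _) (@vcomp_smooth _ _ _ xi c)) (smooth_on_sub (sub _ _) (@vcomp_smooth _
    _ _ xi d))
  (@trans_field xi c d) (coord c p) (overlap_coord cp dp).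
by rewrite transE// => ->.
Qed.

Lemma tau_densityE (xi : vector_field M) c p : dom c p ->
  tau_density phi g xi p =
  bform (g c (coord c p)) (S2 (g c) (phi c) (xi c) (xi c) (coord c p))
     (S2 (g c) (phi c) (xi c) (xi c) (coord c p))
  + bform (Pm (g c) (phi c) (coord c p)) (Lap (g c) (xi c) (coord c p))
     (Lap (g c) (xi c) (coord c p)).
Proof.
move=> cp; rewrite /tau_density; set d := chart_at p;
  have dp : dom d p := projT2 (cid (dom_cover p)).
have ip := img_coord dp.
have E0 := tension_density (metric_on_img d) (@smooth_on_phi d) (@phi_self d)
  (@phi_par d) (@phi2 d) (@vcomp_smooth _ _ _ xi d) ip.
apply: etrans E0 _.
have sub c' d' : overlap c' d' `<=` img c' := @overlap_img c' d'.
have := @tension_density_psi _ _ _ _ (trans c d) (trans d c) _ _ (phi c) (phi d)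
  (metric_on_overlap c d) (metric_on_overlap d c) (@smooth_on_trans c d) (@smooth_on_trans d c)
  (@overlap_trans c d) (@overlap_trans d c) (@transK c d) (@transK d c) (@trans_iso c d)
  (@trans_phi c d) (xi c) (xi d)
  (smooth_on_sub (sub _ _) (@vcomp_smooth _ _ _ xi c)) (smooth_on_sub (sub _ _) (@vcomp_smooth _
    _ _ xi d))
  (@trans_field xi c d) (coord c p) (overlap_coord cp dp).
by rewrite transE// => ->.
Qed.

Definition total_density (d1 d2 : R) (xi : vector_field M) p : R :=
  d1 * dxi_density phi g xi p + d2 * tau_density phi g xi p.

Lemma total_densityE (d1 d2 : R) (xi : vector_field M) c p : dom c p ->
  total_density d1 d2 xi p = energy_density (g c) (phi c) d1 d2 (xi c) (coord c p).
Proof. by move=> cp; rewrite /total_density (dxi_densityE _ cp) (tau_densityE _ cp). Qed.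

End Charts.

(** Compactness as an induction principle on sets, which hides finite subcovers. It serves for the
    finiteness of volumes and for covers by bump functions. *)
Lemma compact_ind (T : ptopologicalType) (P : set T -> Prop) (K : set T) :
  compact K -> P set0 -> (forall A B, P A -> P B -> P (A `|` B)) ->
  (forall A B, A `<=` B -> P B -> P A) ->
  (forall x, K x -> exists O, [/\ open O, O x & P O]) -> P K.
Proof.
move=> cK P0 PU PS PO.
have [f fP] : {f : T -> set T & forall x, K x -> [/\ open (f x), f x x & P (f x)]}.
  by apply: (@choice _ _ (fun x O => K x -> [/\ open O, O x & P O])) => x;
    have [Kx|Kx] := pselect (K x); [have [N HN] := PO x Kx; exists N|exists set0].
move: cK; rewrite compact_cover => /(_ T K f) [x Kx|x Kx|D' D'K KD'].
- by have [] := fP x Kx.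
- by exists x => //; have [] := fP x Kx.
apply: (PS _ _ KD').
have : forall s : seq T, (forall x, x \in s -> P (f x)) -> P (cover [set` s] f).
  elim=> [|x s IH] H; first by rewrite /cover set_nil bigcup_set0.
  apply: (PS _ (f x `|` cover [set` s] f)).
    by move=> y [z /=]; rewrite inE => /predU1P[->|zs] fy; [left|right; exists z].
  apply: PU; first by apply: H; rewrite mem_head.
  by apply: IH => y ys; apply: H; rewrite inE ys orbT.
move=> H; apply: H => x xD; have := D'K x xD; rewrite inE => Kx.
by have [] := fP x Kx.
Qed.

(** * The Riemannian volume in charts *)

Section Volume.
Variables (R : realType) (n : nat) (M : manifold R n) (g : riemannian_metric M).
Variable vg : borel_measure M.
Hypothesis hvg : riemannian_volume g vg.
Implicit Types (c : chart M) (p : M) (x : 'rV[R]_n).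
Local Notation rV := 'rV[R]_n.
Local Notation mu := (@lebesgue_row R n).
Local Notation bM := (g_sigma_algebraType (@open M)).
Local Notation bR := (g_sigma_algebraType (@open rV)).

Lemma measurable_dom c : measurable (dom c : set bM).
Proof. by apply: measurable_open; exact: dom_open. Qed.

Lemma measurable_img c : measurable (img c : set bR).
Proof. by apply: measurable_open; exact: open_img. Qed.

Lemma measurable_param c : measurable_fun (img c : set bR) (param c : bR -> bM).
Proof.
apply: (@measurability _ _ _ bM _ _ (@open M)) => //.
move=> _ [A oA <-]; apply: measurable_open; exact: open_param_preimage.
Qed.

Lemma vol_ge0 c x : 0 <= vol (g c) x. Proof. exact: sqrtr_ge0. Qed.

Lemma measurable_vol c : measurable_fun (img c : set bR) (vol (g c)).
Proof.
apply: (@measurable_continuous_on R rV) => [|x ix]; first exact: open_img.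
apply: differentiable_continuous.
exact: smooth_on_differentiable (smooth_on_vol (metric_on_img g c)) ix.
Qed.

(** [riemannian_volume] prescribes an iterated integral over the whole coordinate space;
    [lebesgue_rowE] turns it into an integral over [img c] against a measure, the form required by
    [ge0_integral_density]. *)
Lemma volumeE c (A : set bM) : measurable A -> A `<=` dom c ->
  vg A = (\int[mu]_(x in img c) ((\1_A (param c x))%:E * (vol (g c) x)%:E))%E.
Proof.
move=> mA Ac; rewrite (hvg mA Ac) integral_mkcond.
have mF : measurable_fun (img c : set bR) (fun x => (\1_A (param c x))%:E * (vol (g c) x)%:E)%E.
  apply: emeasurable_funM; apply/measurable_EFinP; last exact: measurable_vol.
  have m1 : measurable_fun setT (\1_A : bM -> R) by exact: measurable_indic.
  by have := measurableT_comp m1 (@measurable_param c); apply.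
rewrite lebesgue_rowE; last 2 first.
- by apply/(measurable_restrictT _ (measurable_img c)).
- move=> x; rewrite /patch; case: ifPn => // _.
  by rewrite mule_ge0// lee_fin// vol_ge0.
congr lebesgue_int; apply/funext => x; rewrite /patch; case: ifPn.
  rewrite inE => ix; rewrite EFinM; congr (_%:E * _)%E.
  rewrite !indicE; congr ((nat_of_bool _)%:R); apply/idP/idP; rewrite !inE.
    by case=> p Ap <-; rewrite coordK//; exact: Ac.
  by move=> Ap; exists (param c x) => //; exact: paramK.
rewrite notin_setE => ix; rewrite indicE memNset ?mul0r//.
by case=> p Ap px; apply: ix; rewrite -px; apply: img_coord; exact: Ac.
Qed.

(** The nonnegative case is applied to the positive and negative parts separately, so integrability
    is not assumed. *)
Lemma integral_chart c (f : bM -> R) : measurable_fun (dom c : set bM) f ->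
  (\int[vg]_(p in dom c) (f p)%:E =
   \int[mu]_(x in img c) (f (param c x) * vol (g c) x)%:E)%E.
Proof.
move=> mf.
have H (h : bM -> \bar R) : measurable_fun (dom c : set bM) h -> (forall p, dom c p -> (0 <= h
  p)%E) ->
    (\int[vg]_(p in dom c) h p = \int[mu]_(x in img c) (h (param c x) * (vol (g c) x)%:E))%E.
  apply: (@ge0_integral_density R _ _ bR bM vg mu (dom c) (img c) (param c) (vol (g c))).
  - exact: measurable_dom.
  - exact: measurable_img.
  - exact: measurable_param.
  - exact: measurable_vol.
  - by move=> x _; exact: vol_ge0.
  - by move=> A mA Ac; exact: volumeE.
  - by move=> x; exact: dom_param.
have mfE : measurable_fun (dom c : set bM) (EFin \o f) by exact/measurable_EFinP.
rewrite integralE [RHS]integralE; congr (_ - _)%E.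
- rewrite H//; last exact: measurable_funepos.
  by apply: eq_integral => x _; rewrite !funeposE /= -!EFin_max -EFinM maxr_pMl ?mul0r ?vol_ge0.
- rewrite H//; last exact: measurable_funeneg.
  apply: eq_integral => x _; rewrite !funenegE /= -!EFin_max -EFinM maxr_pMl ?vol_ge0//.
  by rewrite mul0r mulNr.
Qed.

Lemma Rintegral_chart c (f : bM -> R) : measurable_fun (dom c : set bM) f ->
  \int[vg]_(p in dom c) f p = chart_int (g c) (img c) (fun x => f (param c x)).
Proof. by move=> mf; rewrite /Rintegral integral_chart. Qed.

Lemma closed_ball_img c x : img c x -> exists2 r, 0 < r & closed_ball x r `<=` img c.
Proof.
move=> ix; have := open_nbhs_nbhs (conj (@open_img _ _ _ c) ix).
move=> /nbhs_ballP[r /= r0 Hr]; exists (r / 2); first by rewrite divr_gt0.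
apply: subset_trans Hr; apply: closed_ball_subset; rewrite ?divr_gt0//.
by rewrite ltr_pdivrMr// ltr_pMr// ltr1n.
Qed.

Lemma compact_closed_ball x (r : R) : 0 < r -> compact (closed_ball x r).
Proof.
move=> r0; apply: bounded_closed_compact; last exact: closed_ball_closed.
exists (`|x| + r); split; first exact: num_real.
move=> N rN y; rewrite closed_ballE// /closed_ball_/= => xy.
rewrite (le_trans _ (ltW rN))// -[y](subrK x) addrC (le_trans (ler_normD _ _))//.
by rewrite lerD2l distrC.
Qed.

(** A small coordinate ball has finite volume because the density [vol] is bounded on the closed
    ball; [compact_ind] does the rest. *)
Lemma compact_volume (K : set M) : compact K -> (vg K < +oo)%E.
Proof.
move=> cK; have clK : closed K by exact: (compact_closed (@mspace_hausdorff _ _ M)).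
have mK : measurable (K : set bM) by exact: measurable_closed.
pose P (A : set M) := exists2 O : set M, open O /\ A `<=` O & (vg O < +oo)%E.
suff [N [oN KN] Noo] : P K.
  apply: le_lt_trans Noo; apply: le_measure => //; rewrite inE//.
  exact: measurable_open.
apply: (compact_ind cK).
- by exists set0; [split; [exact: open0|]|rewrite measure0 ltry].
- move=> A B [N [oN AN] Noo] [N' [oN' BN'] Noo']; exists (N `|` N').
    by split; [exact: openU|exact: setUSS].
  apply: (@le_lt_trans _ _ (vg N + vg N')%E); last by rewrite lte_add_pinfty.
  by apply: measureU2; exact: measurable_open.
- by move=> A B AB [N [oN BN] Noo]; exists N => //; split=> //; exact: subset_trans BN.
move=> p _; have [c cp] := dom_cover p.
have [r r0 Hr] := closed_ball_img (img_coord cp).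
pose O := [set q | dom c q /\ ball (coord c p) r (coord c q)].
have oO : open O by apply: open_coord_preimage; exact: ball_open.
exists O; split=> //; first by split=> //; exact: ballxx.
exists O; first by split.
rewrite (@volumeE c) => [|//|q []//]; last exact: measurable_open.
pose D : set rV := ball (coord c p) r.
have DI : D `<=` img c by apply: subset_trans Hr; exact: subset_closed_ball.
have oD : open D by exact: ball_open.
have [C C0 HC] := @compact_ubound R rV _ (vol (g c)) (compact_closed_ball r0 (x := coord c p))
  (fun x Hx =>
  differentiable_continuous (smooth_on_differentiable (smooth_on_vol (metric_on_img g c)) (Hr x
    Hx))).
have : mu.-integrable (img c) (EFin \o (fun x => \1_D x * vol (g c) x)).
  apply: (@integrable_dominated _ _ mu (img c) D _ C).
  - exact: measurable_img.
  - exact: measurable_open.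
  - by rewrite lebesgue_row_ball// ltry.
  - apply: measurable_funM; last exact: measurable_vol.
    by apply: measurable_funTS; apply: measurable_indic; exact: measurable_open.
  - move=> x ix; rewrite indicE; case: (boolP (x \in D)) => [|_];
    last by rewrite mul0r normr0 mulr0.
    rewrite inE => Dx; rewrite mul1r mulr1; apply: HC; exact: subset_closed_ball Dx.
move=> /integrableP[_]; apply: le_lt_trans; rewrite le_eqVlt; apply/orP; left; apply/eqP.
apply: eq_integral => x; rewrite inE => ix /=.
rewrite -EFinM; congr (_%:E); rewrite ger0_norm ?mulr_ge0 ?vol_ge0//; congr (_ * _).
rewrite !indicE; congr ((nat_of_bool _)%:R); apply/idP/idP; rewrite !inE /O /=.
  by case=> _; rewrite paramK.
by move=> Dx; rewrite paramK//; split=> //; exact: dom_param.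
Qed.

End Volume.

(** * Vector fields and functions on the manifold built from local data *)

Section Fields.
Variables (R : realType) (n : nat) (M : manifold R n).
Local Notation rV := 'rV[R]_n.
Implicit Types (c d e : chart M) (p : M) (x y v w : rV) (X V : vector_field M) (f : M -> R).

Lemma trans_differentiable c d p : dom c p -> dom d p ->
  differentiable (trans c d) (coord c p).
Proof. by move=> cp dp;
  exact: smooth_on_differentiable (@smooth_on_trans _ _ _ c d) (overlap_coord cp dp). Qed.

Lemma tchangeD c d p v w : dom c p -> dom d p ->
  tchange c d p (v + w) = tchange c d p v + tchange c d p w.
Proof. by move=> cp dp; apply: derive_dirD; exact: trans_differentiable. Qed.

Lemma tchangeZ c d p (a : R) v : dom c p -> dom d p ->
  tchange c d p (a *: v) = a *: tchange c d p v.
Proof. by move=> cp dp; apply: derive_dirZ; exact: trans_differentiable. Qed.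

Lemma tchange0 c d p : tchange c d p 0 = 0.
Proof. exact: derive0. Qed.

Lemma tchange_id c p v : dom c p -> tchange c c p v = v.
Proof.
move=> cp; apply: etrans (derive_id (coord c p) v); apply: near_eq_derive.
apply: filterS (open_nbhs_nbhs (conj (@open_img _ _ _ c) (img_coord cp))) => y iy.
exact: paramK.
Qed.

Lemma tchange_comp c d e p v : dom c p -> dom d p -> dom e p ->
  tchange d e p (tchange c d p v) = tchange c e p v.
Proof.
move=> cp dp ep; have d1 := trans_differentiable cp dp; have d2 := trans_differentiable dp ep.
have E : trans c d (coord c p) = coord d p by rewrite transE.
rewrite /tchange -E; rewrite -E in d2; apply: etrans (esym (derive_comp v d1 d2)) _.
apply: near_eq_derive.
have oc := overlap_coord cp dp.
apply: filterS (open_nbhs_nbhs (conj (@open_overlap _ _ _ c d) oc)) => y [q [cq dq] <-] /=.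
by rewrite !(transE, coordK).
Qed.

Definition smooth_fun f := forall c, smooth_on (img c) (fun x => f (param c x)).

Lemma field_scale f X : smooth_fun f ->
  {V : vector_field M | forall c x, V c x = f (param c x) *: X c x}.
Proof.
move=> sf.
have s c : smooth_on (img c) (fun x => f (param c x) *: X c x).
  by apply: smooth_on_scale => //; [exact: open_img|exact: vcomp_smooth].
have ch c d p : dom c p -> dom d p -> f (param d (coord d p)) *: X d (coord d p) =
    tchange c d p (f (param c (coord c p)) *: X c (coord c p)).
  by move=> cp dp; rewrite !coordK// tchangeZ// (vcomp_change X cp dp).
by exists (VectorField s ch).
Qed.

Lemma field_add (t : R) X X' : {V : vector_field M | forall c x, V c x = X c x + t *: X' c x}.
Proof.
have s c : smooth_on (img c) (fun x => X c x + t *: X' c x).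
  apply: smooth_onD; [exact: open_img|exact: vcomp_smooth|].
  by apply: smooth_on_scale; [exact: open_img|exact: smooth_on_cst|exact: vcomp_smooth].
have ch c d p : dom c p -> dom d p -> X d (coord d p) + t *: X' d (coord d p) =
    tchange c d p (X c (coord c p) + t *: X' c (coord c p)).
  by move=> cp dp; rewrite tchangeD// tchangeZ// (vcomp_change X cp dp) (vcomp_change X' cp dp).
by exists (VectorField s ch).
Qed.

Section Extension.
Variables (c : chart M) (K : set rV).
Hypotheses (cK : compact K) (Kc : K `<=` img c).

Definition param_set : set M := param c @` K.

Lemma param_set_compact : compact param_set.
Proof.
apply: continuous_compact => //; apply: continuous_in_subspaceT => x.
by rewrite inE => Kx; apply: param_continuous; rewrite inE; exact: Kc.
Qed.

Lemma param_set_closed : closed param_set.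
Proof. exact: (compact_closed (@mspace_hausdorff _ _ M)) param_set_compact. Qed.

Lemma param_set_dom : param_set `<=` dom c.
Proof. by move=> _ [x Kx <-]; apply: dom_param; exact: Kc. Qed.

Let off d : set rV := [set y | img d y /\ (~` param_set) (param d y)].

Let open_off d : open (off d).
Proof. by apply: open_param_preimage; apply: closed_openC; exact: param_set_closed. Qed.

Let img_cover d : img d `<=` overlap d c `|` off d.
Proof.
move=> y iy; have [Ky|Ky] := pselect (param_set (param d y)); last by right.
by left; apply/overlapE; split=> //; exact: param_set_dom.
Qed.

(** Each chart image is covered by two open sets: the overlap with [c], where [F] is the given
    expression, and the complement of the support, which is open because [param_set] is compact in a
    Hausdorff space. Values with one row serve both vector fields and, as 1 x 1 matrices,
    functions. *)
Lemma extend_smooth k (F : forall d, rV -> 'M[R]_(1, k)) (H : forall d, rV -> 'M[R]_(1, k)) d :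
  smooth_on (overlap d c) (H d) ->
  (forall y, overlap d c y -> F d y = H d y) ->
  (forall y, off d y -> F d y = 0) -> smooth_on (img d) (F d).
Proof.
move=> sH FH F0; apply: smooth_on_sub (@img_cover d) _; apply: smooth_onU.
  apply: (@eq_smooth_on _ _ _ _ (H d)) => //; first exact: open_overlap.
  by move=> y /FH.
apply: (@eq_smooth_on _ _ _ _ (fun=> 0)) => //; last exact: smooth_on_cst.
by move=> y /F0.
Qed.

Lemma field_extend (X : vfield R n) : smooth_on (img c) X ->
  (forall x, img c x -> ~ K x -> X x = 0) ->
  {V : vector_field M | (forall x, img c x -> V c x = X x) /\
       (forall d p, dom d p -> ~ param_set p -> V d (coord d p) = 0)}.
Proof.
move=> sX X0.
pose F d y : rV := if `[< dom c (param d y) >] then push (trans c d) (trans d c) X y else 0.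
have FE d p : dom d p -> dom c p -> F d (coord d p) = tchange c d p (X (coord c p)).
  by move=> dp cp; rewrite /F coordK// asboolT// /push transE.
have F0 d y : off d y -> F d y = 0.
  rewrite /F => -[iy Ky]; case: asboolP => // cy.
  rewrite /push X0 ?derive0//; first by rewrite /trans /=; exact: img_coord.
  by move=> Kt; apply: Ky; exists (trans d c y) => //; rewrite /trans /= coordK.
have s d : smooth_on (img d) (F d).
  apply: (@extend_smooth _ F (fun d => push (trans c d) (trans d c) X)) => //.
  - apply: (@smooth_on_comp _ _ _ _ _ (overlap d c) (overlap c d) (trans d c)
      (fun x => 'D_(X x) (trans c d) x)).
    + exact: open_overlap.
    + exact: open_overlap.
    + by move=> x; exact: overlap_trans.
    + exact: smooth_on_trans.
    + apply: smooth_on_dir_row; [exact: open_overlap|exact: smooth_on_trans|].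
      by apply: smooth_on_sub sX; exact: overlap_img.
  - by move=> y /overlapE[iy cy]; rewrite /F asboolT.
  - by move=> y; exact: F0.
have ch d e p : dom d p -> dom e p -> F e (coord e p) = tchange d e p (F d (coord d p)).
  move=> dp ep; have [cp|ncp] := pselect (dom c p).
    by rewrite !FE// tchange_comp.
  by rewrite /F !coordK// asboolF// tchange0.
exists (VectorField s ch); split=> /= [x ix|d p dp Kp].
  by have := FE c (param c x) (dom_param ix) (dom_param ix); rewrite paramK// tchange_id//;
    exact: dom_param.
by apply: F0; split; [exact: img_coord|rewrite /setC /= coordK].
Qed.

Lemma function_extend (b : rV -> R) : smooth_on setT b -> (forall x, ~ K x -> b x = 0) ->
  {f : M -> R | [/\ smooth_fun f, forall p, dom c p -> f p = b (coord c p) &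
     forall p, ~ param_set p -> f p = 0]}.
Proof.
move=> sb b0.
pose f p := if `[< dom c p >] then b (coord c p) else 0.
have f0 p : ~ param_set p -> f p = 0.
  move=> Kp; rewrite /f; case: asboolP => // cp; apply: b0 => Kx; apply: Kp.
  by exists (coord c p) => //; exact: coordK.
exists f; split=> // [d|p cp]; last by rewrite /f asboolT.
pose F d y : 'M[R]_(1, 1) := (f (param d y))%:M.
have sF : smooth_on (img d) (F d).
  apply: (@extend_smooth _ F (fun d y => (b (trans d c y))%:M)).
  - apply: smooth_on_mx => [|i j]; first exact: open_overlap.
    rewrite !ord1; under eq_fun do rewrite mxE mulr1n.
    apply: (@smooth_on_comp_scalar _ _ _ _ setT) => //;
      [exact: open_overlap|exact: smooth_on_trans].
  - by move=> y /overlapE[iy cy]; rewrite /F /f asboolT.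
  - by move=> y [iy Ky]; rewrite /F f0//; exact: raddf0.
have := smooth_on_entry 0 0 (@open_img _ _ _ d) sF.
by under eq_fun do rewrite mxE mulr1n.
Qed.

End Extension.

End Fields.

(** * Differentiation of the energy along a family of vector fields *)

Section Family.
Variables (R : realType) (n : nat) (M : manifold R n).
Variables (phi : endo_field M) (g : riemannian_metric M) (vg : borel_measure M).
Local Notation rV := 'rV[R]_n.
Local Notation Z := (R * rV)%type.
Local Notation bM := (g_sigma_algebraType (@open M)).
Implicit Types (c : chart M) (p : M) (x y v w : rV) (X V xi : vector_field M) (s t : R).

Hypothesis phi2 : forall c x, img c x -> phi c x *m phi c x = 1%:M.
Hypothesis phi_self : forall c x v w, img c x ->
  bform (g c x) (v *m phi c x) w = bform (g c x) v (w *m phi c x).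
Hypothesis phi_par : forall c (X Y : vfield R n),
  smooth_on (img c) X -> smooth_on (img c) Y ->
  forall x, img c x -> nabla_endo (g c) (phi c) X Y x = 0.
Hypothesis hvg : riemannian_volume g vg.

Definition time_chart (eps : R) c : set Z := [set z | `|z.1| < eps /\ img c z.2].

Lemma open_time_chart eps c : open (time_chart eps c).
Proof.
rewrite openE => -[t x] [/= te ix].
have nt : nbhs (t : R) (ball (0 : R) eps).
  by apply: open_nbhs_nbhs; split; [exact: ball_open|rewrite -ball_normE /ball_/= sub0r normrN].
have nx : nbhs (x : rV) (img c) by apply: open_nbhs_nbhs; split=> //; exact: open_img.
exists (ball (0 : R) eps, img c) => // -[s y] [/= ]; rewrite -ball_normE /ball_/= sub0r normrN.
by move=> se iy; split.
Qed.

Lemma time_chart_img eps c z : time_chart eps c z -> img c z.2. Proof. by case. Qed.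

Lemma continuous_time_chart eps (T : topologicalType) (k : R * M -> T) c (E : Z -> T) t p :
  `|t| < eps -> dom c p -> {for (t, coord c p), continuous E} ->
  (forall s q, `|s| < eps -> dom c q -> k (s, q) = E (s, coord c q)) ->
  {for (t, p), continuous k}.
Proof.
move=> te cp cE kE A; rewrite /= kE// => nA.
have [[B1 B2] /= [nB1 nB2] BE] := cE A nA.
have nt : nbhs (t : R) (ball (0 : R) eps).
  by apply: open_nbhs_nbhs; split; [exact: ball_open|rewrite -ball_normE /ball_/= sub0r normrN].
have nd : nbhs (p : M) (dom c) by apply: open_nbhs_nbhs; split=> //; exact: dom_open.
have nc : \forall q \near p, B2 (coord c q).
  exact: (Defs.coord_continuous (mem_set cp : p \in dom c)).
exists (B1 `&` ball (0 : R) eps, [set q | B2 (coord c q)] `&` dom c).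
  by split; exact: filterI.
move=> [s q] [/= [Bs]]; rewrite -ball_normE /ball_/= sub0r normrN => se [Bq cq].
by rewrite /= kE//; apply: (BE (s, coord c q)); split.
Qed.

Variables (eps : R) (xit : R -> vector_field M).
Hypothesis eps0 : 0 < eps.
Hypothesis fam : forall c, smooth_on (time_chart eps c) (fun z => xit z.1 c z.2).
Variables d1 d2 : R.

Local Notation F c := (fun z : Z => xit z.1 c z.2).
Local Notation q := (total_density phi g).

Lemma family_density a b c t p : `|t| < eps -> dom c p ->
  q a b (xit t) p = energy_densityP (g c) (phi c) a b (F c) (t, coord c p).
Proof.
move=> te cp; rewrite (total_densityE phi2 phi_self phi_par a b _ cp).
have ip := img_coord cp.
exact: (energy_density_slice (phi c) (metric_on_img g c) (@open_time_chart eps c)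
  (@time_chart_img eps c) a b (@fam c) (conj te ip)).
Qed.

Lemma smooth_family_density a b c :
  smooth_on (time_chart eps c) (energy_densityP (g c) (phi c) a b (F c)).
Proof.
exact: (smooth_on_energy_densityP (metric_on_img g c) (@smooth_on_phi _ _ _ phi c)
  (@open_time_chart eps c) (@time_chart_img eps c)).
Qed.

Lemma near_time t : `|t| < eps -> \forall s \near t, `|s| < eps.
Proof.
move=> te; have : nbhs (t : R) (ball (0 : R) eps).
  by apply: open_nbhs_nbhs; split; [exact: ball_open|rewrite -ball_normE /ball_/= sub0r normrN].
by apply: filterS => s; rewrite -ball_normE /ball_/= sub0r normrN.
Qed.

Lemma family_derive c t p : `|t| < eps -> dom c p ->
  derivable (fun s => q d1 d2 (xit s) p) t 1 /\
  'D_1 (fun s => q d1 d2 (xit s) p) t =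
  dt (energy_densityP (g c) (phi c) d1 d2 (F c)) (t, coord c p).
Proof.
move=> te cp; have Wz : time_chart eps c (t, coord c p) by split=> //; exact: img_coord.
have dE := smooth_on_differentiable (@smooth_family_density d1 d2 c) Wz.
have [dl El] := derive_time dE.
have ne : \forall s \near t, energy_densityP (g c) (phi c) d1 d2 (F c) (s, coord c p) =
    q d1 d2 (xit s) p.
  by apply: filterS (near_time te) => s se; rewrite (family_density d1 d2 se cp).
split; last by rewrite -El; apply/esym; exact: near_eq_derive.
by apply: diff_derivable; exact: near_eq_differentiable ne dl.
Qed.

Lemma continuous_density a b t p : `|t| < eps ->
  {for (t, p), continuous (fun z : R * M => q a b (xit z.1) z.2)}.
Proof.
move=> te; have [c cp] := dom_cover p.
apply: (continuous_time_chart te cp) => [|s r se cr]; last exact: family_density.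
apply: differentiable_continuous.
have Wz : time_chart eps c (t, coord c p) by split=> //; exact: img_coord.
exact: (smooth_on_differentiable (@smooth_family_density a b c) Wz).
Qed.

Lemma continuous_density_derive t p : `|t| < eps ->
  {for (t, p), continuous (fun z : R * M => 'D_1 (fun s => q d1 d2 (xit s) z.2) z.1)}.
Proof.
move=> te; have [c cp] := dom_cover p.
apply: (@continuous_time_chart eps _ _ c (dt (energy_densityP (g c) (phi c) d1 d2 (F c)))) => //.
  apply: differentiable_continuous.
  have := @smooth_on_dt _ _ _ _ _ (@smooth_family_density d1 d2 c).
  by move=> /smooth_on_differentiable; apply; split=> //; exact: img_coord.
by move=> s r se cr; have [_ ->] := family_derive se cr.
Qed.

Lemma continuous_slice (T : topologicalType) (k : R * M -> T) t p :
  {for (t, p), continuous k} -> {for p, continuous (fun r => k (t, r))}.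
Proof.
move=> ck A nA; have [[B1 B2] /= [nB1 nB2] BE] := ck A nA.
by apply: filterS nB2 => r Br; apply: (BE (t, r)); split=> //=; exact: nbhs_singleton.
Qed.

Variable D : set M.
Hypotheses (oD : open D) (cD : compact (closure D)).

Lemma integrable_continuous (f : M -> R) : (forall p, {for p, continuous f}) ->
  vg.-integrable D (EFin \o f).
Proof.
move=> cf; have [C C0 HC] := compact_ubound cD (fun p _ => cf p).
apply: (@integrable_dominated _ _ vg D (closure D) f C).
- exact: measurable_open.
- by apply: measurable_closed; exact: closed_closure.
- exact: (compact_volume hvg).
- by apply: (@measurable_continuous_on R M) => // p _.
- by move=> p Dp; rewrite indicE mem_set ?mulr1; [apply: HC|]; exact: subset_closure.
Qed.

Lemma integrable_density a b t : `|t| < eps ->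
  vg.-integrable D (EFin \o q a b (xit t)).
Proof.
move=> te; apply: integrable_continuous => p.
have H := continuous_slice (@continuous_density a b t p te).
by move=> A nA; exact: (H A nA).
Qed.

(** The two integrals of the energy may be merged because each density is integrable, being
    continuous on the compact closure of [D]. Each is a total density with coefficients 1, 0 or 0,
    1, so continuity need not be proved again. *)
Lemma sesqui_energyE t : `|t| < eps ->
  sesqui_energy phi g vg d1 d2 D (xit t) = \int[vg]_(p in D) q d1 d2 (xit t) p.
Proof.
move=> te.
have mD : measurable (D : set bM) by exact: measurable_open.
have q1 : (fun p => dxi_density phi g (xit t) p) = q 1 0 (xit t).
  by apply/funext => p; rewrite /total_density mul1r mul0r addr0.
have q2 : (fun p => tau_density phi g (xit t) p) = q 0 1 (xit t).
  by apply/funext => p; rewrite /total_density mul1r mul0r add0r.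
have i1 : vg.-integrable D (EFin \o (fun p => dxi_density phi g (xit t) p)).
  by rewrite q1; exact: integrable_density.
have i2 : vg.-integrable D (EFin \o (fun p => tau_density phi g (xit t) p)).
  by rewrite q2; exact: integrable_density.
rewrite /sesqui_energy -!RintegralZl// -RintegralD//.
  by have := integrableZl mD d1 i1.
by have := integrableZl mD d2 i2.
Qed.

(** The time derivative of the density is continuous in time and space, hence bounded on a compact
    box. The bound times the indicator of the closure of [D] dominates, and the derivative passes
    under the integral. *)
Lemma derive_energy :
  is_derive (0 : R) (1 : R) (fun t => sesqui_energy phi g vg d1 d2 D (xit t))
    (\int[vg]_(p in D) 'D_1 (fun s => q d1 d2 (xit s) p) 0).
Proof.
have mD : measurable (D : set bM) by exact: measurable_open.
have e2 : 0 < eps / 2 by rewrite divr_gt0.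
have e2e : eps / 2 < eps by rewrite ltr_pdivrMr// ltr_pMr// ltr1n.
(* Half of [eps] gives a closed time interval inside the domain of the family. *)
pose B : set (R * M) := `[- (eps / 2), eps / 2]%classic `*` closure D.
have cB : compact B by apply: compact_setX => //; exact: segment_compact.
have Beps t p : B (t, p) -> `|t| < eps.
  by case=> /=; rewrite in_itv/= -ler_norml => te _; exact: le_lt_trans e2e.
have cB' (z : R * M) : B z ->
    {for z, continuous (fun z : R * M => 'D_1 (fun s => q d1 d2 (xit s) z.2) z.1)}.
  by case: z => t p /Beps te; exact: continuous_density_derive.
have [C C0 HC] := compact_ubound cB cB'.
pose f t p := q d1 d2 (xit t) p.
pose h p := C * \1_(closure D) p.
have I0 : (`](- (eps / 2)), (eps / 2)[%classic : set R) 0.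
  by rewrite /= in_itv/= e2 oppr_lt0 e2.
have Ie t : (`](- (eps / 2)), (eps / 2)[%classic : set R) t -> `|t| < eps.
  by rewrite /= in_itv/= -ltr_norml => te; exact: lt_trans e2e.
have intf t : (`](- (eps / 2)), (eps / 2)[%classic : set R) t -> vg.-integrable D (EFin \o f t).
  by move=> /Ie te; exact: integrable_density.
have derf t p : (`](- (eps / 2)), (eps / 2)[%classic : set R) t -> D p -> derivable (f ^~ p) t 1.
  by move=> /Ie te _; have [c cp] := dom_cover p; have [] := family_derive te cp.
have h0 p : 0 <= h p by rewrite mulr_ge0.
have mclD : measurable (closure D : set bM) by apply: measurable_closed; exact: closed_closure.
have inth : vg.-integrable D (EFin \o h).
  apply: (@integrable_dominated _ _ vg D (closure D) h C) => //.
  - exact: (compact_volume hvg).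
  - by apply: measurable_funM => //; apply: measurable_funTS; exact: measurable_indic.
  - by move=> p _; rewrite ger0_norm.
have fh t p : (`](- (eps / 2)), (eps / 2)[%classic : set R) t -> D p -> `|partial1of2 f t p| <= h p.
  rewrite /= in_itv/= => /andP[t1 t2] Dp; rewrite partial1of2E /h indicE mem_set ?mulr1; last first.
    exact: subset_closure.
  apply: (HC (t, p)); split; last exact: subset_closure.
  by rewrite /= in_itv/= !ltW.
have dF := @derivable_under_integral _ _ _ vg f D mD 0 _ _ I0 intf derf h h0 inth fh.
have EF := @differentiation_under_integral _ _ _ vg f D mD 0 _ _ I0 intf derf h h0 inth fh.
have ne : \forall t \near 0, \int[vg]_(p in D) f t p = sesqui_energy phi g vg d1 d2 D (xit t).
  by apply: filterS (near_time (t := 0) _) => [t te|]; [rewrite sesqui_energyE|rewrite normr0].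
apply: DeriveDef.
  apply: diff_derivable; apply: near_eq_differentiable ne _; exact/derivable1_diffP.
rewrite -(near_eq_derive _ ne) -derive1E EF.
by apply: eq_Rintegral => p _; rewrite partial1of2E.
Qed.

End Family.

Section VariationLinear.
Variables (R : realType) (n : nat) (G phi : mfield R n) (U : set 'rV[R]_n).
Hypothesis mG : metric_on U G.
Implicit Types (x : 'rV[R]_n) (X Y V e : vfield R n) (a b c : R).

Lemma nabla_linr e V Y a x : differentiable V x -> differentiable Y x ->
  nabla G e (fun y => a *: V y + Y y) x = a *: nabla G e V x + nabla G e Y x.
Proof.
move=> dV dY; have da : differentiable (fun=> a) x by exact: differentiable_cst.
have [dZ E] := derive_scale (e x) da dV.
rewrite !nablaE Gam_linr.
have -> : 'D_(e x) (fun y => a *: V y + Y y) x = a *: 'D_(e x) V x + 'D_(e x) Y x.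
  apply: etrans (deriveD (diff_derivable dZ) (diff_derivable dY)) _.
  by rewrite E derive_cst scale0r add0r.
by rewrite scalerDr addrACA.
Qed.

Lemma Lap_lin V Y a x : smooth_on U V -> smooth_on U Y -> U x ->
  Lap G (fun y => a *: V y + Y y) x = a *: Lap G V x + Lap G Y x.
Proof.
move=> sV sY Ux; have dV y Uy := @smooth_on_differentiable _ _ _ _ V y sV Uy.
have dY y Uy := @smooth_on_differentiable _ _ _ _ Y y sY Uy.
have E i : nabla G (Ef G i) (nabla G (Ef G i) (fun y => a *: V y + Y y)) x
    - nabla G (nabla G (Ef G i) (Ef G i)) (fun y => a *: V y + Y y) x =
  a *: (nabla G (Ef G i) (nabla G (Ef G i) V) x - nabla G (nabla G (Ef G i) (Ef G i)) V x)
  + (nabla G (Ef G i) (nabla G (Ef G i) Y) x - nabla G (nabla G (Ef G i) (Ef G i)) Y x).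
  have sE := smooth_on_Ef mG i.
  have d1 := smooth_on_differentiable (smooth_on_nabla mG sE sV) Ux.
  have d2 := smooth_on_differentiable (smooth_on_nabla mG sE sY) Ux.
  have E1 := @eq_nabla _ _ _ _ mG (Ef G i) (nabla G (Ef G i) (fun y => a *: V y + Y y))
    (fun y => a *: nabla G (Ef G i) V y + nabla G (Ef G i) Y y) x Ux
    (fun y Uy => nabla_linr (Ef G i) a (dV y Uy) (dY y Uy)).
  rewrite E1 (nabla_linr _ _ d1 d2) (nabla_linr _ _ (dV x Ux) (dY x Ux)).
  move: (nabla _ _ _ _) (nabla _ _ _ _) (nabla _ _ _ _) (nabla _ _ _ _) => u1 u2 u3 u4.
  by rewrite scalerBr opprD addrACA.
rewrite /Lap (eq_bigr _ (fun i _ => E i)) big_split /= -scaler_sumr.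
by rewrite opprD scalerN.
Qed.

Lemma S2_linl V Y X a x : U x ->
  S2 G phi (fun y => a *: V y + Y y) X x = a *: S2 G phi V X x + S2 G phi Y X x.
Proof.
move=> Ux; rewrite /S2 scaler_sumr -big_split; apply: eq_bigr => i _ /=.
by rewrite mulmxDl -scalemxAl (Rm_lin1 mG).
Qed.

Lemma S2_linr V Y X a x : U x -> differentiable V x -> differentiable Y x ->
  S2 G phi X (fun y => a *: V y + Y y) x = a *: S2 G phi X V x + S2 G phi X Y x.
Proof.
move=> Ux dV dY; rewrite /S2 scaler_sumr -big_split; apply: eq_bigr => i _ /=.
by rewrite (nabla_linr _ _ dV dY) (Rm_lin2 mG).
Qed.

Variables d1 d2 : R.

Lemma variation_density_lin X V Y a x : smooth_on U V -> smooth_on U Y -> U x ->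
  variation_density G phi d1 d2 X (fun y => a *: V y + Y y) x =
  a * variation_density G phi d1 d2 X V x + variation_density G phi d1 d2 X Y x.
Proof.
move=> sV sY Ux; have dV := smooth_on_differentiable sV Ux.
have dY := smooth_on_differentiable sY Ux.
rewrite /variation_density (Lap_lin a sV sY Ux) (S2_linl V Y X a Ux) (S2_linr X a Ux dV dY).
rewrite (eq_bigr (fun i => a * bform (Pm G phi x) (nabla G (Ef G i) X x) (nabla G (Ef G i) V x)
   + bform (Pm G phi x) (nabla G (Ef G i) X x) (nabla G (Ef G i) Y x))); last first.
  by move=> i _; rewrite (nabla_linr _ _ dV dY) bformDr bformZr.
rewrite big_split /= -mulr_sumr !bformDr !bformZr.
move: (\sum_i _) (\sum_i _) (bform _ _ _) (bform _ _ _) (bform _ _ _) => b1 b2 b3 b4 b5.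
move: (bform _ _ _) (bform _ _ _) (bform _ _ _) => b6 b7 b8; ring.
Qed.

Lemma variation_density0 X x : U x -> variation_density G phi d1 d2 X (fun=> 0) x = 0.
Proof.
move=> Ux; have s0 : smooth_on U (fun=> 0 : 'rV[R]_n) by exact: smooth_on_cst.
have := variation_density_lin X (-1) s0 s0 Ux.
rewrite (_ : (fun y => _) = fun=> 0); last by apply/funext => y; rewrite scaler0 addr0.
by rewrite mulN1r addNr.
Qed.

Lemma eq_variation_density X X' V V' x : U x -> (forall y, U y -> X y = X' y) ->
  (forall y, U y -> V y = V' y) ->
  variation_density G phi d1 d2 X V x = variation_density G phi d1 d2 X' V' x.
Proof.
move=> Ux XX VV.
have NX e : nabla G e X x = nabla G e X' x by exact: (eq_nabla mG).
have NV e : nabla G e V x = nabla G e V' x by exact: (eq_nabla mG).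
have SS A A' B B' : A x = A' x -> (forall e, nabla G e B x = nabla G e B' x) ->
    S2 G phi A B x = S2 G phi A' B' x.
  by move=> AA BB; rewrite /S2 AA; apply: eq_bigr => i _; rewrite BB.
rewrite /variation_density (eq_Lap mG XX Ux) (eq_Lap mG VV Ux).
rewrite (SS X X' X X' (XX x Ux) NX) (SS V V' X X' (VV x Ux) NX) (SS X X' V V' (XX x Ux) NV).
by under eq_bigr => i _ do rewrite NX NV.
Qed.

End VariationLinear.

(** The derivatives of a slice are derivatives of [F] in the directions (0, v), so smoothness is
    inherited. *)
Lemma smooth_on_slice (R : realType) n m k (W : set (R * 'rV[R]_n))
    (F : R * 'rV[R]_n -> 'M[R]_(m, k)) t : open W -> smooth_on W F ->
  smooth_on [set x | W (t, x)] (slice F t).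
Proof.
move=> oW sF.
have E s : forall x, W (t, x) -> Defs.iterD s (slice F t) x =
    slice (Defs.iterD [seq (0 : R, v : 'rV[R]_n) | v <- s] F) t x.
  elim: s => [//|v s IH] x Wx /=.
  have [_ E] := derive_slice v (sF [seq (0 : R, v) | v <- s] _ Wx).
  rewrite -[RHS]/('D_(0, v) _ (t, x)) -E; apply: near_eq_derive.
  by apply: filterS (near_slice oW Wx) => y Wy; exact: IH.
move=> s x Wx.
have [d _] := derive_slice (0 : 'rV[R]_n) (sF [seq (0 : R, v) | v <- s] _ Wx).
apply: near_eq_differentiable d.
by apply: filterS (near_slice oW Wx) => y Wy; rewrite E.
Qed.

(** * The first variation as an additive functional of the velocity field *)

Section FirstVariationField.
Variables (R : realType) (n : nat) (M : manifold R n).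
Variables (phi : endo_field M) (g : riemannian_metric M) (vg : borel_measure M).
Local Notation rV := 'rV[R]_n.
Local Notation Z := (R * rV)%type.
Local Notation bM := (g_sigma_algebraType (@open M)).
Implicit Types (c : chart M) (p : M) (x y v w : rV) (X V xi : vector_field M) (s t : R).

Hypothesis phi2 : forall c x, img c x -> phi c x *m phi c x = 1%:M.
Hypothesis phi_self : forall c x v w, img c x ->
  bform (g c x) (v *m phi c x) w = bform (g c x) v (w *m phi c x).
Hypothesis phi_par : forall c (X Y : vfield R n),
  smooth_on (img c) X -> smooth_on (img c) Y ->
  forall x, img c x -> nabla_endo (g c) (phi c) X Y x = 0.
Hypothesis hvg : riemannian_volume g vg.
Variables (d1 d2 : R) (xi : vector_field M).

Lemma smooth_on_fst (U : set Z) : smooth_on U (fun z : Z => z.1).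
Proof. by apply: (@smooth_on_linear _ _ _ _ (@fst R rV : {linear Z -> R})) => z;
  exact: cvg_fst. Qed.

Section AddField.
Variable V : vector_field M.

Definition add_field t : vector_field M := sval (field_add t xi V).

Lemma add_fieldE t c x : add_field t c x = xi c x + t *: V c x.
Proof. by rewrite /add_field; case: (field_add t xi V). Qed.

Lemma add_field_family (eps : R) c :
  smooth_on (time_chart eps c) (fun z => add_field z.1 c z.2).
Proof.
have oW := @open_time_chart _ _ _ eps c; have WU := @time_chart_img _ _ _ eps c.
rewrite (_ : (fun z => _) = (fun z : Z => xi c z.2 + z.1 *: V c z.2)); last first.
  by apply/funext => z; rewrite add_fieldE.
apply: smooth_onD => //;
  first exact: (smooth_on_base (metric_on_img g c) oW WU (@vcomp_smooth _ _ _ xi c)).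
apply: smooth_on_scale => //; first exact: smooth_on_fst.
exact: (smooth_on_base (metric_on_img g c) oW WU (@vcomp_smooth _ _ _ V c)).
Qed.

(** The linear variation xi + s V has velocity [V], so this is [variation_density] in a form free of
    charts, ready to be integrated over [D]. *)
Definition first_var p : R := 'D_1 (fun s => total_density phi g d1 d2 (add_field s) p) 0.

Let lt01 : `|0 : R| < 1. Proof. by rewrite normr0. Qed.

Lemma first_varE c p : dom c p ->
  first_var p = variation_density (g c) (phi c) d1 d2 (xi c) (V c) (coord c p).
Proof.
move=> cp; have ip := img_coord cp.
have [_ E] := family_derive phi2 phi_self phi_par (@add_field_family 1) d1 d2 lt01 cp.
have W0 y : img c y -> time_chart 1 c (0, y) by move=> iy; split.
apply: etrans E _.
apply: etrans (dt_energy_densityP (metric_on_img g c) (@smooth_on_phi _ _ _ phi c) (@phi_self c)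
  (@open_time_chart _ _ _ 1 c) (@time_chart_img _ _ _ 1 c) d1 d2 (@add_field_family 1 c) (W0 _
    ip)) _.
apply: (eq_variation_density _ (metric_on_img g c)) => // y iy.
  by rewrite /slice add_fieldE scale0r addr0.
rewrite /slice.
have dF := smooth_on_differentiable (@add_field_family 1 c) (W0 _ iy).
have [_ <-] := derive_time dF.
have dc (a : rV) : differentiable (fun=> a) (0 : R) by exact: differentiable_cst.
have di : differentiable (@id R) (0 : R) by [].
have [ds Es] := derive_scale (1 : R) di (dc (V c y)).
rewrite (_ : (fun s => _) = (fun s : R => xi c y + s *: V c y)); last first.
  by apply/funext => s; rewrite add_fieldE.
apply: etrans (deriveD (diff_derivable (dc _)) (diff_derivable ds)) _.
by rewrite Es !derive_cst derive_id scale1r scaler0 addr0 add0r.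
Qed.

Lemma continuous_first_var p : {for p, continuous first_var}.
Proof.
have H := continuous_slice (@continuous_density_derive _ _ _ _ _ phi2 phi_self phi_par _ _
  (@add_field_family 1) d1 d2 0 p lt01).
by move=> A nA; exact: (H A nA).
Qed.

End AddField.

Definition zero_off (V : vector_field M) (K : set M) :=
  forall c p, dom c p -> ~ K p -> V c (coord c p) = 0.

(** As [K] is closed, [V] vanishes in a neighbourhood of [p], so all its derivatives in the density
    vanish there too. *)
Lemma first_var_off V K p : closed K -> zero_off V K -> ~ K p -> first_var V p = 0.
Proof.
move=> clK V0 Kp; have [c cp] := dom_cover p; rewrite (first_varE _ cp).
pose N := [set x | img c x /\ (~` K) (param c x)].
have oN : open N by apply: open_param_preimage; exact: closed_openC.
have Np : N (coord c p) by split; [exact: img_coord|rewrite /= coordK].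
have mN : metric_on N (g c) by apply: metric_onS (metric_on_img g c) => // x [].
rewrite (@eq_variation_density _ _ _ _ _ mN _ _ _ (xi c) _ (fun=> 0) _ Np)//.
  exact: variation_density0 mN _ _ _ _ Np.
by move=> y [iy Ky]; rewrite -(paramK iy) V0//; exact: dom_param.
Qed.

Variables (D : set M).
Hypotheses (oD : open D) (cD : compact (closure D)).

Definition first_variation_int V : R := \int[vg]_(p in D) first_var V p.
Local Notation L := first_variation_int.

Lemma first_variation_int_add V V1 V2 :
  (forall c x, img c x -> V c x = V1 c x + V2 c x) -> L V = L V1 + L V2.
Proof.
move=> E; rewrite /L -RintegralD; last 3 first.
- exact: measurable_open.
- by apply: (integrable_continuous hvg oD cD); exact: continuous_first_var.
- by apply: (integrable_continuous hvg oD cD); exact: continuous_first_var.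
apply: eq_Rintegral => p _; have [c cp] := dom_cover p; rewrite !(first_varE _ cp).
have ip := img_coord cp.
rewrite (@eq_variation_density _ _ _ _ _ (metric_on_img g c) _ _ _ (xi c) _
  (fun y => 1 *: V1 c y + V2 c y) _ ip)//; last by move=> y iy; rewrite E// scale1r.
by rewrite (variation_density_lin _ (metric_on_img g c)) ?mul1r//; exact: vcomp_smooth.
Qed.

(** The integrand vanishes off [K1] and off [K2], so the integrals over [D] and over the chart
    domain agree; [first_variation] then applies with the compact image of [K2] in the chart. *)
Lemma first_variation_int_chart V c (K1 K2 : set M) :
  closed K1 -> K1 `<=` D -> zero_off V K1 ->
  compact K2 -> K2 `<=` dom c -> zero_off V K2 ->
  L V = 2 * chart_int (g c) (img c) (fun x =>
    bform (Pm (g c) (phi c) x) (sesqui_lhs d1 d2 (g c) (phi c) (xi c) x) (V c x)).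
Proof.
move=> clK1 K1D V1 cK2 K2c V2.
have clK2 : closed K2 by exact: (compact_closed (@mspace_hausdorff _ _ M)).
have E : L V = \int[vg]_(p in dom c) first_var V p.
  rewrite /L Rintegral_mkcond [RHS]Rintegral_mkcond; congr Rintegral; apply/funext => p.
  have [K1p|K1p] := pselect (K1 p); have [K2p|K2p] := pselect (K2 p).
  - by rewrite !patchE !mem_set//; [exact: K2c|exact: K1D].
  - by rewrite !patchE (first_var_off clK2 V2 K2p); case: ifP; case: ifP.
  - by rewrite !patchE (first_var_off clK1 V1 K1p); case: ifP; case: ifP.
  - by rewrite !patchE (first_var_off clK1 V1 K1p); case: ifP; case: ifP.
rewrite E (Rintegral_chart hvg); last first.
  apply: (@measurable_continuous_on R M) => [|p _]; first exact: dom_open.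
  exact: continuous_first_var.
pose K := coord c @` K2.
have cK : compact K.
  apply: continuous_compact => //; apply: continuous_in_subspaceT => p.
  by rewrite inE => Kp; apply: Defs.coord_continuous; rewrite inE; exact: K2c.
have KU : K `<=` img c by move=> _ [p Kp <-]; apply: img_coord; exact: K2c.
have clK : closed K by exact: (compact_closed (@norm_hausdorff _ _)).
have mG := metric_on_img g c.
rewrite (@chart_int_eq _ _ (g c) (img c) _ (variation_density (g c) (phi c) d1 d2 (xi c) (V c)));
  last first.
  move=> x ix; rewrite (first_varE _ (dom_param ix)) paramK//.
apply: (@first_variation _ _ _ _ (img c) K mG) => //.
- exact: smooth_on_phi.
- exact: phi_self.
- exact: phi_par.
- exact: chart_int_eq.
- by move=> f h cf ch; exact: (chart_intD mG cK KU).
- by move=> a f cf; exact: (chart_intZ mG cK KU).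
- by move=> f X cf sX; exact: (chart_int_div mG cK KU).
- exact: vcomp_smooth.
- exact: vcomp_smooth.
- move=> x ix Kx; rewrite -(paramK ix); apply: V2; first exact: dom_param.
  by move=> Kp; apply: Kx; exists (param c x) => //; exact: paramK.
Qed.

End FirstVariationField.

Lemma smooth_on_sesqui_lhs (R : realType) n (G phi : mfield R n) (U : set 'rV[R]_n)
    (d1 d2 : R) (X : vfield R n) : metric_on U G -> smooth_on U phi -> smooth_on U X ->
  smooth_on U (sesqui_lhs d1 d2 G phi X).
Proof.
move=> mG sphi sX; have oU : open U by case: mG.
have sE i := smooth_on_Ef mG i.
have sL := smooth_on_Lap mG sX; have sLL := smooth_on_Lap mG sL.
have sS := smooth_on_S2 mG sphi sX sX.
have s1 i := smooth_on_nabla mG (sE i) (smooth_on_Rf mG (sE i) sS sX).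
have s2 i := smooth_on_Rf mG (smooth_on_nabla mG (sE i) (sE i)) sS sX.
have s3 i := smooth_on_Rf mG (sE i) sS (smooth_on_nabla mG (sE i) sX).
pose f x := d1 *: Lap G X x + d2 *: Lap G (Lap G X) x
  - d2 *: \sum_i (nabla G (Ef G i) (Rf G (Ef G i) (S2 G phi X X) X) x
     - Rf G (nabla G (Ef G i) (Ef G i)) (S2 G phi X X) X x
     + Rf G (Ef G i) (S2 G phi X X) (nabla G (Ef G i) X) x).
apply: (@eq_smooth_on _ _ _ _ f) => //.
  by move=> x Ux; rewrite (sesqui_lhsE mG sphi _ _ sX Ux).
have sc (a : R) (F : vfield R n) : smooth_on U F -> smooth_on U (fun x => a *: F x).
  by move=> sF; apply: smooth_on_scale => //; exact: smooth_on_cst.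
apply: smooth_onB => //; first by apply: smooth_onD => //; exact: sc.
apply: sc; apply: smooth_on_sum => // i _; apply: smooth_onD => //.
exact: smooth_onB.
Qed.

(** * Equivalence of criticality and the equation *)

Section Main.
Variables (R : realType) (n : nat) (M : manifold R n).
Variables (phi : endo_field M) (g : riemannian_metric M) (vg : borel_measure M).
Local Notation rV := 'rV[R]_n.
Local Notation Z := (R * rV)%type.
Local Notation bM := (g_sigma_algebraType (@open M)).
Local Notation mu := (@lebesgue_row R n).
Implicit Types (c : chart M) (p : M) (x y v w : rV) (X V : vector_field M) (s t : R).

Hypothesis phi2 : forall c x, img c x -> phi c x *m phi c x = 1%:M.
Hypothesis phi_self : forall c x v w, img c x ->
  bform (g c x) (v *m phi c x) w = bform (g c x) v (w *m phi c x).
Hypothesis phi_par : forall c (X Y : vfield R n),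
  smooth_on (img c) X -> smooth_on (img c) Y ->
  forall x, img c x -> nabla_endo (g c) (phi c) X Y x = 0.
Hypothesis hvg : riemannian_volume g vg.
Variables (d1 d2 : R) (xi : vector_field M).

Definition bump (f : M -> R) := smooth_fun f /\
  exists c (K : set M), [/\ compact K, K `<=` dom c & forall p, ~ K p -> f p = 0].

Lemma bump_at p : exists (f : M -> R) (N : set M),
  [/\ bump f, open N, N p & forall q, N q -> f q = 1].
Proof.
have [c cp] := dom_cover p; have [r r0 Hr] := closed_ball_img (img_coord cp).
have [b [sb b_ge0 b1 b0]] := plateau_exists (coord c p) r0.
have cK := @compact_closed_ball _ _ (coord c p) r r0.
have b0' x : ~ closed_ball (coord c p) r x -> b x = 0.
  by move=> Kx; apply: b0 => bx; apply: Kx; exact: subset_closed_ball.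
have [f [sf fE f0]] := function_extend cK Hr sb b0'.
exists f, [set q | dom c q /\ ball (coord c p) (r / 2) (coord c q)]; split.
- split=> //; exists c, (param_set c (closed_ball (coord c p) r)); split=> //.
    exact: param_set_compact.
  exact: param_set_dom.
- by apply: open_coord_preimage; exact: ball_open.
- by split=> //; apply: ballxx; rewrite divr_gt0.
- by move=> q [cq bq]; rewrite fE// b1.
Qed.

Fixpoint all_bumps (fs : seq (M -> R)) : Prop :=
  if fs is f :: fs' then bump f /\ all_bumps fs' else True.

Lemma all_bumps_cat fs fs' : all_bumps fs -> all_bumps fs' -> all_bumps (fs ++ fs').
Proof. by elim: fs => //= f fs IH [bf /IH H] /H. Qed.

(** At each point of [K] some bump equals 1, which is what the vanishing product records. This is
    enough to cut up a field and avoids normalising to a partition of unity. *)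
Lemma bump_cover (K : set M) : compact K -> exists2 fs, all_bumps fs &
  forall p, K p -> \prod_(f <- fs) (1 - f p) = 0.
Proof.
move=> cK; apply: (compact_ind (P := fun K => exists2 fs, all_bumps fs &
  forall p, K p -> \prod_(f <- fs) (1 - f p) = 0) cK).
- by exists [::].
- move=> A B [fs bfs fsA] [fs' bfs' fsB]; exists (fs ++ fs'); first exact: all_bumps_cat.
  by move=> p; rewrite big_cat /= => -[/fsA ->|/fsB ->]; rewrite ?mul0r ?mulr0.
- by move=> A B AB [fs bfs fsB]; exists fs => // p /AB /fsB.
- move=> p _; have [f [N [bf oN Np f1]]] := bump_at p; exists N; split=> //.
  by exists [:: f] => //= q /f1; rewrite big_seq1 => ->; rewrite subrr.
Qed.

Variable D : set M.
Hypotheses (oD : open D) (cD : compact (closure D)).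

Local Notation L := (first_variation_int phi g vg d1 d2 xi D).

(* Bumps [fs] with [\prod (1 - f) = 0] on [K] split [V] into the fields
   [f_i \prod_(j < i) (1 - f_j) V], each supported in one chart. *)
Lemma first_variation_int_zero V (K : set M) :
  (forall c x, img c x -> sesqui_lhs d1 d2 (g c) (phi c) (xi c) x = 0) ->
  closed K -> K `<=` D -> zero_off V K -> L V = 0.
Proof.
move=> lhs0 clK KD V0.
have cK : compact K by apply: subclosed_compact cD _ => //; apply: subset_trans KD _;
  exact: subset_closure.
have [fs bfs fsK] := bump_cover cK.
have addL V' V1 V2 := first_variation_int_add phi2 phi_self phi_par hvg d1 d2 xi oD cD (V := V')
  (V1 := V1) (V2 := V2).
(* The induction over the bumps needs the weaker assumption that the product of the 1 - f
   annihilates [V], because after each step [V] is replaced by (1 - f) V. *)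
suff H : forall (fs : seq (M -> R)) V, all_bumps fs -> zero_off V K ->
    (forall c p, dom c p -> \prod_(f <- fs) (1 - f p) *: V c (coord c p) = 0) -> L V = 0.
  apply: (H fs) => // c p cp; have [Kp|Kp] := pselect (K p); last by rewrite V0// scaler0.
  by rewrite fsK// scale0r.
move=> {bfs fsK V V0} {fs}; elim=> [|f fs IH] V /= bfs V0 VP.
  (* For the empty list [V] is zero, hence V = V + V, and additivity forces L V = 0. *)
  have E : L V = L V + L V.
    apply: addL => c x ix; have := VP c (param c x) (dom_param ix).
    by rewrite big_nil scale1r paramK// => ->; rewrite addr0.
  by move: E; move: (L V) => a E; apply: (addrI a); rewrite addr0 -E.
have [[sf [c [K2 [cK2 K2c f0]]]] bfs'] := bfs.
have sf' : smooth_fun (fun p => 1 - f p).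
  by move=> e; apply: smooth_onB; [exact: open_img|exact: smooth_on_cst|exact: sf].
have [V1 V1E] := field_scale V sf; have [V2 V2E] := field_scale V sf'.
rewrite (addL V V1 V2); last by move=> e x _; rewrite V1E V2E -scalerDl addrC subrK scale1r.
have z1 : zero_off V1 K by move=> e p ep Kp; rewrite V1E V0// scaler0.
have z2 : zero_off V2 K by move=> e p ep Kp; rewrite V2E V0// scaler0.
have z1' : zero_off V1 K2 by move=> e p ep Kp; rewrite V1E coordK// f0// scale0r.
rewrite (IH V2 bfs' z2) ?addr0; last first.
  move=> e p ep; rewrite V2E coordK// scalerA [_ * (1 - f p)]mulrC.
  by have := VP e p ep; rewrite big_cons.
rewrite (first_variation_int_chart phi2 phi_self phi_par hvg d1 d2 xi clK KD z1 cK2 K2c z1').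
rewrite (@chart_int_eq _ _ _ _ _ (fun=> 0)); last by move=> x ix; rewrite lhs0// bform0l.
rewrite /chart_int (_ : Rintegral _ _ _ = 0) ?mulr0//.
by rewrite /Rintegral integral0_eq// => x _; rewrite mul0r.
Qed.

Section Variation.
Variables (eps : R) (xit : R -> vector_field M).
Hypothesis eps0 : 0 < eps.
Hypothesis fam : forall c, smooth_on (time_chart eps c) (fun z => xit z.1 c z.2).
Local Notation F c := (fun z : Z => xit z.1 c z.2).

Let eps00 : `|0 : R| < eps. Proof. by rewrite normr0. Qed.

Let fam_time c p : dom c p ->
  differentiable (fun s => xit s c (coord c p)) (0 : R) /\
  'D_1 (fun s => xit s c (coord c p)) (0 : R) = dt (F c) (0, coord c p).
Proof.
move=> cp; have Wz : time_chart eps c (0, coord c p) by split=> //; exact: img_coord.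
exact: derive_time (smooth_on_differentiable (@fam c) Wz).
Qed.

(** The differential of a transition map at a fixed point is linear and independent of time, so it
    commutes with the time derivative and the velocity is again a vector field. *)
Lemma variation_field : {V : vector_field M | forall c x, img c x -> V c x = dt (F c) (0, x)}.
Proof.
have s c : smooth_on (img c) (slice (dt (F c)) 0).
  have H := @smooth_on_slice _ _ _ _ _ _ (0 : R) (@open_time_chart _ _ _ eps c) (smooth_on_dt
    (@fam c)).
  apply: (@smooth_on_sub _ _ _ _ [set x | time_chart eps c (0, x)]) => // x ix.
have ch c d p : dom c p -> dom d p ->
    slice (dt (F d)) 0 (coord d p) = tchange c d p (slice (dt (F c)) 0 (coord c p)).
  move=> cp dp; have [dc Ec] := fam_time cp; have [dd Ed] := fam_time dp.
  rewrite /slice -Ec -Ed.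
  have lt a u v : tchange c d p (a *: u + v) = a *: tchange c d p u + tchange c d p v.
    by rewrite tchangeD// tchangeZ.
  have [_ <-] := derive_lin lt dc.
  have FE : (fun s => xit s d (coord d p)) = (fun s => tchange c d p (xit s c (coord c p))).
    by apply/funext => s'; exact: vcomp_change.
  by rewrite FE.
by exists (VectorField s ch) => c x ix.
Qed.

Lemma family_first_var V p : (forall q, eq_at (xit 0) xi q) ->
  (forall c x, img c x -> V c x = dt (F c) (0, x)) ->
  'D_1 (fun s => total_density phi g d1 d2 (xit s) p) 0 = first_var phi g d1 d2 xi V p.
Proof.
move=> xi0 VE; have [c cp] := dom_cover p; have ip := img_coord cp.
have W0 y : img c y -> time_chart eps c (0, y) by move=> iy; split.
rewrite (first_varE phi2 phi_self phi_par d1 d2 xi V cp).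
have [_ E] := family_derive phi2 phi_self phi_par fam d1 d2 eps00 cp.
apply: etrans E _.
apply: etrans (dt_energy_densityP (metric_on_img g c) (@smooth_on_phi _ _ _ phi c) (@phi_self c)
  (@open_time_chart _ _ _ eps c) (@time_chart_img _ _ _ eps c) d1 d2 (@fam c) (W0 _ ip)) _.
apply: (eq_variation_density _ (metric_on_img g c)) => // y iy; last by rewrite VE.
by have := xi0 (param c y) c (dom_param iy); rewrite paramK.
Qed.

Lemma critical_of_lhs : (forall q, eq_at (xit 0) xi q) -> supported_in xi eps xit D ->
  (forall c x, img c x -> sesqui_lhs d1 d2 (g c) (phi c) (xi c) x = 0) ->
  is_derive (0 : R) (1 : R) (fun t => sesqui_energy phi g vg d1 d2 D (xit t)) 0.
Proof.
move=> xi0 supp lhs0; have [V VE] := variation_field.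
have dE := derive_energy phi2 phi_self phi_par hvg eps0 fam d1 d2 oD cD.
suff E0 : \int[vg]_(p in D) 'D_1 (fun s => total_density phi g d1 d2 (xit s) p) 0 = 0.
  by move: dE; rewrite E0.
rewrite (_ : (fun p => _) = first_var phi g d1 d2 xi V); last first.
  by apply/funext => p; exact: family_first_var.
apply: (first_variation_int_zero lhs0 (@closed_closure _ _) supp) => c p cp Kp.
rewrite VE; last exact: img_coord.
have [_ <-] := fam_time cp.
(* Off the support the family equals [xi] for all small times, so its velocity vanishes there. *)
rewrite -(derive_cst (xi c (coord c p)) (0 : R) 1); apply: near_eq_derive.
apply: filterS (near_time eps00) => s se /=.
apply: contrapT => ne; apply: Kp; apply: subset_closure; exists s => // H.
by apply: ne; exact: H.
Qed.

End Variation.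

(** The integrand, volume density included, exceeds half of its value at [x0] on a small ball, which
    has positive measure. *)
Lemma chart_int_gt0 c (K : set rV) (h : rV -> R) x0 : compact K -> K `<=` img c ->
  cK (img c) K h -> (forall x, img c x -> 0 <= h x) -> img c x0 -> 0 < h x0 ->
  0 < chart_int (g c) (img c) h.
Proof.
move=> cptK KU ch h0 ix0 hx0; have mG := metric_on_img g c.
have inth := chart_integrable mG cptK KU ch.
pose k x := h x * vol (g c) x.
have kx0 : 0 < k x0 by rewrite mulr_gt0// (vol_gt0 mG).
have ck : {for x0, continuous k}.
  apply: differentiable_continuous; apply: smooth_on_differentiable ix0.
  by apply: smooth_onM; [exact: open_img|case: ch|exact: smooth_on_vol].
have nk : \forall x \near x0, k x0 / 2 < k x.
  have := @cvgr_gt _ _ (nbhs x0) _ k (k x0) ck (k x0 / 2); apply.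
  by rewrite ltr_pdivrMr// ltr_pMr// ltr1n.
have : nbhs x0 ([set x | k x0 / 2 < k x] `&` img c).
  by apply: filterI => //; apply: open_nbhs_nbhs; split=> //; exact: open_img.
move=> /nbhs_ballP[r /= r0 Hr].
have mU : measurable (img c : set (g_sigma_algebraType (@open rV))) by exact: measurable_img.
have mB : measurable (ball x0 r : set (g_sigma_algebraType (@open rV))).
  by apply: measurable_open; exact: ball_open.
have Boo : (mu (ball x0 r) < +oo)%E by rewrite lebesgue_row_ball// ltry.
pose l x := k x0 / 2 * \1_(ball x0 r) x.
have k2 : 0 < k x0 / 2 by rewrite divr_gt0.
have intl : mu.-integrable (img c) (EFin \o l).
  apply: (@integrable_dominated _ _ mu (img c) (ball x0 r) l (k x0 / 2)) => //.
    by apply: measurable_funM => //; apply: measurable_funTS; exact: measurable_indic.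
  by move=> x _; rewrite ger0_norm// mulr_ge0// ltW.
apply: (@lt_le_trans _ _ (\int[mu]_(x in img c) l x)); last first.
  apply: le_Rintegral => // x ix; rewrite /l indicE.
  have [xB|xB] := boolP (x \in (ball x0 r : set rV)).
    rewrite mulr1; move: xB; rewrite inE => /Hr[/ltW]; done.
  by rewrite mulr0 mulr_ge0 ?h0// vol_ge0.
rewrite /l RintegralZl//; last first.
  apply: (@integrable_dominated _ _ mu (img c) (ball x0 r) _ 1) => //.
  by move=> x _; rewrite ger0_norm// mul1r.
rewrite mulr_gt0// /Rintegral integral_indic//.
rewrite (_ : _ `&` _ = ball x0 r); last by apply/seteqP; split=> [x []//|x xB]; split=> //;
  have [] := Hr x xB.
by rewrite lebesgue_row_ball//= exprn_gt0// mulr_gt0.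
Qed.

(* The variation field is a bump times the constant [w = phi H], where [H] is the
   value of the left-hand side at [x0]: then [g(H, phi w) = g(H, H)] since
   [phi^2 = 1]. *)
Lemma lhs_of_critical c x0 : critical_on phi g vg d1 d2 xi D -> img c x0 ->
  D (param c x0) -> sesqui_lhs d1 d2 (g c) (phi c) (xi c) x0 = 0.
Proof.
move=> crit ix0 Dx0; apply: contrapT => /eqP lhs0.
have mG := metric_on_img g c.
pose H := sesqui_lhs d1 d2 (g c) (phi c) (xi c).
pose w := H x0 *m phi c x0.
pose h x := bform (Pm (g c) (phi c) x) (H x) w.
have sH : smooth_on (img c) H.
  exact: (smooth_on_sesqui_lhs _ _ mG (@smooth_on_phi _ _ _ phi c) (@vcomp_smooth _ _ _ xi c)).
have sh : smooth_on (img c) h.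
  apply: smooth_on_bform => //; [exact: open_img| |exact: smooth_on_cst].
  exact: (smooth_on_Pm mG (@smooth_on_phi _ _ _ phi c)).
have hx0 : 0 < h x0.
  rewrite /h PmE /w -mulmxA phi2// mulmx1.
  by apply: gcomp_pos.
have nh : \forall x \near x0, 0 < h x.
  have ch := differentiable_continuous (smooth_on_differentiable sh ix0).
  by have := @cvgr_gt _ _ (nbhs x0) _ h (h x0) ch 0; apply.
have nI : nbhs x0 (img c) by apply: open_nbhs_nbhs; split=> //; exact: open_img.
have nD := near_param ix0 oD Dx0.
have : nbhs x0 ([set x | 0 < h x] `&` (img c `&` [set x | D (param c x)])).
  by apply: filterI => //; exact: filterI.
move=> /nbhs_ballP[e /= e0 He].
(* Half the radius, so that the closed ball stays inside the open ball on which [h] is positive. *)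
pose r := e / 2; have r0 : 0 < r by rewrite divr_gt0.
pose K := closed_ball x0 r.
have KN : K `<=` ball x0 e.
  by apply: closed_ball_subset => //; rewrite ltr_pdivrMr// ltr_pMr// ltr1n.
have Kc : K `<=` img c by move=> x /KN /He[_ []].
have cptK : compact K by exact: compact_closed_ball.
have [b [sb b_ge0 b1 b0]] := plateau_exists x0 r0.
have b0' x : ~ K x -> b x = 0 by move=> Kx; apply: b0 => bx; apply: Kx; exact: subset_closed_ball.
have sbc : smooth_on (img c) b by apply: smooth_on_sub sb.
have sX : smooth_on (img c) (fun x => b x *: w).
  by apply: smooth_on_scale => //; [exact: open_img|exact: smooth_on_cst].
have [|V [VE V0]] := field_extend cptK Kc sX; first by move=> x _ Kx; rewrite b0'// scale0r.
pose PK := param_set c K.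
have clPK : closed PK by exact: param_set_closed.
have z : zero_off V PK by move=> d p dp Kp; exact: V0.
have PKD : PK `<=` D by move=> _ [x /KN /He[_ [_ Dx]] <-].
have LE := first_variation_int_chart phi2 phi_self phi_par hvg d1 d2 xi clPK PKD z
  (param_set_compact cptK Kc) (param_set_dom Kc) z.
pose xit := add_field xi V.
have fam := @add_field_family _ _ _ g xi V 1.
have xi0 q : eq_at (xit 0) xi q by move=> d dq; rewrite add_fieldE scale0r addr0.
have supp : supported_in xi 1 xit D.
  apply: subset_trans PKD; rewrite [X in _ `<=` X](closure_id PK).1//.
  apply: closureS => p [t _ ne]; apply: contrapT => Kp; apply: ne => d dp.
  by rewrite add_fieldE z// scaler0 addr0.
(* The linear variation exists for all times; 1 is an arbitrary time range. *)
have [dE0 E0] := crit 1 xit ltr01 (conj xi0 fam) supp.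
have [_ E1] := derive_energy phi2 phi_self phi_par hvg ltr01 fam d1 d2 oD cD.
have L0 : L V = 0 by rewrite -E0 E1.
have hb : cK (img c) K (fun x => h x * b x).
  split; first by apply: smooth_onM => //; exact: open_img.
  by move=> x _ Kx; rewrite b0'// mulr0.
have : 0 < chart_int (g c) (img c) (fun x => h x * b x).
  apply: (chart_int_gt0 cptK Kc hb _ ix0) => [x ix|].
    have [Kx|Kx] := pselect (K x); last by rewrite b0'// mulr0.
    by have [hx _] := He x (KN x Kx); apply: (mulr_ge0 (ltW hx)); exact: b_ge0.
  by rewrite b1 ?mulr1//; apply: ballxx; rewrite divr_gt0.
rewrite (@chart_int_eq _ _ _ _ _ (fun x => bform (Pm (g c) (phi c) x) (H x) (V c x))); last first.
  by move=> x ix; rewrite VE// bformZr mulrC.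
by move: LE; rewrite L0 => /esym/eqP; rewrite mulf_eq0 pnatr_eq0 /= => /eqP ->; rewrite ltxx.
Qed.

End Main.

Theorem corollary5p8 (R : realType) (d1 d2 : R) (m : nat)
    (M : manifold R (2 * m)) (phi : endo_field M) (g : riemannian_metric M)
    (vg : borel_measure M) (pkn : para_kahler_norden phi g)
    (hvg : riemannian_volume g vg) (xi : vector_field M) :
  interpolating_sesqui_harmonic phi g vg d1 d2 xi <->
  (forall (c : chart M) (x : 'rV[R]_(2 * m)), img c x ->
     sesqui_lhs d1 d2 (g c) (phi c) (xi c) x = 0).
Proof.
have [phi2 _ _ phi_self phi_par] := pkn.
have D0 : closure [set: M] = [set: M] by apply/seteqP; split=> // p _; exact: subset_closure.
split=> [[critT critD] c x ix|lhs0].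
  (* For compact [M] the definition tests D = M only; otherwise [D] is taken to be a coordinate ball
     around the point. *)
  have [cM|ncM] := pselect (compact [set: M]).
    apply: (lhs_of_critical phi2 phi_self phi_par hvg (D := setT)) => //.
    - exact: openT.
    - by rewrite D0.
    - exact: critT.
  have [r r0 Hr] := closed_ball_img ix.
  pose D := [set p | dom c p /\ ball x r (Defs.coord c p)].
  have oD : open D by apply: open_coord_preimage; exact: ball_open.
  have cK := @compact_closed_ball _ _ x r r0.
  have cD : compact (closure D).
    (* The closure of [D] lies in the image of the closed ball, which is compact and therefore
       closed in [M]. *)
    apply: subclosed_compact (param_set_compact cK Hr) _; first exact: closed_closure.
    rewrite [X in _ `<=` X](closure_id _).1; last exact: param_set_closed.
    apply: closureS => p [cp bp]; exists (Defs.coord c p); last exact: coordK.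
    exact: subset_closed_ball.
  apply: (lhs_of_critical phi2 phi_self phi_par hvg oD cD) => //.
    exact: critD.
  by split; [exact: dom_param|rewrite paramK//; exact: ballxx].
split=> [cM|_ D oD cD] eps xit eps0 [xi0 fam] supp.
  apply: (critical_of_lhs phi2 phi_self phi_par hvg _ _ eps0 fam) => //.
  - exact: openT.
  - by rewrite D0.
by apply: (critical_of_lhs phi2 phi_self phi_par hvg oD cD eps0 fam).
Qed.
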